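(* Let $n\ge 2$, let $k_1,\dots,k_n$ be nonnegative integers, $\lambda=\sum_{i=1}^nk_i\lambda_i$ and $|\lambda|=\sum_{i=1}^nk_i$. Let $\overline{M}=V_n(\lambda)$ with graded pieces $\overline{M}_r$ be the polynomial realization of the irreducible $\mathfrak{sl}(n+1)$-module with highest weight $\lambda$ described in the context. Then $$\max\{r\in\mathbb{N}\mid\overline{M}_r\ne\{0\}\}=\sum_{i=1}^nk_i=|\lambda|.$$ Moreover, as $\mathfrak{sl}(n)$-modules, $$\overline{M}_0=M=V_{n-1}\Big(\sum_{i=1}^{n-1}k_{i+1}\lambda_i\Big),\qquad\overline{M}_{|\lambda|}=V_{n-1}\Big(\sum_{i=1}^{n-1}k_i\lambda_i\Big),$$ and for $0\le r\le|\lambda|$ the $\mathfrak{sl}(n)$-modules $\overline{M}_r$ and $\overline{M}_{|\lambda|-r}$ have the same number of irreducible components.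
   Context: $E_{i,j}$ denotes the matrix unit with $1$ in position $(i,j)$; the base field is $\mathbb{C}$; $\mathbb{N}=\{0,1,2,\dots\}$. For $\mathfrak{sl}(m+1)$ the Cartan subalgebra is spanned by $h_i=E_{m+2-i,m+2-i}-E_{m+1-i,m+1-i}$ ($1\le i\le m$), the positive root vectors are $E_{i,j}$ with $j<i$, and $\lambda_i(h_r)=\delta_{i,r}$ defines the fundamental weights; $V_m(\mu)$ is the irreducible $\mathfrak{sl}(m+1)$-module of highest weight $\mu$. $\mathfrak{sl}(n)\subset\mathfrak{sl}(n+1)$ is the upper left corner. Construction. For $1\le m\le n$ let $\mathcal{C}_m=\mathbb{C}[x_{i,j}\mid 1\le j\le i\le m]$ and $c_m=-\frac{1}{m+1}\sum_{i=0}^{m-1}(m-i)k_{n-m+1+i}$. $\mathfrak{sl}(m+1)$ acts on $\mathcal{C}_m$ inductively. For $m=1$: $E_{1,2}=x_{1,1}^2\partial_{x_{1,1}}-k_nx_{1,1}$, $E_{2,1}=-\partial_{x_{1,1}}$, $E_{1,1}-E_{2,2}=2x_{1,1}\partial_{x_{1,1}}-k_n$. For $2\le m\le n$: make $\mathcal{C}_{m-1}$ a $\mathfrak{gl}(m)$-module by letting $\sum_{i=1}^mE_{i,i}$ act as the scalar $c_m$; view differential operators on $\mathcal{C}_{m-1}$ as operators on $\mathcal{C}_m$; put $\mathcal{D}_m=\sum_{s=1}^mx_{m,s}\partial_{x_{m,s}}$; and for $i\ne j$ in $\{1,\dots,m\}$ let $E_{i,j}|_{\mathcal{C}_m}=x_{m,i}\partial_{x_{m,j}}+E_{i,j}|_{\mathcal{C}_{m-1}}$,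 $(E_{i,i}-E_{j,j})|_{\mathcal{C}_m}=x_{m,i}\partial_{x_{m,i}}-x_{m,j}\partial_{x_{m,j}}+(E_{i,i}-E_{j,j})|_{\mathcal{C}_{m-1}}$, $E_{i,m+1}|_{\mathcal{C}_m}=x_{m,i}\mathcal{D}_m+c_mx_{m,i}+\sum_{r=1}^mx_{m,r}E_{i,r}|_{\mathcal{C}_{m-1}}$, $E_{m+1,i}|_{\mathcal{C}_m}=-\partial_{x_{m,i}}$, $(E_{m,m}-E_{m+1,m+1})|_{\mathcal{C}_m}=\mathcal{D}_m+x_{m,m}\partial_{x_{m,m}}+c_m+E_{m,m}|_{\mathcal{C}_{m-1}}$. Put $V^{(1)}=\mathrm{Span}\{x_{1,1}^i\mid 0\le i\le k_n\}\subset\mathcal{C}_1$ and $V^{(m)}=U(\mathfrak{sl}(m+1))\,(1\otimes V^{(m-1)})\subset\mathcal{C}_m=\mathbb{C}[x_{m,1},\dots,x_{m,m}]\otimes\mathcal{C}_{m-1}$ for $2\le m\le n$. Then $M=V^{(n-1)}$ (identified with $1\otimes M$), $\overline{M}=V_n(\lambda)=V^{(n)}\subset\mathcal{C}_n$ is the irreducible $\mathfrak{sl}(n+1)$-module with highest weight $\lambda$, and $\overline{M}_r$ is the subspace of elements of $\overline{M}$ homogeneous of degree $r$ in $x_{n,1},\dots,x_{n,n}$; it is an $\mathfrak{sl}(n)$-submodule. *)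

(* Defs.v *)
From mathcomp Require Import all_boot all_order all_algebra.
From mathcomp Require Import mpoly.

Set Implicit Arguments.
Unset Strict Implicit.
Unset Printing Implicit Defensive.

Import GRing.Theory.
Local Open Scope ring_scope.

(* Conventions. The integers k_1, ..., k_n are given by k : nat -> nat, read
   only at arguments 1, ..., n. Row, column and variable indices are ordinals,
   so that E_{i,j} and x_{m,i} (numbered from 1) carry the indices i-1, j-1 here. *)

Section Polynomials.
Variable F : fieldType.

(* C_m = F[x_{i,j} | 1 <= j <= i <= m], built as C_{m-1}[x_{m,1},...,x_{m,m}]
   with C_0 = F. *)
Fixpoint Cpoly (m : nat) : idomainType :=
  if m is p.+1 then {mpoly (Cpoly p)[p.+1]} else F.

Fixpoint cst (m : nat) : F -> Cpoly m :=
  match m return F -> Cpoly m with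
  | 0 => fun a => a
  | p.+1 => fun a => (cst p a)%:MP
  end.

Definition scal (m : nat) (a : F) (f : Cpoly m) : Cpoly m := cst m a * f.

(* f |-> 1 (x) f *)
Definition incl (m : nat) (f : Cpoly m) : Cpoly m.+1 :=
  (f%:MP : {mpoly (Cpoly m)[m.+1]}).

(* An operator on C_m viewed on C_{m+1}, acting on the coefficients. *)
Definition lift_op (m : nat) (T : Cpoly m -> Cpoly m) :
    Cpoly m.+1 -> Cpoly m.+1 :=
  fun f => map_mpoly T (f : {mpoly (Cpoly m)[m.+1]}).

Definition xv (m : nat) (i : 'I_m.+1) : Cpoly m.+1 :=
  ('X_i : {mpoly (Cpoly m)[m.+1]}).

Definition dx (m : nat) (i : 'I_m.+1) (f : Cpoly m.+1) : Cpoly m.+1 :=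
  mderiv i (f : {mpoly (Cpoly m)[m.+1]}).

Definition euler (m : nat) (f : Cpoly m.+1) : Cpoly m.+1 :=
  \sum_(s < m.+1) xv s * dx s f.

Definition span (m : nat) (S : Cpoly m -> Prop) (f : Cpoly m) : Prop :=
  exists (N : nat) (a : 'I_N -> F) (g : 'I_N -> Cpoly m),
    (forall i, S (g i)) /\ f = \sum_(i < N) scal (a i) (g i).

Definition subspace (m : nat) (W : Cpoly m -> Prop) : Prop :=
  W 0 /\ (forall (a : F) f g, W f -> W g -> W (scal a f + g)).

End Polynomials.

Arguments cst {F} m a.

Section Modules.
Variable F : fieldType.

(* An sl(m+1)-module carried by a subspace W of C_p. Elements of sl(m+1) are
   traceless matrices; the values of act on other matrices are irrelevant. *)
Variables (m p : nat) (act : 'M[F]_m.+1 -> Cpoly F p -> Cpoly F p).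

Definition submodule (W : Cpoly F p -> Prop) : Prop :=
  subspace W /\ (forall A f, \tr A = 0 -> W f -> W (act A f)).

Definition sl_module (W : Cpoly F p -> Prop) : Prop :=
  [/\ submodule W,
      forall A (a : F) f g, \tr A = 0 -> W f -> W g ->
        act A (scal a f + g) = scal a (act A f) + act A g,
      forall A B (a : F) f, \tr A = 0 -> \tr B = 0 -> W f ->
        act (a *: A + B) f = scal a (act A f) + act B f
    & forall A B f, \tr A = 0 -> \tr B = 0 -> W f ->
        act (A *m B - B *m A) f = act A (act B f) - act B (act A f)].

Definition nontrivial (W : Cpoly F p -> Prop) : Prop :=
  exists2 f, W f & f <> 0.

Definition irreducible (W : Cpoly F p -> Prop) : Prop :=
  [/\ sl_module W, nontrivial W
    & forall W' : Cpoly F p -> Prop,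
        submodule W' -> (forall f, W' f -> W f) ->
        (forall f, W' f -> f = 0) \/ (forall f, W f -> W' f)].

(* h_r = E_{m+2-r,m+2-r} - E_{m+1-r,m+1-r}, for 1 <= r <= m. *)
Definition coroot (r : nat) : 'M[F]_m.+1 :=
  delta_mx (inord (m.+1 - r)) (inord (m.+1 - r))
  - delta_mx (inord (m - r)) (inord (m - r)).

(* The weight is sum_{r=1}^m (a r) lambda_r; the positive root vectors are the
   strictly lower triangular matrix units. *)
Definition highest_weight_vector (a : nat -> nat) (v : Cpoly F p) : Prop :=
  [/\ v <> 0,
      forall i j : 'I_m.+1, (j < i)%N -> act (delta_mx i j) v = 0
    & forall r : nat, (1 <= r <= m)%N -> act (coroot r) v = scal (a r)%:R v].

(* W is V_m(sum_{r=1}^m (a r) lambda_r), up to isomorphism. *)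
Definition irreducible_of_highest_weight
    (W : Cpoly F p -> Prop) (a : nat -> nat) : Prop :=
  irreducible W /\ (exists2 v, W v & highest_weight_vector a v).

(* W is the direct sum of N irreducible submodules. *)
Definition irreducible_components (W : Cpoly F p -> Prop) (N : nat) : Prop :=
  exists U : 'I_N -> Cpoly F p -> Prop,
  [/\ sl_module W,
      forall i, irreducible (U i),
      forall f, W f <->
        exists2 g : 'I_N -> Cpoly F p, forall i, U i (g i) & f = \sum_i g i
    & forall g : 'I_N -> Cpoly F p, (forall i, U i (g i)) ->
        \sum_i g i = 0 -> forall i, g i = 0].

(* U(sl(m+1)) S: U(sl(m+1)) is spanned by the monomials A_1 ... A_s with the
   A_i in sl(m+1). *)
Definition Umul (S : Cpoly F p -> Prop) : Cpoly F p -> Prop :=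
  span (fun f => exists (s : seq 'M[F]_m.+1) (w : Cpoly F p),
    [/\ forall A, A \in s -> \tr A = 0, S w & f = foldr act w s]).

End Modules.

Section Construction.
Variables (F : fieldType) (n : nat) (k : nat -> nat).

Definition cm (m : nat) : F :=
  - (m.+1%:R)^-1 * \sum_(i < m) ((m - i) * k (n - m + 1 + i))%N%:R.

(* Extension of an sl(m)-action on C_{m-1} to gl(m), the identity matrix acting
   as the scalar c_m; here m = p+1. *)
Definition gl_ext (p : nat) (T : 'M[F]_p.+1 -> Cpoly F p -> Cpoly F p)
    (A : 'M[F]_p.+1) (f : Cpoly F p) : Cpoly F p :=
  let t := \tr A / p.+1%:R in T (A - t%:M) f + scal (t * cm p.+1) f.

Section Step.
(* m = p+1, and T is the action of sl(m) on C_{m-1}. *)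
Variables (p : nat) (T : 'M[F]_p.+1 -> Cpoly F p -> Cpoly F p).
Local Notation c := (cm p.+1).
Local Notation E i j := (lift_op (gl_ext T (delta_mx i j))).

(* E_{i,j}, for i <> j in {1, ..., m} *)
Definition op_offdiag (i j : 'I_p.+1) (f : Cpoly F p.+1) : Cpoly F p.+1 :=
  xv F i * dx j f + E i j f.

(* E_{i,i} - E_{j,j}, for i, j in {1, ..., m} *)
Definition op_diag (i j : 'I_p.+1) (f : Cpoly F p.+1) : Cpoly F p.+1 :=
  xv F i * dx i f - xv F j * dx j f
  + lift_op (T (delta_mx i i - delta_mx j j)) f.

(* E_{i,m+1} *)
Definition op_col (i : 'I_p.+1) (f : Cpoly F p.+1) : Cpoly F p.+1 :=
  xv F i * euler f + scal c (xv F i * f) + \sum_(r < p.+1) xv F r * E i r f.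

(* E_{m+1,i} *)
Definition op_row (i : 'I_p.+1) (f : Cpoly F p.+1) : Cpoly F p.+1 :=
  - dx i f.

(* E_{m,m} - E_{m+1,m+1} *)
Definition op_last (f : Cpoly F p.+1) : Cpoly F p.+1 :=
  euler f + xv F ord_max * dx ord_max f + scal c f + E ord_max ord_max f.

(* Linear extension to sl(m+1): a traceless matrix A is the sum of its
   off-diagonal terms, of
     sum_{i<m} A_{i,i} (E_{i,i} - E_{m,m}),
   and of (sum_{i<=m} A_{i,i}) (E_{m,m} - E_{m+1,m+1}). *)
Definition sl_step (A : 'M[F]_p.+2) (f : Cpoly F p.+1) : Cpoly F p.+1 :=
  let w (i : 'I_p.+1) : 'I_p.+2 := lift ord_max i in
  \sum_(i < p.+1) \sum_(j < p.+1 | j != i)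
      scal (A (w i) (w j)) (op_offdiag i j f)
  + \sum_(i < p.+1) scal (A (w i) ord_max) (op_col i f)
  + \sum_(i < p.+1) scal (A ord_max (w i)) (op_row i f)
  + \sum_(i < p.+1 | i != ord_max) scal (A (w i) (w i)) (op_diag i ord_max f)
  + scal (\sum_(i < p.+1) A (w i) (w i)) (op_last f).

End Step.

(* The action of sl(2) on C_1. *)
Definition sl2_act (A : 'M[F]_2) (f : Cpoly F 1) : Cpoly F 1 :=
  let x : Cpoly F 1 := xv F (m := 0) ord0 in
  let d : Cpoly F 1 := dx (m := 0) ord0 f in
  let kn : F := (k n)%:R in
  scal (A ord0 ord_max) (x ^+ 2 * d - scal kn (x * f))
  + scal (A ord_max ord0) (- d)
  + scal (A ord0 ord0) (2%:R * (x * d) - scal kn f).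

(* The action of sl(m+1) on C_m, for m >= 1 (sl(1) = 0). *)
Fixpoint sl_act (m : nat) : 'M[F]_m.+1 -> Cpoly F m -> Cpoly F m :=
  match m return 'M[F]_m.+1 -> Cpoly F m -> Cpoly F m with
  | 0 => fun _ _ => 0
  | p.+1 =>
      match p return ('M[F]_p.+1 -> Cpoly F p -> Cpoly F p) ->
                     'M[F]_p.+2 -> Cpoly F p.+1 -> Cpoly F p.+1 with
      | 0 => fun _ => sl2_act
      | q.+1 => fun T => sl_step T
      end (@sl_act p)
  end.

(* V^(m), for 1 <= m <= n; the value at m = 0 is not used. *)
Fixpoint Vmod (m : nat) : Cpoly F m -> Prop :=
  match m return Cpoly F m -> Prop with
  | 0 => fun _ => True
  | p.+1 =>
      match p return (Cpoly F p -> Prop) -> Cpoly F p.+1 -> Prop with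
      | 0 => fun _ => @span F 1 (fun f =>
          exists2 i : nat, (i <= k n)%N & f = xv F (m := 0) ord0 ^+ i)
      | q.+1 => fun V => Umul (@sl_act q.+2)
          (fun f => exists2 g : Cpoly F q.+1, V g & f = incl g)
      end (@Vmod p)
  end.

(* Elements of V^(m+1) homogeneous of degree r in x_{m+1,1}, ..., x_{m+1,m+1};
   this is \overline{M}_r when n = m+1. *)
Definition Vgraded (m r : nat) (f : Cpoly F m.+1) : Prop :=
  @Vmod m.+1 f /\ (f : {mpoly (Cpoly F m)[m.+1]}) \is r.-homog.

End Construction.

(* sl(n) as the upper left corner of sl(n+1) *)
Definition corner (F : fieldType) (n : nat) (A : 'M[F]_n) : 'M[F]_n.+1 :=
  \matrix_(i, j)
    match unlift ord_max i, unlift ord_max j with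
    | Some i', Some j' => A i' j'
    | _, _ => 0
    end.

(* The restriction to sl(m+1) of the action of sl(m+2) on C_{m+1}. *)
Definition corner_act (F : fieldType) (n : nat) (k : nat -> nat) (m : nat)
    (A : 'M[F]_m.+1) : Cpoly F m.+1 -> Cpoly F m.+1 :=
  @sl_act F n k m.+1 (corner A).

(* Main.v *)
(** Split the action of weight [k] into a derivation, which does not depend on [k], and a
    zeroth-order term linear in [k]: it satisfies a Leibniz rule additive in [k].  The
    derivations act on the "flag matrix" [Y = [[-x_m, 1], [Y', 0]]] ([Y'] being the flag
    matrix of size [m]) as a column operation followed by a lower triangular row operation,
    so the minors of its first [j] rows span a copy of the [j]-th exterior power, and
    [V^(n)] is the span of the products of [k_1] minors of size 1, ..., [k_n] minors of
    size [n].  This span is a quotient of a tensor power of the standard module, so it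
    carries a positive contravariant Hermitian form and its submodules are completely
    reducible; a nonzero subspace stable under the [E_{m+1,i}] contains 1, whence
    irreducibility.

    Let [zeta_j] be the minor on the first [j] rows and the columns [n], ..., [n+1-j].
    The vectors of degree [r] killed by the raising operators of sl(n) are spanned by
    the monomials [prod_j zeta_j^{a_j}] with [a_j <= k_j] and [sum_j a_j = r]: such a
    vector is determined by its restriction to the slice where the variables of
    [C_{n-1}] vanish, on which [zeta_j] is [+-x_{n,n+1-j}], and the bound [a_j <= k_j]
    comes from the degree in [X] after adding [X] times row [j+1] of [Y] to row [j].
    These monomials have distinct weights, so [Mbar_r] is the direct sum of the
    irreducible modules they generate, and [a |-> k - a] exchanges degrees [r] and
    [|lambda| - r]. *)
From HB Require Import structures.
Require Import Defs.
From mathcomp Require Import all_boot all_order all_algebra.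
From mathcomp Require Import reals complex.
From mathcomp Require Import mpoly ring zify.
From Stdlib Require Import Classical IndefiniteDescription.
From Stdlib Require Import FunctionalExtensionality PropExtensionality.
Set Implicit Arguments.
Unset Strict Implicit.
Unset Printing Implicit Defensive.
Import Order.TTheory GRing.Theory Num.Theory.

Local Open Scope ring_scope.

(** That the formulas for the action respect brackets is not checked on the whole of C_n. It is
    checked on single minors, where the action is the explicit one of a tensor power, and the
    Leibniz rule carries it to products of minors. This is why V^(n) has to be described by such
    products before it can be called a module.

    Neither Weyl's theorem nor the theory of highest weights is assumed. The Hermitian form supplies
    orthogonal complements. The raising operators increase a height on a finite family, so every
    nonzero stable subspace of its span contains a vector that they all kill. A nonzero singular
    vector orthogonal to the expected summands is then excluded, because the singular vectors are
    known explicitly.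

    The positive root vectors E_{m+1,i} act as minus the partial derivatives. Hence 1 is the highest
    weight vector, and differentiation alone leads from any nonzero polynomial to a nonzero
    constant. The form needs a conjugation and a positive cone, which is what [numClosedFieldType]
    provides. *)

Section Basics.

(** * Coefficients, derivations and coefficientwise operators on the tower of polynomial rings *)

Variable F : fieldType.

Lemma cst_zmod_morphism m : zmod_morphism (@cst F m).
Proof. by elim: m => [|m IH] //= a b; rewrite IH; exact: mpolyCB. Qed.

Lemma cst_monoid_morphism m : monoid_morphism (@cst F m).
Proof.
elim: m => [|m [IH1 IHM]] //=; split; first by rewrite IH1.
by move=> a b; rewrite IHM; exact: mpolyCM.
Qed.

HB.instance Definition _ m :=
  GRing.isZmodMorphism.Build F (Cpoly F m) (@cst F m) (cst_zmod_morphism m).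
HB.instance Definition _ m :=
  GRing.isMonoidMorphism.Build F (Cpoly F m) (@cst F m) (cst_monoid_morphism m).

Lemma incl_zmod_morphism m : zmod_morphism (@incl F m).
Proof. exact: mpolyCB. Qed.
Lemma incl_monoid_morphism m : monoid_morphism (@incl F m).
Proof. by split; [|exact: mpolyCM]. Qed.
HB.instance Definition _ m :=
  GRing.isZmodMorphism.Build (Cpoly F m) (Cpoly F m.+1) (@incl F m)
    (incl_zmod_morphism (m := m)).
HB.instance Definition _ m :=
  GRing.isMonoidMorphism.Build (Cpoly F m) (Cpoly F m.+1) (@incl F m)
    (incl_monoid_morphism m).

Lemma incl_cst m a : incl (@cst F m a) = cst m.+1 a. Proof. by []. Qed.

Definition coef m (mu : 'X_{1..m.+1}) (f : Cpoly F m.+1) : Cpoly F m :=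
  (f : {mpoly (Cpoly F m)[m.+1]})@_mu.

Lemma coefP m (f g : Cpoly F m.+1) : (forall mu, coef mu f = coef mu g) -> f = g.
Proof. by move=> H; apply/mpolyP. Qed.

Lemma coef_zmod_morphism m mu : zmod_morphism (@coef m mu).
Proof. exact: mcoeffB. Qed.
HB.instance Definition _ m mu :=
  GRing.isZmodMorphism.Build (Cpoly F m.+1) (Cpoly F m) (@coef m mu)
    (@coef_zmod_morphism m mu).

Lemma coef_incl m mu (g : Cpoly F m) : coef mu (incl g) = g * (mu == 0%MM)%:R.
Proof. exact: mcoeffC. Qed.
Lemma coef_inclM m mu (g : Cpoly F m) f : coef mu (incl g * f) = g * coef mu f.
Proof. exact: mcoeffCM. Qed.
Lemma coef_cstM m mu a (f : Cpoly F m.+1) :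
  coef mu (cst m.+1 a * f) = cst m a * coef mu f.
Proof. exact: coef_inclM. Qed.
Lemma coef0_incl m (g : Cpoly F m) : coef 0%MM (incl g) = g.
Proof. by rewrite coef_incl eqxx mulr1. Qed.
Lemma incl_inj m : injective (@incl F m).
Proof. by move=> f g /(congr1 (coef 0%MM)); rewrite !coef0_incl. Qed.

Lemma coef_xvM m mu i (f : Cpoly F m.+1) :
  coef mu (xv F i * f) = if mu i == 0%N then 0 else coef (mu - U_(i))%MM f.
Proof.
rewrite /coef /xv mulrC.
case: ifPn => [mu0|mu0].
  apply: memN_msupp_eq0; apply/negP=> /msuppM_le /allpairsP [[m1 m2] /= [_]].
  rewrite msuppX inE => /eqP -> E.
  by move: mu0; rewrite E mnmDE mnm1E eqxx addn1.
have E : mu = (U_(i) + (mu - U_(i)))%MM.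
  by rewrite addmC submK // lep1mP.
by rewrite {1}E; exact: mcoeffMX.
Qed.

Lemma coef_dx m mu i (f : Cpoly F m.+1) :
  coef mu (dx i f) = coef (mu + U_(i))%MM f *+ (mu i).+1.
Proof. exact: mcoeff_deriv. Qed.

Lemma dx_zmod_morphism m i : zmod_morphism (@dx F m i).
Proof. exact: mderivB. Qed.
HB.instance Definition _ m i :=
  GRing.isZmodMorphism.Build (Cpoly F m.+1) (Cpoly F m.+1) (@dx F m i)
    (@dx_zmod_morphism m i).

Lemma dxM m i (f g : Cpoly F m.+1) : dx i (f * g) = dx i f * g + f * dx i g.
Proof. exact: mderivM. Qed.
Lemma dx_incl m i (g : Cpoly F m) : dx i (incl g) = 0.
Proof. exact: mderivC. Qed.
Lemma dx_cst m i a : dx i (cst m.+1 a) = 0 :> Cpoly F m.+1.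
Proof. exact: dx_incl. Qed.
Lemma dx_cstM m i a (f : Cpoly F m.+1) : dx i (cst m.+1 a * f) = cst m.+1 a * dx i f.
Proof. by rewrite dxM dx_cst mul0r add0r. Qed.
Lemma dx_xv m i j : dx i (xv F j) = (i == j)%:R :> Cpoly F m.+1.
Proof.
rewrite /dx /xv; apply/mpolyP => mu; rewrite mcoeff_deriv !mcoeffX.
rewrite -[(i == j)%:R]mpolyC_nat mcoeffC.
case: (eqVneq i j) => [->|ij] /=; last first.
  rewrite mul0r; case: eqP => [/(congr1 (fun m : 'X_{1..m.+1} => m i))|]; last by rewrite mul0rn.
  by rewrite mnmDE !mnm1E eqxx (negPf (_ : j != i)) ?addn1 // eq_sym.
rewrite mul1r -{1}[U_(j)%MM]add0m (inj_eq (@addIm _ _)) eq_sym.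
by case: eqP => [->|]; rewrite ?mnm0E ?mul0rn.
Qed.

(** Linearity is spelled out because [Cpoly] returns an [idomainType], which carries no F-module
    structure; scalars enter through [cst]. *)
Definition clin m (T : Cpoly F m -> Cpoly F m) :=
  forall a f g, T (cst m a * f + g) = cst m a * T f + T g.

Lemma clinB m T : @clin m T -> zmod_morphism T.
Proof.
move=> TL f g; rewrite [f - g]addrC -[- g]mulN1r -(rmorph1 (@cst F m)) -rmorphN TL.
by rewrite rmorphN rmorph1 mulN1r addrC.
Qed.
Lemma clin0 m T : @clin m T -> T 0 = 0.
Proof. by move=> TL; have := clinB TL 0 0; rewrite !subrr. Qed.
Lemma clinD m T : @clin m T -> {morph T : f g / f + g}.
Proof. by move=> TL f g; have := TL 1 f g; rewrite rmorph1 !mul1r. Qed.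
Lemma clinZ m T : @clin m T -> forall a f, T (cst m a * f) = cst m a * T f.
Proof. by move=> TL a f; rewrite -[cst m a * f]addr0 TL (clin0 TL) addr0. Qed.
Lemma clin_sum m T : @clin m T -> forall I (r : seq I) P (G : I -> Cpoly F m),
  T (\sum_(i <- r | P i) G i) = \sum_(i <- r | P i) T (G i).
Proof.
by move=> TL I r P G; apply: (big_morph T (clinD TL) (clin0 TL)).
Qed.

Lemma coef_lift m mu T (f : Cpoly F m.+1) : @clin m T ->
  coef mu (lift_op T f) = T (coef mu f).
Proof.
move=> TL; pose T' : {additive _ -> _} :=
  HB.pack T (GRing.isZmodMorphism.Build _ _ T (clinB TL)).
exact: (mcoeff_map_mpoly T').
Qed.

Lemma lift_clin m T : @clin m T -> clin (lift_op T).
Proof.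
move=> TL a f g; apply: coefP => mu.
by rewrite raddfD /= coef_cstM !coef_lift // raddfD /= coef_cstM TL.
Qed.

Lemma lift_incl m T g : @clin m T -> lift_op T (incl g) = incl (T g).
Proof.
move=> TL; apply: coefP => mu; rewrite coef_lift // !coef_incl.
by case: (mu == _); rewrite ?mulr1 ?mulr0 ?(clin0 TL).
Qed.

Lemma lift_xvM m T i f : @clin m T -> lift_op T (xv F i * f) = xv F i * lift_op T f.
Proof.
move=> TL; apply: coefP => mu; rewrite coef_lift // !coef_xvM coef_lift //.
by case: ifP; rewrite ?(clin0 TL).
Qed.

Lemma lift_xv m T i : @clin m T -> lift_op T (xv F i) = xv F i * incl (T 1).
Proof.
by move=> TL; rewrite -{1}[xv F i]mulr1 lift_xvM // -(rmorph1 (@incl F m)) lift_incl.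
Qed.

(** Three operators occur because factors of weights k1 and k2 have a product of weight k1 + k2, and
    each weight has its own action. *)
Lemma lift_leibniz m T T1 T2 (f g : Cpoly F m.+1) : @clin m T -> clin T1 -> clin T2 ->
  (forall f g, T (f * g) = T1 f * g + f * T2 g) ->
  lift_op T (f * g) = lift_op T1 f * g + f * lift_op T2 g.
Proof.
move=> TL T1L T2L H; apply: coefP => mu.
rewrite raddfD /= coef_lift //.
have cM (a b : Cpoly F m.+1) : coef mu (a * b) =
    \sum_(k : 'X_{1..m.+1 < (mdeg mu).+1, (mdeg mu).+1} | mu == (k.1 + k.2)%MM)
      (coef k.1 a * coef k.2 b) by exact: mcoeffM.
rewrite !cM clin_sum // -big_split; apply: eq_bigr => i _ /=.
by rewrite H !coef_lift.
Qed.

Lemma euler_leibniz m (f g : Cpoly F m.+1) :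
  euler (f * g) = euler f * g + f * euler g.
Proof.
rewrite /euler mulr_suml mulr_sumr -big_split; apply: eq_bigr => s _ /=.
by rewrite dxM; ring.
Qed.

Lemma euler_clin m : clin (@euler F m).
Proof.
move=> a f g; rewrite /euler mulr_sumr -big_split; apply: eq_bigr => s _ /=.
by rewrite raddfD /= dx_cstM; ring.
Qed.

Lemma euler_incl m (g : Cpoly F m) : euler (incl g) = 0.
Proof. by rewrite /euler big1 // => s _; rewrite dx_incl mulr0. Qed.

Lemma euler_xv m i : euler (xv F i) = xv F i :> Cpoly F m.+1.
Proof.
rewrite /euler (bigD1 i) //= dx_xv eqxx mulr1 big1 ?addr0 // => s si.
by rewrite dx_xv (negPf si) mulr0.
Qed.

End Basics.

(** * The action as first-order operators *)

Section Action.
Variables (F : numClosedFieldType) (n : nat).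
Implicit Type k : nat -> nat.

(** Linearity is asked on all matrices, traceless or not, so that a matrix may be split freely into
    matrix units. *)
Definition mlin p (T : 'M[F]_p.+1 -> Cpoly F p -> Cpoly F p) :=
  (forall A, clin (T A)) /\
  (forall a A B f, T (a *: A + B) f = cst p a * T A f + T B f).

Lemma mxtrace_delta p (i j : 'I_p) : \tr (delta_mx i j) = (i == j)%:R :> F.
Proof.
rewrite /mxtrace (bigD1 i) //= mxE eqxx big1 ?addr0 // => s si.
by rewrite mxE (negPf si).
Qed.

Section Mlin.
Variables (p : nat) (T : 'M[F]_p.+1 -> Cpoly F p -> Cpoly F p) (TL : mlin T).

Lemma mlin0 f : T 0 f = 0.
Proof.
have := TL.2 (-1) 0 0 f; rewrite scaler0 addr0 rmorphN rmorph1 mulN1r.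
by rewrite addNr.
Qed.
Lemma mlinZ a A f : T (a *: A) f = cst p a * T A f.
Proof. by rewrite -[a *: A]addr0 TL.2 mlin0 addr0. Qed.
Lemma mlinD A B f : T (A + B) f = T A f + T B f.
Proof. by have := TL.2 1 A B f; rewrite scale1r rmorph1 mul1r. Qed.
Lemma mlinN A f : T (- A) f = - T A f.
Proof. by rewrite -scaleN1r mlinZ rmorphN rmorph1 mulN1r. Qed.
Lemma mlinB A B f : T (A - B) f = T A f - T B f.
Proof. by rewrite mlinD mlinN. Qed.
Lemma mlin_sum I (r : seq I) P (G : I -> 'M[F]_p.+1) f :
  T (\sum_(i <- r | P i) G i) f = \sum_(i <- r | P i) T (G i) f.
Proof.
by apply: (big_morph (fun A => T A f)) => [A B|]; rewrite ?mlinD ?mlin0.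
Qed.

Lemma gl_ext_clin k A : clin (gl_ext n k T A).
Proof.
move=> a f g; rewrite /gl_ext /scal TL.1; ring.
Qed.

Lemma gl_ext_lin k a A B f :
  gl_ext n k T (a *: A + B) f = cst p a * gl_ext n k T A f + gl_ext n k T B f.
Proof.
rewrite /gl_ext /scal mxtraceD mxtraceZ mulrDl.
set tA := \tr A / _; set tB := \tr B / _; rewrite -!mulrA -/tA.
rewrite (_ : a *: A + B - _ = a *: (A - tA%:M) + (B - tB%:M)); last first.
  by rewrite raddfD /= scalerBr -scale_scalar_mx opprD !addrA; congr (_ - _); rewrite addrAC.
by rewrite TL.2 mulrDl !rmorphD !rmorphM; ring.
Qed.

End Mlin.

Lemma gl_ext_tr0 k p T (A : 'M[F]_p.+1) f : \tr A = 0 -> gl_ext n k T A f = T A f.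
Proof.
by move=> tA; rewrite /gl_ext /scal tA !mul0r !rmorph0 mul0r addr0 subr0.
Qed.

Definition ulift p (i : 'I_p.+1) : 'I_p.+2 := lift ord_max i.

Lemma big_ulift (V : nmodType) p (G : 'I_p.+2 -> V) :
  \sum_i G i = \sum_i G (ulift i) + G ord_max.
Proof.
rewrite big_ord_recr /=; congr (_ + _); apply: eq_bigr => i _; congr G.
by apply: val_inj; rewrite /= /bump leqNgt ltn_ord.
Qed.

Section StepFormula.
Variables (k : nat -> nat) (p : nat) (T : 'M[F]_p.+1 -> Cpoly F p -> Cpoly F p).
Hypothesis TL : mlin T.

Definition glop (i r : 'I_p.+1) : Cpoly F p.+1 -> Cpoly F p.+1 :=
  lift_op (gl_ext n k T (delta_mx i r)).

(** The total coefficient of E_{i,r} on C_{m-1}: E_{i,r} itself contributes an entry of A, and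
    E_{i,m+1} contributes one multiplied by x_r. *)
Definition Nmx (A : 'M[F]_p.+2) (i r : 'I_p.+1) : Cpoly F p.+1 :=
  cst p.+1 (A (ulift i) (ulift r)) + cst p.+1 (A (ulift i) ord_max) * xv F r.

Lemma glop_clin i r : clin (glop i r).
Proof. exact: lift_clin (gl_ext_clin TL _ _). Qed.

Lemma lift_diagB i j f :
  lift_op (T (delta_mx i i - delta_mx j j)) f = glop i i f - glop j j f.
Proof.
apply: coefP => mu; rewrite raddfB /= !coef_lift; try exact: gl_ext_clin; last exact: TL.1.
rewrite /gl_ext /scal !mxtrace_delta eqxx.
by rewrite eqxx opprD addrACA subrr addr0 -(mlinB TL) opprB addrA subrK.
Qed.

(** The definition splits the diagonal relative to the index m. Once recombined, no diagonal
    position is distinguished, and the whole action depends on A through [Nmx] and the entries of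
    A. *)
Lemma sl_stepE A f :
  sl_step n k T A f =
    (\sum_i Nmx A i i) * (euler f + cst p.+1 (cm F n k p.+1) * f)
    + \sum_i \sum_j cst p.+1 (A (ulift i) (ulift j)) * (xv F i * dx j f)
    - \sum_i cst p.+1 (A ord_max (ulift i)) * dx i f
    + \sum_i \sum_r Nmx A i r * glop i r f.
Proof.
rewrite /sl_step /op_offdiag /op_col /op_row /op_diag /op_last /scal -/glop.
pose G i j := xv F i * dx j f + glop i j f.
pose B i j := cst p.+1 (A (ulift i) (ulift j)).
pose c := cst p.+1 (cm F n k p.+1).
transitivity (\sum_i \sum_(j | j != i) B i j * G i j
  + \sum_i cst p.+1 (A (ulift i) ord_max) *
     (xv F i * euler f + c * (xv F i * f) + \sum_r xv F r * glop i r f)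
  + \sum_i cst p.+1 (A ord_max (ulift i)) * - dx i f
  + \sum_(i | i != ord_max) B i i * (G i i - G ord_max ord_max)
  + (\sum_i B i i) * (euler f + c * f + G ord_max ord_max)).
  congr (_ + _ + _); last first.
    by rewrite rmorph_sum; congr (_ * _); rewrite -/c /G /glop; ring.
  apply: eq_bigr => i _; rewrite lift_diagB /B /G; congr (_ * _).
  by rewrite addrACA opprD.
(* The multiples of [G ord_max ord_max] coming from E_{i,i} - E_{m,m} cancel against those coming
   from E_{m,m} - E_{m+1,m+1}. *)
have E1 : \sum_(i | i != ord_max) B i i * (G i i - G ord_max ord_max) +
    (\sum_i B i i) * (euler f + c * f + G ord_max ord_max) =
    \sum_i B i i * G i i + (\sum_i B i i) * (euler f + c * f).
  have H1 : (\sum_i B i i) * G ord_max ord_max = B ord_max ord_max * G ord_max ord_max +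
      \sum_(i | i != ord_max) B i i * G ord_max ord_max.
    by rewrite mulr_suml (bigD1 ord_max).
  have H2 : \sum_i B i i * G i i = B ord_max ord_max * G ord_max ord_max +
      \sum_(i | i != ord_max) B i i * G i i by exact: bigD1.
  have H3 : \sum_(i | i != ord_max) B i i * (G i i - G ord_max ord_max) =
      \sum_(i | i != ord_max) B i i * G i i - \sum_(i | i != ord_max) B i i * G ord_max ord_max.
    by rewrite -sumrB; apply: eq_bigr => i _; rewrite mulrBr.
  have comb (x y z t : Cpoly F p.+1) : x - y + (z + (t + y)) = t + x + z by ring.
  by rewrite mulrDr H1 H2 H3 comb.
rewrite -addrA E1.
have E2 : \sum_i \sum_j B i j * G i j =
   \sum_i \sum_(j | j != i) B i j * G i j + \sum_i B i i * G i i.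
  rewrite -big_split; apply: eq_bigr => i _ /=.
  by rewrite (bigD1 i) //= addrC.
have E3 : \sum_i \sum_j B i j * G i j =
   \sum_i \sum_j B i j * (xv F i * dx j f) + \sum_i \sum_r B i r * glop i r f.
  rewrite -big_split; apply: eq_bigr => i _ /=; rewrite -big_split; apply: eq_bigr => j _ /=.
  by rewrite mulrDr.
have E4 : \sum_i \sum_r Nmx A i r * glop i r f =
  \sum_i \sum_r B i r * glop i r f +
  \sum_i cst p.+1 (A (ulift i) ord_max) * \sum_r xv F r * glop i r f.
  rewrite -big_split; apply: eq_bigr => i _ /=; rewrite mulr_sumr -big_split; apply: eq_bigr => j _ /=.
  by rewrite mulrDl mulrA.
have E5 : \sum_i Nmx A i i = \sum_i B i i + \sum_i cst p.+1 (A (ulift i) ord_max) * xv F i.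
  by rewrite -big_split.
have E6 : \sum_i cst p.+1 (A (ulift i) ord_max) *
     (xv F i * euler f + c * (xv F i * f) + \sum_r xv F r * glop i r f) =
   (\sum_i cst p.+1 (A (ulift i) ord_max) * xv F i) * (euler f + c * f) +
   \sum_i cst p.+1 (A (ulift i) ord_max) * \sum_r xv F r * glop i r f.
  rewrite mulr_suml -big_split; apply: eq_bigr => i _ /=; ring.
rewrite E6 E4 E5 -sumrN.
have -> : \sum_i cst p.+1 (A ord_max (ulift i)) * - dx i f =
    \sum_i - (cst p.+1 (A ord_max (ulift i)) * dx i f).
  by apply: eq_bigr => i _; rewrite mulrN.
have -> : \sum_i \sum_(j | j != i) B i j * G i j =
  \sum_i \sum_j B i j * (xv F i * dx j f) + \sum_i \sum_r B i r * glop i r f - \sum_i B i i * G i i.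
  by rewrite -E3 E2 addrK.
rewrite -/B -/c; ring.
Qed.

End StepFormula.

Hypothesis n_gt0 : (0 < n)%N.

(** The sl(2) formulas are the general step above sl(1) = 0: there c_1 = -k_n/2, and E_{1,1} of
    gl(1) acts as the scalar c_1. Inductions can therefore start at 0. *)
Lemma sl_actS k p A f :
  @sl_act F n k p.+1 A f = sl_step n k (@sl_act F n k p) A f.
Proof.
case: p A f => [|p] A f //.
have TL : mlin (@sl_act F n k 0).
  by split=> [B a g h|a B C g] /=; rewrite mulr0 addr0.
rewrite (sl_stepE k TL) !big_ord1 /= /sl2_act /scal /euler big_ord1.
have gE : glop k (@sl_act F n k 0) ord0 ord0 f = cst 1 (cm F n k 1) * f.
  apply: coefP => mu; rewrite coef_lift; last exact: gl_ext_clin.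
  by rewrite /gl_ext /scal /= mxtrace_delta eqxx divr1 mul1r add0r coef_cstM.
rewrite gE.
have cE : cst 1 (k n)%:R = - (cst 1 (cm F n k 1) + cst 1 (cm F n k 1)).
  rewrite -rmorphD -rmorphN; congr cst.
  rewrite /cm big_ord1 /= addn0 subn0 mul1n mulNr opprD opprK -mulrDl -[_ + _]mulr2n.
  by rewrite -[_^-1 *+ 2]mulr_natr mulVf ?pnatr_eq0 // mul1r subn1 addn1 prednK.
rewrite cE /Nmx /=.
have -> : ulift ord0 = ord0 :> 'I_2 by apply: val_inj.
ring.
Qed.

Lemma sl_act_mlin k p : mlin (@sl_act F n k p).
Proof.
elim: p => [|p IH].
  by split=> [B a g h|a B C g] /=; rewrite mulr0 addr0.
split=> [A a f g|a A B f]; rewrite !sl_actS !(sl_stepE k IH).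
  have L1 (u v w : 'I_p.+1 -> Cpoly F p.+1) : \sum_i u i * (cst p.+1 a * v i + w i) =
     cst p.+1 a * (\sum_i u i * v i) + \sum_i u i * w i.
    by rewrite mulr_sumr -big_split; apply: eq_bigr => i _ /=; ring.
  have L2 (u v w : 'I_p.+1 -> 'I_p.+1 -> Cpoly F p.+1) :
    \sum_i \sum_j u i j * (cst p.+1 a * v i j + w i j) =
     cst p.+1 a * (\sum_i \sum_j u i j * v i j) + \sum_i \sum_j u i j * w i j.
    rewrite mulr_sumr -big_split; apply: eq_bigr => i _ /=; exact: L1.
  have E1 : \sum_i \sum_j cst p.+1 (A (ulift i) (ulift j)) * (xv F i * dx j (cst p.+1 a * f + g)) =
    cst p.+1 a * (\sum_i \sum_j cst p.+1 (A (ulift i) (ulift j)) * (xv F i * dx j f)) +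
    \sum_i \sum_j cst p.+1 (A (ulift i) (ulift j)) * (xv F i * dx j g).
    rewrite -L2; apply: eq_bigr => i _; apply: eq_bigr => j _.
    by rewrite raddfD /= dx_cstM; ring.
  have E2 : \sum_i cst p.+1 (A ord_max (ulift i)) * dx i (cst p.+1 a * f + g) =
    cst p.+1 a * (\sum_i cst p.+1 (A ord_max (ulift i)) * dx i f) +
    \sum_i cst p.+1 (A ord_max (ulift i)) * dx i g.
    by rewrite -L1; apply: eq_bigr => i _; rewrite raddfD /= dx_cstM.
  have E3 : \sum_i \sum_r Nmx A i r * glop k (@sl_act F n k p) i r (cst p.+1 a * f + g) =
    cst p.+1 a * (\sum_i \sum_r Nmx A i r * glop k (@sl_act F n k p) i r f) +
    \sum_i \sum_r Nmx A i r * glop k (@sl_act F n k p) i r g.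
    by rewrite -L2; apply: eq_bigr => i _; apply: eq_bigr => j _; rewrite glop_clin.
  have comb (N b ef eg c u v x1 y1 x2 y2 x3 y3 : Cpoly F p.+1) :
      N * (b * ef + eg + c * (b * u + v)) + (b * x1 + y1) - (b * x2 + y2) + (b * x3 + y3) =
      b * (N * (ef + c * u) + x1 - x2 + x3) + (N * (eg + c * v) + y1 - y2 + y3) by ring.
  by rewrite E1 E2 E3 (euler_clin a f g) comb.
have NE i r : Nmx (a *: A + B) i r = cst p.+1 a * Nmx A i r + Nmx B i r.
  by rewrite /Nmx !mxE !rmorphD !rmorphM; ring.
have L1 (u v : 'I_p.+1 -> Cpoly F p.+1) w : \sum_i (cst p.+1 a * u i + v i) * w i =
   cst p.+1 a * (\sum_i u i * w i) + \sum_i v i * w i.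
  by rewrite mulr_sumr -big_split; apply: eq_bigr => i _ /=; ring.
have L2 (u v : 'I_p.+1 -> 'I_p.+1 -> Cpoly F p.+1) w :
  \sum_i \sum_j (cst p.+1 a * u i j + v i j) * w i j =
   cst p.+1 a * (\sum_i \sum_j u i j * w i j) + \sum_i \sum_j v i j * w i j.
  rewrite mulr_sumr -big_split; apply: eq_bigr => i _ /=; exact: L1.
have cE (i j : 'I_p.+2) : cst p.+1 ((a *: A + B) i j) =
    cst p.+1 a * cst p.+1 (A i j) + cst p.+1 (B i j).
  by rewrite !mxE rmorphD rmorphM.
have E1 : \sum_i Nmx (a *: A + B) i i = cst p.+1 a * (\sum_i Nmx A i i) + \sum_i Nmx B i i.
  by rewrite mulr_sumr -big_split; apply: eq_bigr => i _; rewrite NE.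
have E2 : \sum_i \sum_j cst p.+1 ((a *: A + B) (ulift i) (ulift j)) * (xv F i * dx j f) =
    cst p.+1 a * (\sum_i \sum_j cst p.+1 (A (ulift i) (ulift j)) * (xv F i * dx j f)) +
    \sum_i \sum_j cst p.+1 (B (ulift i) (ulift j)) * (xv F i * dx j f).
  by rewrite -L2; apply: eq_bigr => i _; apply: eq_bigr => j _; rewrite cE.
have E3 : \sum_i cst p.+1 ((a *: A + B) ord_max (ulift i)) * dx i f =
    cst p.+1 a * (\sum_i cst p.+1 (A ord_max (ulift i)) * dx i f) +
    \sum_i cst p.+1 (B ord_max (ulift i)) * dx i f.
  by rewrite -L1; apply: eq_bigr => i _; rewrite cE.
have E4 : \sum_i \sum_r Nmx (a *: A + B) i r * glop k (@sl_act F n k p) i r f =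
    cst p.+1 a * (\sum_i \sum_r Nmx A i r * glop k (@sl_act F n k p) i r f) +
    \sum_i \sum_r Nmx B i r * glop k (@sl_act F n k p) i r f.
  by rewrite -L2; apply: eq_bigr => i _; apply: eq_bigr => j _; rewrite NE.
by rewrite E1 E2 E3 E4; ring.
Qed.

Lemma sl_act_clin k p A : clin (@sl_act F n k p A).
Proof. exact: (sl_act_mlin k p).1. Qed.

Lemma cm_add k k1 k2 p : (p < n)%N ->
  (forall j, (1 <= j <= n)%N -> k j = (k1 j + k2 j)%N) ->
  cm F n k p.+1 = cm F n k1 p.+1 + cm F n k2 p.+1.
Proof.
move=> pn kE; rewrite /cm -mulrDr -big_split; congr (_ * _).
apply: eq_bigr => i _ /=; rewrite -natrD kE ?mulnDr //.
have := ltn_ord i; lia.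
Qed.

Lemma sl_act_leibniz k k1 k2 p A f g : (p <= n)%N ->
  (forall j, (1 <= j <= n)%N -> k j = (k1 j + k2 j)%N) ->
  @sl_act F n k p A (f * g) = sl_act n k1 A f * g + f * sl_act n k2 A g.
Proof.
move=> pn kE; elim: p pn A f g => [|p IH] pn A f g.
  by rewrite /= mulr0 mul0r addr0.
rewrite !sl_actS !sl_stepE; try exact: sl_act_mlin.
have GL i r : glop k (@sl_act F n k p) i r (f * g) =
    glop k1 (@sl_act F n k1 p) i r f * g + f * glop k2 (@sl_act F n k2 p) i r g.
  apply: lift_leibniz; try (apply: gl_ext_clin; exact: sl_act_mlin).
  move=> u v; rewrite /gl_ext /scal IH; last by lia.
  by rewrite (cm_add pn kE) mulrDr rmorphD; ring.
have L1 (u v w : 'I_p.+1 -> Cpoly F p.+1) : \sum_i u i * (v i * g + f * w i) =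
   (\sum_i u i * v i) * g + f * \sum_i u i * w i.
  by rewrite mulr_sumr mulr_suml -big_split; apply: eq_bigr => i _ /=; ring.
have L2 (u v w : 'I_p.+1 -> 'I_p.+1 -> Cpoly F p.+1) :
  \sum_i \sum_j u i j * (v i j * g + f * w i j) =
   (\sum_i \sum_j u i j * v i j) * g + f * \sum_i \sum_j u i j * w i j.
  rewrite mulr_sumr mulr_suml -big_split; apply: eq_bigr => i _ /=; exact: L1.
have E1 : \sum_i \sum_j cst p.+1 (A (ulift i) (ulift j)) * (xv F i * dx j (f * g)) =
  (\sum_i \sum_j cst p.+1 (A (ulift i) (ulift j)) * (xv F i * dx j f)) * g +
  f * (\sum_i \sum_j cst p.+1 (A (ulift i) (ulift j)) * (xv F i * dx j g)).
  by rewrite -L2; apply: eq_bigr => i _; apply: eq_bigr => j _; rewrite dxM; ring.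
have E2 : \sum_i cst p.+1 (A ord_max (ulift i)) * dx i (f * g) =
  (\sum_i cst p.+1 (A ord_max (ulift i)) * dx i f) * g +
  f * (\sum_i cst p.+1 (A ord_max (ulift i)) * dx i g).
  by rewrite -L1; apply: eq_bigr => i _; rewrite dxM.
have E3 : \sum_i \sum_r Nmx A i r * glop k (@sl_act F n k p) i r (f * g) =
  (\sum_i \sum_r Nmx A i r * glop k1 (@sl_act F n k1 p) i r f) * g +
  f * (\sum_i \sum_r Nmx A i r * glop k2 (@sl_act F n k2 p) i r g).
  by rewrite -L2; apply: eq_bigr => i _; apply: eq_bigr => j _; rewrite GL.
have comb (N ef eg c1 c2 x1 y1 x2 y2 x3 y3 : Cpoly F p.+1) :
    N * (ef * g + f * eg + (c1 + c2) * (f * g)) + (x1 * g + f * y1) - (x2 * g + f * y2)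
      + (x3 * g + f * y3) =
    (N * (ef + c1 * f) + x1 - x2 + x3) * g + f * (N * (eg + c2 * g) + y1 - y2 + y3) by ring.
by rewrite E1 E2 E3 euler_leibniz (cm_add pn kE) rmorphD comb.
Qed.

End Action.

Arguments cst {F} m a : simpl never.
Arguments sl_act : simpl never.

(** * The flag matrix and its minors *)

Section FlagMatrix.
Variables (F : numClosedFieldType) (n : nat).
Implicit Type k : nat -> nat.

Fixpoint Yrec p : 'M[Cpoly F p]_p.+1 :=
  match p return 'M[Cpoly F p]_p.+1 with
  | 0 => const_mx 1
  | q.+1 => \matrix_(i, j)
      match unlift ord0 i, unlift ord_max j with
      | None, Some j' => - xv F j'
      | None, None => 1
      | Some i', Some j' => incl (Yrec q i' j')
      | Some _, None => 0
      end
  end.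

Fact Ymx_key : unit. Proof. exact: tt. Qed.
(* locked, so that [mxE] does not expand it *)
Definition Ymx := locked_with Ymx_key Yrec.

Lemma Y00 i j : Ymx 0 i j = 1.
Proof. by rewrite /Ymx unlock mxE. Qed.
Lemma Y0u p j : Ymx p.+1 ord0 (ulift j) = - xv F j.
Proof. by rewrite /Ymx unlock mxE unlift_none /ulift liftK. Qed.
Lemma Y0m p : Ymx p.+1 ord0 ord_max = 1.
Proof. by rewrite /Ymx unlock mxE !unlift_none. Qed.
Lemma Ylu p i j : Ymx p.+1 (lift ord0 i) (ulift j) = incl (Ymx p i j).
Proof. by rewrite /Ymx unlock mxE /ulift !liftK. Qed.
Lemma Ylm p i : Ymx p.+1 (lift ord0 i) ord_max = 0.
Proof. by rewrite /Ymx unlock mxE unlift_none liftK. Qed.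

Lemma ulift_val p (i : 'I_p.+1) : ulift i = i :> nat.
Proof. by rewrite /= /bump leqNgt ltn_ord. Qed.

Lemma uliftP p (j : 'I_p.+2) : (exists j', j = ulift j') \/ j = ord_max.
Proof. by case: (unliftP ord_max j) => [j' ->|->]; [left; exists j'|right]. Qed.

(** This shape makes the minor on the last columns equal to 1, so the constant 1 is itself a product
    of minors. *)
Lemma Y_antidiag p (i j : 'I_p.+1) :
  ((p < i + j)%N -> Ymx p i j = 0) /\ ((i + j)%N = p -> Ymx p i j = 1).
Proof.
elim: p i j => [|p IH] i j.
  by split=> [|_]; [rewrite !ord1|rewrite Y00].
have [[j' ->]|->] := uliftP j; case: (unliftP ord0 i) => [i' ->|->].
- rewrite Ylu ulift_val lift0; have [H0 H1] := IH i' j'.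
  split=> H; first by rewrite H0 ?rmorph0 //; lia.
  by rewrite H1 ?rmorph1 //; lia.
- rewrite Y0u ulift_val /=; have := ltn_ord j'; split; lia.
- rewrite Ylm lift0 /=; split=> //; lia.
- rewrite Y0m /=; split=> //; lia.
Qed.

Hypothesis n_gt0 : (0 < n)%N.

Definition zero_weight : nat -> nat := fun=> 0%N.

Definition der p A : Cpoly F p -> Cpoly F p := @sl_act F n zero_weight p A.

Lemma derM p A f g : (p <= n)%N -> @der p A (f * g) = der A f * g + f * der A g.
Proof. by move=> pn; apply: sl_act_leibniz => //. Qed.

Lemma der_clin p A : clin (@der p A).
Proof. exact: sl_act_clin. Qed.

Lemma der_cst p A a : (p <= n)%N -> @der p A (cst p a) = 0.
Proof.
move=> pn; have D1 : @der p A 1 = 0.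
  have := derM A 1 1 pn; rewrite !mulr1 mul1r => /eqP.
  by rewrite -{1}[der A 1]addr0 (inj_eq (addrI _)) => /eqP <-.
by rewrite -[cst p a]mulr1 (clinZ (der_clin A)) D1 mulr0.
Qed.

Lemma der1 p A : (p <= n)%N -> @der p A 1 = 0.
Proof. by move=> pn; have := der_cst A 1 pn; rewrite rmorph1. Qed.

Lemma sl_act_der k p A f : (p <= n)%N ->
  @sl_act F n k p A f = der A f + f * sl_act n k A 1.
Proof.
by move=> pn; rewrite -{1}[f]mulr1 (@sl_act_leibniz _ _ _ k zero_weight k) // mulr1.
Qed.

(** For p = n this is k_{i+1} + ... + k_n, a part of the partition attached to the weight: it counts
    the minors that involve row i, rows being numbered from 0. For smaller p only k_{n-p+1}, ...,
    k_n enter, as in V^(p). *)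
Definition tail_weight k p i : nat := (\sum_(i <= j < p) k (n - p + j.+1))%N.

Lemma tail_weightS k p i : (p < n)%N -> tail_weight k p i = tail_weight k p.+1 i.+1.
Proof.
move=> pn; rewrite /tail_weight big_add1 /=; apply: eq_bigr => j _; congr k; lia.
Qed.

Lemma sum_tail (K : nat -> nat) N :
  (\sum_(i < N) \sum_(i.+1 <= j < N) K j = \sum_(j < N) j * K j)%N.
Proof.
elim: N => [|N IH]; first by rewrite !big_ord0.
rewrite !big_ord_recr /= -IH [X in (_ + X)%N]big_geq // addn0.
rewrite (eq_bigr (fun i : 'I_N => (\sum_(i.+1 <= j < N) K j) + K N)%N); last first.
  by move=> i _; rewrite big_nat_recr.
by rewrite big_split /= sum_nat_const card_ord.
Qed.

(** This identity, with m = p + 1, determines c_m. It matches the scalar by which the identity of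
    gl(m) acts with the diagonal of the row operation on the flag matrix. *)
Lemma cm_tail_weight k p : (p < n)%N ->
  cm F n k p.+1 + cm F n k p.+1 / p.+1%:R =
  - (tail_weight k p.+1 0)%:R + (\sum_(s < p.+1) (tail_weight k p s)%:R) / p.+1%:R.
Proof.
move=> pn; have p0 : p.+1%:R != 0 :> F by rewrite pnatr_eq0.
have p1 : p.+2%:R != 0 :> F by rewrite pnatr_eq0.
pose K j := k (n - p.+1 + j.+1)%N.
have E1 : cm F n k p.+1 * p.+2%:R = - (\sum_(i < p.+1) ((p.+1 - i) * K i)%N%:R).
  rewrite /cm !mulNr mulrAC mulVf // mul1r; congr (- _); apply: eq_bigr => i _.
  by congr ((_ * k _)%N%:R); lia.
have E2 : \sum_(s < p.+1) (tail_weight k p s)%:R = (\sum_(j < p.+1) j * K j)%N%:R :> F.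
  rewrite -sum_tail natr_sum; apply: eq_bigr => s _; congr _%:R.
  by rewrite tail_weightS.
have E3 : (tail_weight k p.+1 0)%:R * p.+1%:R =
    (\sum_(i < p.+1) ((p.+1 - i) * K i) + \sum_(j < p.+1) j * K j)%N%:R :> F.
  rewrite -natrM /tail_weight big_mkord big_distrl /= -big_split /=; congr _%:R.
  by apply: eq_bigr => i _; have := ltn_ord i => ip; rewrite -mulnDl subnK 1?mulnC 1?ltnW.
apply: (mulIf p0); rewrite !mulrDl !divfK // E2 mulNr E3 natrD opprD.
rewrite -addrA addNr addr0 -natr_sum in E1 *.
by rewrite -E1 -[p.+2]addn1 natrD mulrDr mulr1.
Qed.

Definition tdelta p (i r : 'I_p.+1) : 'M[F]_p.+1 :=
  delta_mx i r - ((i == r)%:R / p.+1%:R)%:M.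

Lemma mxtrace_tdelta p (i r : 'I_p.+1) : \tr (tdelta i r) = 0.
Proof.
rewrite raddfB /= mxtrace_delta mxtrace_scalar -[X in _ - X]mulr_natr divfK ?subrr //.
by rewrite pnatr_eq0.
Qed.

Lemma glop_incl k p i r g :
  glop n k (@sl_act F n k p) i r (incl g) =
  incl (sl_act n k (tdelta i r) g + cst p ((i == r)%:R / p.+1%:R * cm F n k p.+1) * g).
Proof.
rewrite /glop lift_incl; last exact/gl_ext_clin/sl_act_mlin.
by rewrite /gl_ext /scal mxtrace_delta.
Qed.

Lemma cm_zero_weight p : cm F n zero_weight p.+1 = 0.
Proof. by rewrite /cm big1 ?mulr0 // => i _; rewrite muln0. Qed.

(* [L A] is the row operation that restores the normal form of the flag matrix
   after the infinitesimal column operation [A]; its diagonal carries the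
   zeroth-order terms of the action, for all weights at once. *)
Definition flag_cocycle p (L : 'M[F]_p.+1 -> 'M[Cpoly F p]_p.+1) :=
  forall A, \tr A = 0 ->
  [/\ forall i c, der A (Ymx p i c) =
        \sum_c' Ymx p i c' * cst p (A c' c) - \sum_q L A i q * Ymx p q c,
      forall i q : 'I_p.+1, (i < q)%N -> L A i q = 0,
      forall k, sl_act n k A 1 = \sum_(i < p.+1) cst p (tail_weight k p i)%:R * L A i i
    & (forall i j : 'I_p.+1, (i < j)%N -> A i j = 0) ->
      forall i, L A i i = cst p (A (rev_ord i) (rev_ord i))].

(** Induction on the size, in the block form of the flag matrix. The action on the block [Ymx p] is
    that of the matrices [tdelta a b] with coefficients [N A a b], so the previous cocycle can be
    reused linearly. *)
Lemma flag_cocycle_ex p : (p <= n)%N -> exists L, @flag_cocycle p L.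
Proof.
elim: p => [_|p IH pn].
  exists (fun=> 0) => A; rewrite /mxtrace big_ord1 => A0.
  split=> [i c|i q|k|_ i].
  - have Z (a b : 'I_1) : (0 : 'M[Cpoly F 0]_1) a b = 0 by rewrite mxE.
    by rewrite !big_ord1 !ord1 A0 rmorph0 mulr0 Z mul0r subrr.
  - by rewrite mxE.
  - by rewrite big_ord1 mxE mulr0.
  - by rewrite mxE !ord1 A0 rmorph0.
have [L' HL'] := IH (ltnW pn).
pose N A i r := @Nmx F p A i r.
pose tN A := \sum_i N A i i.
pose c1 : F := p.+1%:R^-1.
(* The last column of the flag matrix must remain (1, 0, ..., 0), and this dictates the first column
   of L. In the remaining block, the multiple of the identity makes up for the traces removed in
   [tdelta]. *)
have [L [L00 L0l Ll0 Lll]] : exists L : 'M[F]_p.+2 -> 'M[Cpoly F p.+1]_p.+2,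
   [/\ forall A, L A ord0 ord0 = - tN A,
     forall A j, L A ord0 (lift ord0 j) = 0,
     forall A i, L A (lift ord0 i) ord0 = \sum_s incl (Ymx p i s) * cst p.+1 (A (ulift s) ord_max)
   & forall A i j, L A (lift ord0 i) (lift ord0 j) =
       \sum_a \sum_b N A a b * incl (L' (tdelta a b) i j)
       + (i == j)%:R * (tN A * cst p.+1 c1)].
  exists (fun A => \matrix_(i, j)
    match unlift ord0 i, unlift ord0 j with
    | None, None => - tN A
    | None, Some _ => 0
    | Some i', None => \sum_s incl (Ymx p i' s) * cst p.+1 (A (ulift s) ord_max)
    | Some i', Some j' => \sum_a \sum_b N A a b * incl (L' (tdelta a b) i' j')
         + (i' == j')%:R * (tN A * cst p.+1 c1)
    end).
  by split=> *; rewrite mxE ?liftK ?unlift_none.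
exists L => A trA.
have trE : \sum_i A (ulift i) (ulift i) + A ord_max ord_max = 0.
  by move: (trA); rewrite /mxtrace big_ulift.
have tNE : tN A = \sum_i cst p.+1 (A (ulift i) (ulift i)) +
     \sum_i cst p.+1 (A (ulift i) ord_max) * xv F i.
  by rewrite /tN /N /Nmx big_split.
have sumdelta (G : 'I_p.+1 -> 'I_p.+1 -> Cpoly F p.+1) (c : Cpoly F p.+1) :
   \sum_a \sum_b G a b * ((a == b)%:R * c) = (\sum_a G a a) * c.
  rewrite mulr_suml; apply: eq_bigr => a _; rewrite (bigD1 a) //= eqxx mul1r.
  by rewrite big1 ?addr0 // => b ba; rewrite eq_sym (negPf ba) mul0r mulr0.
split=> [i c|i q|k|low i].
- rewrite /der sl_actS // sl_stepE; last exact: sl_act_mlin.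
  rewrite cm_zero_weight rmorph0 mul0r addr0 -/(tN A).
  rewrite big_ulift [X in _ = _ - X]big_ord_recl.
  have [[j ->]|->] := uliftP c; case: (unliftP ord0 i) => [i' ->|->].
  + rewrite Ylu Ylm mul0r addr0 euler_incl mulr0 add0r Y0u Ll0.
    rewrite big1 ?sub0r; last by move=> a _; rewrite big1 // => b _; rewrite dx_incl !mulr0.
    rewrite big1 ?oppr0 ?add0r; last by move=> a _; rewrite dx_incl mulr0.
    have [IHa _ _ _] := HL' _ (mxtrace_tdelta (ord0 : 'I_p.+1) ord0).
    transitivity (\sum_a \sum_b N A a b *
       (incl (Ymx p i' a) * (b == j)%:R - ((a == b)%:R * (incl (Ymx p i' j) * cst p.+1 c1))
         - \sum_q incl (L' (tdelta a b) i' q) * incl (Ymx p q j))).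
      apply: eq_bigr => a _; apply: eq_bigr => b _; congr (_ * _).
      rewrite glop_incl cm_zero_weight mulr0 rmorph0 mul0r addr0.
      rewrite -/(der _ _); have [-> _ _ _] := HL' _ (mxtrace_tdelta a b).
      rewrite raddfB /= !rmorph_sum; congr (_ - _); last first.
        by apply: eq_bigr => q _; rewrite rmorphM.
      rewrite (bigD1 a) //= !mxE eqxx /= rmorphM /= incl_cst.
      rewrite (eq_bigr (fun s => if s == j then - ((a == b)%:R * (incl (Ymx p i' j) * cst p.+1 c1)) else 0)); last first.
        move=> s sa; rewrite !mxE (negPf sa) /= sub0r rmorphM /= incl_cst.
        case: (eqVneq s j) => [->|_]; last by rewrite mulr0n oppr0 rmorph0 mulr0.
        by rewrite mulr1n rmorphN rmorphM rmorph_nat /c1; ring.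
      rewrite rmorphB rmorph_nat eq_sym mulrBr -addrA; congr (_ + _).
      case: (eqVneq a j) => [->|aj].
        rewrite mulr1n rmorphM rmorph_nat big1 ?addr0; first by rewrite /c1; ring.
        by move=> s /negPf ->.
      rewrite mulr0n rmorph0 mulr0 oppr0 add0r (bigD1 j) 1?eq_sym //= eqxx big1 ?addr0 //.
      by move=> s /andP [_ /negPf ->].
    transitivity ((\sum_a \sum_b N A a b * (incl (Ymx p i' a) * (b == j)%:R))
       - (tN A * (incl (Ymx p i' j) * cst p.+1 c1))
       - \sum_a \sum_b N A a b * \sum_q incl (L' (tdelta a b) i' q) * incl (Ymx p q j)).
      rewrite -sumdelta -!sumrB; apply: eq_bigr => a _; rewrite -!sumrB; apply: eq_bigr => b _; ring.
    have -> : \sum_a \sum_b N A a b * (incl (Ymx p i' a) * (b == j)%:R) =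
       \sum_a incl (Ymx p i' a) * N A a j.
      apply: eq_bigr => a _; rewrite (bigD1 j) //= eqxx big1 ?addr0; first by rewrite mulr1 mulrC.
      by move=> b /negPf ->; rewrite !mulr0.
    have -> : \sum_(q < p.+1) L A (lift ord0 i') (lift ord0 q) * Ymx p.+1 (lift ord0 q) (ulift j) =
       \sum_a \sum_b N A a b * \sum_q incl (L' (tdelta a b) i' q) * incl (Ymx p q j) +
       tN A * (incl (Ymx p i' j) * cst p.+1 c1).
      transitivity (\sum_q ((\sum_a \sum_b N A a b * incl (L' (tdelta a b) i' q)) * incl (Ymx p q j)
          + (i' == q)%:R * (tN A * cst p.+1 c1) * incl (Ymx p q j))).
        by apply: eq_bigr => q _; rewrite Lll Ylu mulrDl.
      rewrite big_split /=; congr (_ + _); last first.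
        rewrite (bigD1 i') //= eqxx mul1r big1 ?addr0; first by ring.
        by move=> q qi; rewrite eq_sym (negPf qi) !mul0r.
      under eq_bigr do rewrite mulr_suml.
      rewrite exchange_big; apply: eq_bigr => a _.
      under eq_bigr do rewrite mulr_suml.
      rewrite exchange_big; apply: eq_bigr => b _; rewrite mulr_sumr.
      by apply: eq_bigr => q _; rewrite mulrA.
    have -> : \sum_a incl (Ymx p i' a) * N A a j =
       \sum_i0 Ymx p.+1 (lift ord0 i') (ulift i0) * cst p.+1 (A (ulift i0) (ulift j)) +
       (\sum_s incl (Ymx p i' s) * cst p.+1 (A (ulift s) ord_max)) * xv F j.
      rewrite mulr_suml -big_split; apply: eq_bigr => a _ /=; rewrite Ylu /N /Nmx; ring.
    ring.
  + rewrite Y0u Y0m mul1r L00.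
    rewrite [X in _ - (_ + X)]big1 ?addr0; last first.
      by move=> q _; rewrite L0l mul0r.
    have eN : euler (- xv F j) = - xv F j.
      by rewrite -[- xv F j]sub0r (clinB (@euler_clin F p)) (clin0 (@euler_clin F p)) euler_xv.
    have dN b : dx b (- xv F j) = - (b == j)%:R by rewrite raddfN /= dx_xv.
    have dNj : dx j (- xv F j) = -1 by rewrite dN eqxx.
    have gN a b : glop n zero_weight (@sl_act F n zero_weight p) a b (- xv F j) = 0.
      rewrite -[- xv F j]sub0r (clinB (glop_clin n zero_weight (sl_act_mlin F n_gt0 zero_weight p) a b)).
      rewrite (clin0 (glop_clin n zero_weight (sl_act_mlin F n_gt0 zero_weight p) a b)) sub0r.
      rewrite /glop lift_xv; last exact/gl_ext_clin/sl_act_mlin.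
      rewrite /gl_ext cm_zero_weight mulr0 /scal rmorph0 mul0r addr0.
      by rewrite -/(der _ _) der1 ?rmorph0 ?mulr0 ?oppr0 // ltnW.
    rewrite eN [X in _ + X]big1 ?addr0; last by move=> a _; rewrite big1 // => b _; rewrite gN mulr0.
    have -> : \sum_i0 \sum_j0 cst p.+1 (A (ulift i0) (ulift j0)) * (xv F i0 * dx j0 (- xv F j)) =
       \sum_i0 Ymx p.+1 ord0 (ulift i0) * cst p.+1 (A (ulift i0) (ulift j)).
      apply: eq_bigr => a _; rewrite (bigD1 j) //= dNj big1 ?addr0.
        by rewrite Y0u; ring.
      by move=> b /negPf bj; rewrite dN bj oppr0 !mulr0.
    have -> : \sum_i0 cst p.+1 (A ord_max (ulift i0)) * dx i0 (- xv F j) =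
       - cst p.+1 (A ord_max (ulift j)).
      rewrite (bigD1 j) //= dNj big1 ?addr0; first by rewrite mulrN1.
      by move=> b /negPf bj; rewrite dN bj oppr0 !mulr0.
    ring.
  + rewrite Ylm Y0m mul0r addr0 mulr1 Ll0.
    rewrite [X in _ = _ - (_ + X)]big1 ?addr0; last by move=> q _; rewrite Ylm mulr0.
    rewrite (clin0 (@euler_clin F p)) mulr0 add0r.
    rewrite big1 ?sub0r; last by move=> a _; rewrite big1 // => b _; rewrite raddf0 !mulr0.
    rewrite big1 ?oppr0 ?add0r; last by move=> a _; rewrite raddf0 mulr0.
    rewrite big1; last first.
      move=> a _; rewrite big1 // => b _.
      by rewrite (clin0 (glop_clin n zero_weight (sl_act_mlin F n_gt0 zero_weight p) a b)) mulr0.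
    apply/esym/eqP; rewrite subr_eq0; apply/eqP; apply: eq_bigr => s _.
    by rewrite Ylu.
  + rewrite Y0m mul1r mulr1 L00.
    rewrite [X in _ = _ - (_ + X)]big1 ?addr0; last by move=> q _; rewrite Ylm mulr0.
    have e1 : (1 : Cpoly F p.+1) = incl 1 by [].
    rewrite e1 euler_incl mulr0 add0r.
    rewrite big1 ?sub0r; last by move=> a _; rewrite big1 // => b _; rewrite dx_incl !mulr0.
    rewrite big1 ?oppr0 ?add0r; last by move=> a _; rewrite dx_incl mulr0.
    rewrite big1; last first.
      move=> a _; rewrite big1 // => b _; rewrite glop_incl cm_zero_weight mulr0 rmorph0 mul0r addr0.
      by rewrite -/(der _ _) der1 ?rmorph0 ?mulr0 // ltnW.
    rewrite opprK tNE -rmorph_sum.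
    have -> : A ord_max ord_max = - \sum_i A (ulift i) (ulift i).
      by apply/eqP; rewrite -addr_eq0 addrC trE.
    have -> : \sum_i0 Ymx p.+1 ord0 (ulift i0) * cst p.+1 (A (ulift i0) ord_max) =
       - \sum_i0 cst p.+1 (A (ulift i0) ord_max) * xv F i0.
      by rewrite -sumrN; apply: eq_bigr => a _; rewrite Y0u; ring.
    rewrite rmorphN; ring.
- case: (unliftP ord0 i) => [i' ->|->]; case: (unliftP ord0 q) => [q' ->|->] //.
  rewrite Lll !lift0 ltnS => iq.
  rewrite (_ : (i' == q') = false) ?mul0r ?addr0; last by apply/negbTE; rewrite neq_ltn iq.
  rewrite big1 // => a _; rewrite big1 // => b _.
  have [_ H _ _] := HL' _ (mxtrace_tdelta a b).
  by rewrite H // rmorph0 mulr0.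
- rewrite sl_actS // sl_stepE; last exact: sl_act_mlin.
  have e1 : (1 : Cpoly F p.+1) = incl 1 by [].
  rewrite -/(tN A) e1 euler_incl add0r -e1 mulr1.
  rewrite big1 ?addr0; last by move=> a _; rewrite big1 // => b _; rewrite e1 dx_incl !mulr0.
  rewrite [X in _ - X]big1 ?subr0; last by move=> a _; rewrite e1 dx_incl mulr0.
  transitivity (tN A * cst p.+1 (cm F n k p.+1) +
    \sum_a \sum_b N A a b * (\sum_(s < p.+1) cst p.+1 (tail_weight k p s)%:R * incl (L' (tdelta a b) s s) +
       (a == b)%:R * cst p.+1 (c1 * cm F n k p.+1))).
    congr (_ + _); apply: eq_bigr => a _; apply: eq_bigr => b _; congr (_ * _).
    rewrite e1 glop_incl rmorphD; have [_ _ -> _] := HL' _ (mxtrace_tdelta a b).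
    rewrite /= rmorph_sum mulr1 incl_cst; congr (_ + _).
      by apply: eq_bigr => s _; rewrite rmorphM.
    by rewrite !rmorphM rmorph_nat; ring.
  rewrite [RHS]big_ord_recl L00.
  transitivity (tN A * cst p.+1 (cm F n k p.+1 + cm F n k p.+1 / p.+1%:R) +
    \sum_a \sum_b N A a b * \sum_(s < p.+1) cst p.+1 (tail_weight k p s)%:R * incl (L' (tdelta a b) s s)).
    rewrite rmorphD mulrDr -addrA; congr (_ + _).
    have := sumdelta (N A) (cst p.+1 (c1 * cm F n k p.+1)); rewrite -/(tN A) mulrC => H.
    rewrite [_ / _]mulrC mulrC -H -big_split; apply: eq_bigr => a _.
    by rewrite -big_split; apply: eq_bigr => b _ /=; rewrite mulrDr addrC.
  (* The scalar due to c_m splits into the share of row 0, where L has the entry [- tN A], and equal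
     shares [tN A / (p+1)] for the other rows. *)
  rewrite cm_tail_weight // rmorphD rmorphN mulrDr mulrN mulrN [tN A * cst p.+1 (tail_weight k p.+1 0)%:R]mulrC -addrA.
  congr (_ + _).
  transitivity (\sum_(s < p.+1) cst p.+1 (tail_weight k p s)%:R * (\sum_a \sum_b N A a b * incl (L' (tdelta a b) s s)
       + tN A * cst p.+1 c1)); last first.
    by apply: eq_bigr => s _; rewrite tail_weightS // Lll eqxx mul1r.
  rewrite rmorphM rmorph_sum mulrA mulr_sumr mulr_suml.
  under [RHS]eq_bigr do rewrite mulrDr.
  rewrite big_split /= addrC; congr (_ + _); last by apply: eq_bigr => s _; rewrite /c1; ring.
  under [RHS]eq_bigr do rewrite mulr_sumr.
  rewrite [RHS]exchange_big; apply: eq_bigr => a _.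
  under [RHS]eq_bigr do rewrite mulr_sumr.
  rewrite [RHS]exchange_big; apply: eq_bigr => b _; rewrite mulr_sumr.
  by apply: eq_bigr => s _; ring.
(* For a lower triangular A the column E_{i,m+1} is absent, so all coefficients [N A a b] are
   constants. *)
- have w0 s : A (ulift s) ord_max = 0 by apply: low; rewrite ulift_val.
  have NE a b : N A a b = cst p.+1 (A (ulift a) (ulift b)).
    by rewrite /N /Nmx w0 rmorph0 mul0r addr0.
  have tNE' : tN A = cst p.+1 (- A ord_max ord_max).
    rewrite tNE [X in _ + X]big1 ?addr0; last by move=> s _; rewrite w0 rmorph0 mul0r.
    rewrite -rmorph_sum; congr cst; apply/eqP; rewrite -addr_eq0.
    by rewrite trE.
  case: (unliftP ord0 i) => [i' ->|->].
    have -> : rev_ord (lift ord0 i') = ulift (rev_ord i').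
      by apply: ord_inj; rewrite ulift_val /= /bump.
    rewrite Lll eqxx mul1r.
    transitivity (\sum_a \sum_b N A a b * ((a == b)%:R * cst p.+1 ((a == rev_ord i')%:R - c1)) + tN A * cst p.+1 c1).
      congr (_ + _); apply: eq_bigr => a _; apply: eq_bigr => b _.
      case: (ltnP a b) => ab.
        by rewrite NE low ?rmorph0 ?mul0r // !ulift_val.
      have [_ _ _ ->] := HL' _ (mxtrace_tdelta a b); last first.
        move=> s t st; rewrite !mxE [s == t](negbTE _) ?mulr0n ?subr0; last by rewrite neq_ltn st.
        case: eqP => [sa|] //=; case: eqP => [tb|] //=; move: st; rewrite sa tb; lia.
      rewrite incl_cst; congr (_ * _); rewrite !mxE eqxx mulr1n.
      have -> : (a == b)%:R = cst p.+1 (a == b)%:R :> Cpoly F p.+1 by rewrite rmorph_nat.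
      rewrite -rmorphM; congr cst.
      rewrite [rev_ord i' == a]eq_sym; case: (eqVneq a b) => [->|nab].
        by rewrite eq_sym andbb !mul1r.
      rewrite mul0r mul0r subr0; case: eqP => //= ea; case: eqP => //= eb.
      by move: nab; rewrite ea eb eqxx.
    under eq_bigr do under eq_bigr do rewrite mulrCA mulrC.
    rewrite (eq_bigr (fun a => N A a a * cst p.+1 ((a == rev_ord i')%:R - c1))); last first.
      move=> a _; rewrite (bigD1 a) //= eqxx mulr1 big1 ?addr0 // => b ba.
      by rewrite [a == b]eq_sym (negPf ba) mulr0.
    under eq_bigr do rewrite rmorphB mulrBr.
    rewrite sumrB -mulr_suml subrK (bigD1 (rev_ord i')) //= eqxx rmorph1 mulr1 NE.
    by rewrite big1 ?addr0 // => a /negPf ->; rewrite rmorph0 mulr0.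
  have -> : rev_ord (ord0 : 'I_p.+2) = ord_max by apply: val_inj; rewrite /= subn1.
  by rewrite L00 tNE' rmorphN opprK.
Qed.

End FlagMatrix.

(** * The derivative of a determinant *)

Section Jacobi.
Variables (R : comNzRingType) (D : R -> R).
Hypotheses (DB : zmod_morphism D) (DM : forall f g, D (f * g) = D f * g + f * D g).

Lemma deriv0 : D 0 = 0.
Proof. by have := DB 0 0; rewrite !subrr. Qed.
Lemma derivN f : D (- f) = - D f.
Proof. by rewrite -sub0r DB deriv0 sub0r. Qed.
Lemma derivD f g : D (f + g) = D f + D g.
Proof. by rewrite -{1}[g]opprK DB derivN opprK. Qed.
Lemma deriv1 : D 1 = 0.
Proof.
have := DM 1 1; rewrite !mulr1 mul1r => /eqP.
by rewrite -{1}[D 1]addr0 (inj_eq (addrI _)) => /eqP <-.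
Qed.
Lemma deriv_sum I (r : seq I) P (G : I -> R) :
  D (\sum_(i <- r | P i) G i) = \sum_(i <- r | P i) D (G i).
Proof. exact: (big_morph D derivD deriv0). Qed.

Lemma deriv_sign (b : bool) : D ((-1) ^+ b) = 0.
Proof. by case: b; rewrite ?expr1 ?expr0 ?derivN deriv1 ?oppr0. Qed.

Lemma deriv_prod (I : finType) (G : I -> R) :
  D (\prod_i G i) = \sum_i \prod_j (if j == i then D (G j) else G j).
Proof.
have H (r : seq I) : uniq r -> D (\prod_(i <- r) G i) =
    \sum_(i <- r) \prod_(j <- r) (if j == i then D (G j) else G j).
  elim: r => [_|i r IH /= /andP [ir ur]]; first by rewrite !big_nil deriv1.
  rewrite !big_cons DM IH // eqxx; congr (_ + _).
    congr (_ * _); apply: eq_big_seq => j jr.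
    by case: eqP => // ji; rewrite -ji jr in ir.
  rewrite mulr_sumr; apply: eq_big_seq => j jr; rewrite big_cons.
  by case: eqP => // ij; rewrite ij jr in ir.
exact: H (index_enum_uniq I).
Qed.

Lemma deriv_det n (M : 'M[R]_n) :
  D (\det M) = \sum_i \sum_s D (M i s) * cofactor M i s.
Proof.
pose M' i := \matrix_(a, b) if a == i then D (M a b) else M a b.
transitivity (\sum_i \det (M' i)).
  rewrite /determinant deriv_sum exchange_big; apply: eq_bigr => s _.
  rewrite DM deriv_sign mul0r add0r deriv_prod mulr_sumr; apply: eq_bigr => i _.
  by congr (_ * _); apply: eq_bigr => j _; rewrite mxE.
apply: eq_bigr => i _; rewrite (expand_det_row _ i); apply: eq_bigr => s _.
rewrite mxE eqxx; congr (_ * (_ * \det _)).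
by apply/matrixP => a b; rewrite !mxE eq_sym (negPf (neq_lift _ _)).
Qed.

End Jacobi.

(** * The action on the minors of the first rows *)

Section Minors.
Variables (F : numClosedFieldType) (m : nat).
Notation n := m.+1.
Implicit Type k : nat -> nat.

Definition fund_weight (j x : nat) : nat := (x == j).

(** The columns form an arbitrary tuple instead of an increasing one. Minors are then indexed by the
    basis of a tensor power, replacing a column needs no sorting sign, and a repeated column gives
    0. *)
Definition minorY j (i : 'I_j -> 'I_n.+1) : Cpoly F n :=
  \det (\matrix_(a < j, s < j) Ymx F n (inord a) (i s)).

Definition upd j (i : {ffun 'I_j -> 'I_n.+1}) s c : {ffun 'I_j -> 'I_n.+1} :=
  [ffun t => if t == s then c else i t].

Lemma tail_weight_fund j (i : nat) : (j <= n)%N -> tail_weight n (fund_weight j) n i = (i < j)%N.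
Proof.
move=> jn; rewrite /tail_weight subnn; case: (ltnP i j) => ij.
  rewrite (bigD1_seq j.-1) ?iota_uniq //=; last by rewrite mem_index_iota; lia.
  rewrite prednK ?(leq_ltn_trans _ ij) // /fund_weight eqxx big1 ?addn0 // => x xj.
  by case: eqP => // E; move: xj; rewrite -E eqxx.
rewrite big_nat big1 // => x /andP [ix _]; rewrite /fund_weight add0n.
by case: eqP => // E; move: ij; rewrite -E; lia.
Qed.

(** The column operation acts on one slot at a time. The row operation is lower triangular, so it
    stays within the first j rows, and against the cofactors only its diagonal survives. *)
Lemma der_minor L j (i : {ffun 'I_j -> 'I_n.+1}) A : (j <= n)%N ->
  @flag_cocycle F n n L -> \tr A = 0 ->
  der n A (minorY i) =
    \sum_s \sum_c cst n (A c (i s)) * minorY (upd i s c)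
    - (\sum_(a < j) L A (inord a) (inord a)) * minorY i.
Proof.
move=> jn HL trA; have [H1 H2 _ _] := HL A trA.
set M := (\matrix_(a < j, s < j) Ymx F n (inord a) (i s)).
rewrite [in LHS]/minorY (deriv_det (D := der n A)); first last.
- by move=> f g; apply: derM.
- exact: clinB (der_clin _ _).
rewrite -/M.
have inE (a : 'I_j) : (inord a : 'I_n.+1) = a :> nat.
  by rewrite inordK // ltnS (leq_trans (ltnW (ltn_ord a))).
transitivity (\sum_(a < j) \sum_(s < j) (\sum_c Ymx F n (inord a) c * cst n (A c (i s))) * cofactor M a s
   - \sum_(a < j) \sum_(s < j) (\sum_q L A (inord a) q * Ymx F n q (i s)) * cofactor M a s).
  rewrite -sumrB; apply: eq_bigr => a _; rewrite -sumrB; apply: eq_bigr => s _.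
  by rewrite mxE H1 mulrBl.
congr (_ - _).
  rewrite exchange_big; apply: eq_bigr => s _.
  under eq_bigr do rewrite mulr_suml.
  rewrite exchange_big; apply: eq_bigr => c _.
  rewrite /minorY (expand_det_col _ s) mulr_sumr; apply: eq_bigr => a _.
  rewrite !mxE ffunE eqxx [cofactor _ a s in RHS](_ : _ = cofactor M a s); first by ring.
  congr (_ * \det _); apply/matrixP => x y; rewrite !mxE ffunE.
  by rewrite eq_sym (negPf (neq_lift _ _)).
rewrite mulr_suml; apply: eq_bigr => a _.
under eq_bigr do rewrite mulr_suml.
rewrite exchange_big /=.
have E q : \sum_s L A (inord a) q * Ymx F n q (i s) * cofactor M a s =
    if q == inord a then L A (inord a) q * minorY i else 0.
  case: (ltnP q j) => qj; last first.
    rewrite H2 ?inE ?(leq_trans (ltn_ord a)) // mul0r if_same big1 // => s _.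
    by rewrite !mul0r.
  have qE : q = inord (Ordinal qj) by apply: val_inj; rewrite /= inordK.
  transitivity (L A (inord a) q * (M *m \adj M) (Ordinal qj) a).
    rewrite mxE mulr_sumr; apply: eq_bigr => s _; rewrite !mxE -qE; ring.
  rewrite mul_mx_adj mxE; case: eqP => [<-|ne]; first by rewrite -qE eqxx.
  case: eqP => [E|]; last by rewrite mulr0.
  by case: ne; apply: val_inj; rewrite /= -[RHS]inE -E.
rewrite (bigD1 (inord a)) //= E eqxx big1 ?addr0 // => q qa.
by rewrite E (negPf qa).
Qed.

(** For the fundamental weight of index j the zeroth-order term is the sum of the first j diagonal
    entries of L. It cancels the row operation and leaves the action of a tensor power. *)
Lemma minor_act j (i : {ffun 'I_j -> 'I_n.+1}) A : (j <= n)%N -> \tr A = 0 ->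
  sl_act n (fund_weight j) A (minorY i) =
    \sum_s \sum_c cst n (A c (i s)) * minorY (upd i s c).
Proof.
move=> jn trA; have [L HL] := flag_cocycle_ex F (ltn0Sn m) (leqnn n).
rewrite sl_act_der // (der_minor i jn HL trA).
have [_ _ -> _] := HL A trA.
rewrite (_ : \sum_(i0 < n.+1) _ = \sum_(a < j) L A (inord a) (inord a)); first by ring.
rewrite (eq_bigr (fun x : 'I_n.+1 => if (x < j)%N then L A x x else 0)); last first.
  by move=> x _; rewrite tail_weight_fund //; case: ltnP => _; rewrite ?rmorph1 ?mul1r // rmorph0 mul0r.
rewrite -big_mkcond /= (big_ord_narrow (leqW jn)).
by apply: eq_bigr => x _; congr (L A _ _); apply: val_inj; rewrite /= inordK // ltnS (leq_trans (ltnW (ltn_ord x))).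
Qed.

(* Terms acting in two different slots commute, so only the terms acting twice
   in the same slot survive. *)
Lemma minor_bracket j (i : {ffun 'I_j -> 'I_n.+1}) A B : (j <= n)%N ->
  \tr A = 0 -> \tr B = 0 ->
  sl_act n (fund_weight j) (A *m B - B *m A) (minorY i) =
  sl_act n (fund_weight j) A (sl_act n (fund_weight j) B (minorY i)) -
  sl_act n (fund_weight j) B (sl_act n (fund_weight j) A (minorY i)).
Proof.
move=> jn trA trB.
have act2 (P Q : 'M[F]_n.+1) : \tr P = 0 -> \tr Q = 0 ->
  sl_act n (fund_weight j) P (sl_act n (fund_weight j) Q (minorY i)) =
  \sum_s \sum_c cst n ((P *m Q) c (i s)) * minorY (upd i s c) +
  \sum_s \sum_(t | t != s) \sum_c \sum_d
     cst n (Q c (i s)) * cst n (P d (i t)) * minorY (upd (upd i s c) t d).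
  move=> trP trQ; have PL := sl_act_clin (ltn0Sn m) (fund_weight j) P.
  rewrite (minor_act i jn trQ) (clin_sum PL) -big_split; apply: eq_bigr => s _ /=.
  transitivity (\sum_c \sum_t \sum_d cst n (Q c (i s)) * (cst n (P d (upd i s c t)) * minorY (upd (upd i s c) t d))).
    rewrite (clin_sum PL); apply: eq_bigr => c _; rewrite (clinZ PL) minor_act // mulr_sumr.
    by apply: eq_bigr => t _; rewrite mulr_sumr.
  rewrite exchange_big (bigD1 s) //=; congr (_ + _).
    rewrite exchange_big; apply: eq_bigr => d _; rewrite mxE rmorph_sum mulr_suml.
    apply: eq_bigr => c _; rewrite ffunE eqxx rmorphM mulrA [cst _ _ * cst _ _]mulrC.
    have -> // : upd (upd i s c) s d = upd i s d.
    by apply/ffunP => t; rewrite !ffunE; case: eqP.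
  apply: eq_bigr => t ts; apply: eq_bigr => c _; apply: eq_bigr => d _.
  by rewrite ffunE (negPf ts) mulrA.
rewrite !act2 //.
have -> : \sum_s \sum_(t | t != s) \sum_c \sum_d
     cst n (B c (i s)) * cst n (A d (i t)) * minorY (upd (upd i s c) t d) =
  \sum_s \sum_(t | t != s) \sum_c \sum_d
     cst n (A c (i s)) * cst n (B d (i t)) * minorY (upd (upd i s c) t d).
  rewrite [LHS](exchange_big_dep predT) //=; apply: eq_bigr => t _.
  rewrite [LHS](eq_bigl (fun s => s != t)); last by move=> s; rewrite eq_sym.
  apply: eq_bigr => s st; rewrite exchange_big; apply: eq_bigr => d _; apply: eq_bigr => c _.
  rewrite [X in X * _ = _]mulrC.
  have -> // : upd (upd i s c) t d = upd (upd i t d) s c.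
  apply/ffunP => x; rewrite !ffunE; case: (eqVneq x t) => [->|//].
  by rewrite eq_sym (negPf st).
rewrite opprD addrACA subrr addr0 minor_act //; last first.
  by rewrite raddfB /= mxtrace_mulC subrr.
rewrite -sumrB; apply: eq_bigr => s _; rewrite -sumrB; apply: eq_bigr => c _.
by rewrite !mxE rmorphB mulrBl.
Qed.

End Minors.

(** * Evaluation of the variables in a commutative ring *)

Section Evaluation.
Variables (F : fieldType) (S : comNzRingType) (phi : {rmorphism F -> S}).
Variable x : nat -> nat -> S.

(** [x i c] is the value of the variable of level i and column c, levels being numbered from 1 and
    columns from 0. *)
Fixpoint evC p : Cpoly F p -> S :=
  match p return Cpoly F p -> S with
  | 0 => phi
  | q.+1 => fun f : {mpoly (Cpoly F q)[q.+1]} => mmap (@evC q) (fun c => x q.+1 c) f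
  end.

Lemma evC_morph p : zmod_morphism (@evC p) * monoid_morphism (@evC p).
Proof.
elim: p => [|p [IH1 IH2]].
  by split=> [f g|]; [exact: rmorphB|split=> [|f g]; [exact: rmorph1|exact: rmorphM]].
pose e : {rmorphism Cpoly F p -> S} := HB.pack (@evC p)
  (GRing.isZmodMorphism.Build _ _ (@evC p) IH1)
  (GRing.isMonoidMorphism.Build _ _ (@evC p) IH2).
split; first by move=> f g; exact: (mmapB (fun c : 'I_p.+1 => x p.+1 c) e).
by have [H1 H2] := mmap_is_multiplicative (fun c : 'I_p.+1 => x p.+1 c) e; split.
Qed.
HB.instance Definition _ p :=
  GRing.isZmodMorphism.Build (Cpoly F p) S (@evC p) (evC_morph p).1.
HB.instance Definition _ p :=
  GRing.isMonoidMorphism.Build (Cpoly F p) S (@evC p) (evC_morph p).2.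

Lemma evC_incl p g : evC (@incl F p g) = evC g.
Proof. exact: (mmapC (fun c : 'I_p.+1 => x p.+1 c) (@evC p)). Qed.
Lemma evC_xv p c : evC (@xv F p c) = x p.+1 c.
Proof.
transitivity (mmap1 (fun c : 'I_p.+1 => x p.+1 c) U_(c)); last exact: mmap1U.
exact: (mmapX (fun c : 'I_p.+1 => x p.+1 c) (@evC p)).
Qed.
Lemma evC_cst p a : evC (cst p a) = phi a.
Proof. by elim: p => [|p IH] //; rewrite -incl_cst evC_incl. Qed.
End Evaluation.

Arguments evC : simpl never.

Lemma evC_Y (F : numClosedFieldType) (S : comNzRingType) (phi : {rmorphism F -> S}) x p
    (a c : 'I_p.+1) :
  evC phi x (Ymx F p a c) =
    if (c < p - a)%N then - x (p - a)%N c else (c == p - a :> nat)%N%:R.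
Proof.
elim: p a c => [|p IH] a c; first by rewrite !ord1 Y00 rmorph1 sub0n.
have [[c' ->]|->] := uliftP c; case: (unliftP ord0 a) => [a' ->|->].
- by rewrite Ylu evC_incl IH !ulift_val lift0 subSS.
- by rewrite ulift_val subn0 ltn_ord Y0u rmorphN /= evC_xv.
- rewrite Ylm rmorph0 lift0 subSS.
  have -> : (ord_max : 'I_p.+2) = p.+1 :> nat by [].
  rewrite ltnNge (leq_trans (leq_subr _ _)) //=.
  by rewrite gtn_eqF // ltnS leq_subr.
- by rewrite Y0m rmorph1 subn0 ltnn eqxx.
Qed.

(** Below its first row M is an identity matrix followed by a zero column, so the expansion along
    the last column has one term. *)
Lemma det_slice (R : comNzRingType) j (v : 'I_j.+1 -> R) (M : 'M[R]_j.+1) :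
  (forall s, M ord0 s = v s) ->
  (forall (a : 'I_j) s, M (lift ord0 a) s = (a == s :> nat)%N%:R) ->
  \det M = (-1) ^+ j * v ord_max.
Proof.
move=> H0 H1; rewrite (expand_det_col _ ord_max) big_ord_recl /= H0 big1 ?addr0; last first.
  by move=> a _; rewrite H1 /= ltn_eqF ?mul0r.
rewrite /cofactor add0n mulrC -mulrA; congr (_ * _).
rewrite (_ : row' _ _ = 1%:M) ?det1 ?mul1r //.
by apply/matrixP => a s; rewrite !mxE H1 /= /bump leqNgt ltn_ord.
Qed.

(** * The corner action and its singular vectors *)

Section Corner.
Variables (F : numClosedFieldType) (N m : nat).
Notation n := m.+1.
Hypothesis N_gt0 : (0 < N)%N.
Implicit Type k : nat -> nat.

Lemma corner_uu (A : 'M[F]_n) i j : corner A (ulift i) (ulift j) = A i j.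
Proof. by rewrite mxE /ulift !liftK. Qed.
Lemma corner_um (A : 'M[F]_n) i : corner A i ord_max = 0.
Proof. by rewrite mxE unlift_none; case: unlift. Qed.
Lemma corner_mu (A : 'M[F]_n) j : corner A ord_max j = 0.
Proof. by rewrite mxE unlift_none. Qed.

Lemma cornerP (A : 'M[F]_n) (B : 'M[F]_n.+1) :
  (forall i j, B (ulift i) (ulift j) = A i j) ->
  (forall i, B i ord_max = 0) -> (forall j, B ord_max j = 0) -> B = corner A.
Proof.
move=> H1 H2 H3; apply/matrixP => i j.
have [[j' ->]|->] := uliftP j; last by rewrite corner_um.
by have [[i' ->]|->] := uliftP i; rewrite ?corner_uu ?corner_mu.
Qed.

Lemma corner_lin a (A B : 'M[F]_n) : corner (a *: A + B) = a *: corner A + corner B.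
Proof.
apply/esym/cornerP => [i j|i|j]; rewrite !mxE -?/(ulift _).
- by rewrite /ulift !liftK.
- by rewrite unlift_none; case: unlift => *; rewrite mulr0 addr0.
- by rewrite unlift_none mulr0 addr0.
Qed.

Lemma corner_mul (A B : 'M[F]_n) : corner (A *m B) = corner A *m corner B.
Proof.
apply/esym/cornerP => [i j|i|j]; rewrite mxE big_ulift.
- rewrite corner_um mul0r addr0 mxE; apply: eq_bigr => s _.
  by rewrite !corner_uu.
- by rewrite corner_um mul0r addr0 big1 // => s _; rewrite corner_um mulr0.
- by rewrite corner_mu mul0r addr0 big1 // => s _; rewrite corner_mu mul0r.
Qed.

Lemma cornerB (A B : 'M[F]_n) : corner (A - B) = corner A - corner B.
Proof. by have := corner_lin (-1) B A; rewrite !scaleN1r addrC => ->; rewrite addrC. Qed.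

Lemma corner_tr (A : 'M[F]_n) : \tr (corner A) = \tr A.
Proof.
rewrite /mxtrace big_ulift corner_um addr0.
by apply: eq_bigr => i _; rewrite corner_uu.
Qed.

Lemma corner_delta i j : corner (delta_mx i j : 'M[F]_n) = delta_mx (ulift i) (ulift j).
Proof.
apply/esym/cornerP => [a b|a|b]; rewrite !mxE.
- by rewrite !(inj_eq lift_inj).
- by rewrite andbC eq_sym [lift _ _ == _]eq_sym ?(negPf (neq_lift _ _)) //= (negPf (neq_lift _ _)).
- by rewrite (negPf (neq_lift _ _)).
Qed.

(** The last row and column of [corner A] vanish and its trace is 0. What remains is the linear
    substitution in the last variables and the action on coefficients; both preserve the degree in
    those variables. *)
Lemma corner_actE k (A : 'M[F]_n) f : \tr A = 0 ->
  sl_act N k (corner A) f =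
  \sum_i \sum_j cst n (A i j) * (xv F i * dx j f) + lift_op (@sl_act F N k m A) f.
Proof.
move=> trA; have TL := sl_act_mlin F N_gt0 k m.
rewrite sl_actS // sl_stepE //.
have NE i r : Nmx (corner A) i r = cst n (A i r).
  by rewrite /Nmx corner_uu corner_um rmorph0 mul0r addr0.
rewrite (eq_bigr (fun i => cst n (A i i))) //; rewrite -rmorph_sum -/(\tr A) trA rmorph0 mul0r add0r.
rewrite [X in _ - X]big1 ?subr0; last by move=> i _; rewrite corner_mu rmorph0 mul0r.
congr (_ + _).
  by apply: eq_bigr => i _; apply: eq_bigr => j _; rewrite corner_uu.
apply: coefP => mu; rewrite coef_lift; last exact: TL.1.
have GL := gl_ext_lin N TL k.
have gE B g : gl_ext N k (@sl_act F N k m) B g =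
    \sum_i \sum_r cst m (B i r) * gl_ext N k (@sl_act F N k m) (delta_mx i r) g.
  have g0 : gl_ext N k (@sl_act F N k m) 0 g = 0.
    have := GL (-1) 0 0 g; rewrite scaler0 addr0 rmorphN rmorph1 mulN1r => ->.
    by rewrite addNr.
  rewrite {1}[B]matrix_sum_delta.
  have H I (r : seq I) (G : I -> 'M[F]_n) : gl_ext N k (@sl_act F N k m) (\sum_(i <- r) G i) g =
     \sum_(i <- r) gl_ext N k (@sl_act F N k m) (G i) g.
    elim: r => [|i r IH]; first by rewrite !big_nil.
    by rewrite !big_cons -[G i]scale1r GL IH rmorph1 mul1r scale1r.
  rewrite H; apply: eq_bigr => i _; rewrite H; apply: eq_bigr => j _.
  by rewrite -[_ *: _]addr0 GL g0 addr0.
rewrite -[RHS](gl_ext_tr0 N k) // gE raddf_sum; apply: eq_bigr => i _.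
rewrite raddf_sum; apply: eq_bigr => r _ /=.
rewrite NE coef_cstM coef_lift //; exact: gl_ext_clin.
Qed.

Lemma corner_act_incl k (A : 'M[F]_n) g : \tr A = 0 ->
  sl_act N k (corner A) (incl g) = incl (@sl_act F N k m A g).
Proof.
move=> trA; rewrite corner_actE // big1 ?add0r; first by rewrite lift_incl //; exact: sl_act_clin.
by move=> i _; rewrite big1 // => j _; rewrite dx_incl !mulr0.
Qed.

(** For a vector killed by this operator, the formula expresses the action on one coefficient as a
    multiple of another coefficient, as [slice_inj] requires. *)
Lemma coef_corner_delta k i j f mu : i != j ->
  coef mu (sl_act N k (delta_mx (ulift i) (ulift j)) f) =
  (if mu i == 0%N then 0 else coef (mu - U_(i) + U_(j))%MM f *+ (mu j).+1) +
  @sl_act F N k m (delta_mx i j) (coef mu f).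
Proof.
move=> ij; rewrite -corner_delta corner_actE ?mxtrace_delta ?(negPf ij) //.
rewrite raddfD /= coef_lift; last exact: sl_act_clin.
congr (_ + _); rewrite (bigD1 i) //= (bigD1 j) //= big1 ?addr0; last first.
  by move=> b bj; rewrite mxE (negPf bj) andbF rmorph0 mul0r.
rewrite [X in _ + X]big1 ?addr0; last first.
  move=> a ai; rewrite big1 // => b _; rewrite mxE (negPf ai) rmorph0 mul0r //.
rewrite mxE !eqxx rmorph1 mul1r coef_xvM; case: ifP => // _.
by rewrite coef_dx mnmBE mnm1E (negPf ij) subn0.
Qed.

Lemma coef_corner_homog k (A : 'M[F]_n) f d : \tr A = 0 ->
  (forall mu, mdeg mu != d -> coef mu f = 0) ->
  forall mu, mdeg mu != d -> coef mu (sl_act N k (corner A) f) = 0.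
Proof.
move=> trA Hf mu mud; rewrite corner_actE // raddfD /= coef_lift; last exact: sl_act_clin.
rewrite Hf // (clin0 (sl_act_clin N_gt0 k A)) addr0.
rewrite raddf_sum big1 // => i _; rewrite raddf_sum big1 // => j _ /=.
rewrite coef_cstM coef_xvM; case: ifPn => [_|mui]; first by rewrite mulr0.
rewrite coef_dx Hf ?mul0rn ?mulr0 // mdegD mdeg1.
have E : (mu - U_(i) + U_(i))%MM = mu by rewrite submK // lep1mP.
by move: mud; rewrite -{1}E mdegD mdeg1.
Qed.

End Corner.

(** * The degree in the variables of the last level *)

Section Degrees.
Variables (F : fieldType) (m : nat).
Implicit Types f g : Cpoly F m.+1.

Definition homogeneous (d : nat) f := forall mu, mdeg mu != d -> coef mu f = 0.
Definition deg_le (d : nat) f := forall mu, (d < mdeg mu)%N -> coef mu f = 0.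

Lemma homogeneousP d f : f \is @ishomog1 _ (Cpoly F m) d mdeg <-> homogeneous d f.
Proof.
split=> [/dhomog_nemf_coeff H mu mud|H]; first exact: H.
apply/dhomogP => mu; rewrite mcoeff_msupp => mu0; apply/eqP.
by apply: contraTT mu0 => /H E; rewrite negbK; apply/eqP.
Qed.

Lemma coefM mu f g : coef mu (f * g) =
    \sum_(k : 'X_{1..m.+1 < (mdeg mu).+1, (mdeg mu).+1} | mu == (k.1 + k.2)%MM)
      (coef k.1 f * coef k.2 g).
Proof. exact: mcoeffM. Qed.

Lemma homogeneousM d e f g : homogeneous d f -> homogeneous e g -> homogeneous (d + e) (f * g).
Proof.
move=> Hf Hg mu mud; rewrite coefM big1 // => k /eqP E.
have [d1|d1] := eqVneq (mdeg k.1) d; last by rewrite Hf ?mul0r.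
rewrite Hg ?mulr0 //; apply: contraNneq mud => d2.
by have := congr1 mdeg E; rewrite mdegD d1 d2 => ->.
Qed.

Lemma deg_leM d e f g : deg_le d f -> deg_le e g -> deg_le (d + e) (f * g).
Proof.
move=> Hf Hg mu mud; rewrite coefM big1 // => k /eqP E.
case: (leqP (mdeg k.1) d) => d1; last by rewrite Hf ?mul0r.
have := congr1 mdeg E; rewrite mdegD => E2; rewrite Hg ?mulr0 //.
have X : (d + e < mdeg k.1 + mdeg k.2)%N by rewrite -E2.
suff : (mdeg k.1 + e < mdeg k.1 + mdeg k.2)%N by rewrite ltn_add2l.
by apply: leq_ltn_trans X; rewrite leq_add2r.
Qed.

Lemma homogeneous_sum d I (r : seq I) (P : pred I) (G : I -> Cpoly F m.+1) :
  (forall i, P i -> homogeneous d (G i)) -> homogeneous d (\sum_(i <- r | P i) G i).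
Proof. by move=> H mu mud; rewrite raddf_sum big1 // => i Pi; exact: H. Qed.
Lemma deg_le_sum d I (r : seq I) (P : pred I) (G : I -> Cpoly F m.+1) :
  (forall i, P i -> deg_le d (G i)) -> deg_le d (\sum_(i <- r | P i) G i).
Proof. by move=> H mu mud; rewrite raddf_sum big1 // => i Pi; exact: H. Qed.

Lemma homogeneous_incl (u : Cpoly F m) : homogeneous 0 (incl u).
Proof. by move=> mu; rewrite mdeg_eq0 coef_incl => /negPf ->; rewrite mulr0. Qed.
Lemma homogeneous1 : homogeneous 0 1.
Proof. exact: homogeneous_incl. Qed.
Lemma homogeneous_xv c : homogeneous 1 (@xv F m c).
Proof.
move=> mu mu1; rewrite -[xv F c]mulr1 coef_xvM; case: ifPn => // mc.
apply: homogeneous1; apply: contraNneq mu1 => E.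
have H : (mu - U_(c) + U_(c))%MM = mu by rewrite submK // lep1mP.
by rewrite -H mdegD E mdeg1.
Qed.
Lemma homogeneousN d f : homogeneous d f -> homogeneous d (- f).
Proof. by move=> H mu mud; rewrite raddfN /= H ?oppr0. Qed.
Lemma homogeneousD d f g : homogeneous d f -> homogeneous d g -> homogeneous d (f + g).
Proof. by move=> Hf Hg mu mud; rewrite raddfD /= Hf ?Hg ?addr0. Qed.
Lemma homogeneous_cstM d a f : homogeneous d f -> homogeneous d (cst m.+1 a * f).
Proof. by move=> H mu mud; rewrite coef_cstM H ?mulr0. Qed.
Lemma homogeneous_exp d e f : homogeneous d f -> homogeneous (d * e) (f ^+ e).
Proof.
move=> H; elim: e => [|e IH]; first by rewrite muln0 expr0; exact: homogeneous1.
by rewrite mulnS exprS; exact: homogeneousM.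
Qed.
Lemma homogeneous_deg_le d e f : homogeneous d f -> (d <= e)%N -> deg_le e f.
Proof. by move=> H de mu mud; apply: H; rewrite neq_ltn orbC (leq_ltn_trans de). Qed.
Lemma homogeneous_uniq d e f : homogeneous d f -> deg_le e f -> f <> 0 -> (d <= e)%N.
Proof.
move=> H1 H2; case: (leqP d e) => // ed []; apply: coefP => mu.
rewrite raddf0; have [E|E] := eqVneq (mdeg mu) d; last exact: H1.
by apply: H2; rewrite E.
Qed.
End Degrees.

(** * The minors [zeta j], their monomials and the slice *)

Section Zeta.
Variables (F : numClosedFieldType) (m : nat).
Notation n := m.+1.
Implicit Type k : nat -> nat.

(** As j starts at 0, [zeta j] has size j + 1. Its columns m, ..., m - j avoid the last column,
    which holds the constant of the first row; hence [zeta j] is homogeneous of degree 1. *)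
Definition zcol (j : 'I_n) : {ffun 'I_j.+1 -> 'I_n.+1} := [ffun s : 'I_j.+1 => inord (m - s)].
Definition zeta (j : 'I_n) : Cpoly F n := minorY F (zcol j).
Definition zmon (a : 'I_n -> nat) : Cpoly F n := \prod_j zeta j ^+ a j.
(** These columns give the minor 1, which fills the place of a missing factor when an exponent a_j
    is smaller than k_j. *)
Definition ycol (j : nat) : {ffun 'I_j -> 'I_n.+1} := [ffun s : 'I_j => inord (n - s)].

Lemma zcol_ulift (j : 'I_n) (s : 'I_j.+1) :
  zcol j s = ulift (inord (m - s)).
Proof.
by apply: ord_inj; rewrite ffunE ulift_val !inordK // !ltnS ?leq_subr // leqW ?leq_subr.
Qed.

Lemma minorY_ycol j : (j <= n)%N -> minorY F (ycol j) = 1.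
Proof.
move=> jn; have inE (a : 'I_j) : (inord a : 'I_n.+1) = a :> nat.
  by rewrite inordK // ltnS (leq_trans (ltnW (ltn_ord a))).
have nE (s : 'I_j) : (inord (n - s) : 'I_n.+1) = (n - s)%N :> nat.
  by rewrite inordK // ltnS leq_subr.
rewrite /minorY -det_tr det_trig.
  rewrite big1 // => a _; rewrite !mxE ffunE.
  apply: (proj2 (Y_antidiag F _ _)); rewrite inE nE subnKC // (leq_trans (ltnW (ltn_ord a))) //.
apply/is_trig_mxP => a s ab; rewrite !mxE ffunE.
apply: (proj1 (Y_antidiag F _ _)); rewrite inE nE; have := ltn_ord s; lia.
Qed.

Lemma inord_lift p (a : nat) : (a <= p)%N ->
  inord a.+1 = lift ord0 (inord a) :> 'I_p.+2.
Proof. by move=> ap; apply: ord_inj; rewrite lift0 [in RHS]inordK // inordK. Qed.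

(** Only the first row of the flag matrix contains variables of the last level. *)
Lemma minor_expand j (i : 'I_j.+1 -> 'I_n.+1) : (j < n)%N ->
  exists c : 'I_j.+1 -> Cpoly F m,
    minorY F i = \sum_s Ymx F n ord0 (i s) * incl (c s).
Proof.
move=> jn; exists (fun s : 'I_j.+1 => (-1) ^+ s * \det (\matrix_(a < j, t < j)
   if unlift ord_max (i (lift s t)) is Some u then Ymx F m (inord a) u else 0)).
rewrite /minorY (expand_det_row _ ord0); apply: eq_bigr => s _.
rewrite mxE; have -> : inord (ord0 : 'I_j.+1) = ord0 :> 'I_n.+1.
  by apply: ord_inj; rewrite inordK.
rewrite /cofactor add0n rmorphM rmorphXn rmorphN1 /= -det_map_mx; congr (_ * (_ * \det _)).
apply/matrixP => a t; rewrite !mxE.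
rewrite lift0 inord_lift; last by have := ltn_ord a; lia.
case: unliftP => [u ->|->]; first by rewrite -/(ulift _) Ylu.
by rewrite Ylm rmorph0.
Qed.

Lemma deg_le_minor j (i : 'I_j -> 'I_n.+1) : (j <= n)%N -> deg_le 1 (minorY F i).
Proof.
case: j i => [|j] i jn; first by rewrite /minorY det_mx00; exact: homogeneous_deg_le (@homogeneous1 _ _) _.
have [c ->] := minor_expand i jn; apply: deg_le_sum => s _.
rewrite -[1%N]addn0; apply: deg_leM; last exact: homogeneous_deg_le (homogeneous_incl _) _.
have [[t ->]|->] := uliftP (i s).
  by rewrite Y0u; exact: (@homogeneous_deg_le F m 1 1 _ (homogeneousN (@homogeneous_xv F m t))).
by rewrite Y0m; exact: (@homogeneous_deg_le F m 0 1 _ (@homogeneous1 F m)).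
Qed.

Lemma homogeneous_zeta j : homogeneous 1 (zeta j).
Proof.
rewrite /zeta; have [c ->] := minor_expand (zcol j) (ltn_ord j); apply: homogeneous_sum => s _.
rewrite -[1%N]addn0; apply: homogeneousM; last exact: homogeneous_incl.
by rewrite zcol_ulift Y0u; apply: homogeneousN; exact: homogeneous_xv.
Qed.

Lemma homogeneous_zmon a : homogeneous (\sum_j a j)%N (zmon a).
Proof.
rewrite /zmon; elim/big_ind2: _ => [|d f e g Hf Hg|j _]; first exact: homogeneous1.
  exact: homogeneousM.
by have := homogeneous_exp (e := a j) (homogeneous_zeta j); rewrite mul1n.
Qed.

(** A lower triangular B moves a column to the right, hence onto a column already chosen or onto the
    last one, where [corner B] is zero. The diagonal sums of the column and row operations are
    shifted by one and telescope. *)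
Lemma der_zeta (B : 'M[F]_n) (j : 'I_n) : \tr B = 0 ->
  (forall a b : 'I_n, (a < b)%N -> B a b = 0) ->
  der n (corner B) (zeta j) = cst n (B (rev_ord j) (rev_ord j)) * zeta j.
Proof.
move=> trB low; have [L HL] := flag_cocycle_ex F (ltn0Sn m) (leqnn n).
have trC : \tr (corner B) = 0 by rewrite corner_tr.
have lowC (a b : 'I_n.+1) : (a < b)%N -> corner B a b = 0.
  have [[b' ->]|->] := uliftP b; last by rewrite corner_um.
  have [[a' ->]|->] := uliftP a; last by rewrite corner_mu.
  by rewrite !ulift_val corner_uu; exact: low.
have [_ _ _ H4] := HL _ trC.
pose CB x := corner B (inord x) (inord x).
have zE (s : 'I_j.+1) : zcol j s = (m - s)%N :> nat.
  by rewrite zcol_ulift ulift_val inordK // ltnS leq_subr.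
rewrite /zeta (der_minor _ _ HL) //.
transitivity ((\sum_(s < j.+1) cst n (CB (m - s)%N) - \sum_(a < j.+1) cst n (CB (n - a)%N)) * zeta j).
  rewrite mulrBl; congr (_ - _ * _); last first.
    apply: eq_bigr => a _; rewrite H4 // /CB; congr (cst _ (corner B _ _));
    apply: ord_inj; rewrite /= !inordK //; have := ltn_ord a; have := ltn_ord j; lia.
  rewrite mulr_suml; apply: eq_bigr => s _; rewrite (bigD1 (zcol j s)) //= [X in _ + X]big1 ?addr0.
    have -> : upd (zcol j) s (zcol j s) = zcol j.
      by apply/ffunP => t; rewrite [LHS]ffunE; case: eqP => [->|].
    by rewrite /CB ffunE.
  move=> c cz; case: (ltngtP c (zcol j s)) => H; last 1 first.
  - by move: cz; rewrite (ord_inj H) eqxx.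
  - by rewrite lowC // rmorph0 mul0r.
  have [[c' cE]|->] := uliftP c; last by rewrite corner_mu rmorph0 mul0r.
  have cm : (c <= m)%N by rewrite cE ulift_val -ltnS.
  rewrite zE in H; have tj : (m - c < j.+1)%N by have := ltn_ord s; lia.
  pose t := Ordinal tj.
  have ts : s != t by rewrite -(inj_eq (@ord_inj _)) /=; lia.
  rewrite (_ : minorY _ _ = 0) ?mulr0 // /minorY -det_tr.
  apply: (determinant_alternate ts) => a; rewrite !mxE [in LHS]ffunE eqxx [in RHS]ffunE.
  rewrite eq_sym (negPf ts); congr (Ymx _ _ _ _); apply: ord_inj; rewrite zE /=; lia.
congr (_ * _); rewrite -sumrB.
have tel N : \sum_(a < N.+1) (cst n (CB (m - a)%N) - cst n (CB (n - a)%N)) =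
   cst n (CB (m - N)%N) - cst n (CB n).
  elim: N => [|N IH]; first by rewrite big_ord1 !subn0.
  by rewrite big_ord_recr /= IH subSS; ring.
rewrite tel.
have -> : CB n = 0.
  by rewrite /CB (_ : inord n = ord_max) ?corner_um //; apply: ord_inj; rewrite inordK.
rewrite rmorph0 subr0 /CB (_ : inord _ = ulift (rev_ord j)) ?corner_uu //.
apply: ord_inj; rewrite ulift_val inordK /= ?subSS //; lia.
Qed.

(** The first sum is the contribution of the factors [zeta j], the second the weight of the constant
    1. *)
Definition zwt k (B : 'M[F]_n) (a : 'I_n -> nat) : F :=
  \sum_j (a j)%:R * B (rev_ord j) (rev_ord j) +
  \sum_(i < n.+1) (tail_weight n k n i)%:R * corner B (rev_ord i) (rev_ord i).

Lemma der_zmon (B : 'M[F]_n) a : \tr B = 0 ->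
  (forall a b : 'I_n, (a < b)%N -> B a b = 0) ->
  der n (corner B) (zmon a) =
    cst n (\sum_j (a j)%:R * B (rev_ord j) (rev_ord j)) * zmon a.
Proof.
move=> trB low; rewrite /zmon rmorph_sum.
elim/big_ind2: _ => [|f d g e Hf Hg|j _].
- by rewrite mul0r; exact: der1.
- by rewrite derM // Hf Hg; ring.
rewrite rmorphM rmorph_nat; elim: (a j) => [|d IH].
  by rewrite expr0 !mul0r; exact: der1.
by rewrite exprS derM // IH der_zeta // -[d.+1]addn1 natrD; ring.
Qed.

Lemma sl_act_zmon k (B : 'M[F]_n) a : \tr B = 0 ->
  (forall a b : 'I_n, (a < b)%N -> B a b = 0) ->
  sl_act n k (corner B) (zmon a) = cst n (zwt k B a) * zmon a.
Proof.
move=> trB low; have [L HL] := flag_cocycle_ex F (ltn0Sn m) (leqnn n).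
have trC : \tr (corner B) = 0 by rewrite corner_tr.
have lowC (c d : 'I_n.+1) : (c < d)%N -> corner B c d = 0.
  have [[d' ->]|->] := uliftP d; last by rewrite corner_um.
  have [[c' ->]|->] := uliftP c; last by rewrite corner_mu.
  by rewrite !ulift_val corner_uu; exact: low.
have [_ _ H3 H4] := HL _ trC.
rewrite sl_act_der // der_zmon // H3 /zwt rmorphD mulrDl; congr (_ + _).
rewrite mulrC rmorph_sum; congr (_ * _); apply: eq_bigr => i _.
by rewrite H4 // rmorphM.
Qed.

Definition ev0 p : Cpoly F p -> F := evC idfun (fun _ _ => 0) (p := p).
Definition slice (f : Cpoly F n) : {mpoly F[n]} := map_mpoly (@ev0 m) f.
HB.instance Definition _ p := GRing.RMorphism.on (@ev0 p).
Lemma slice_zmod_morphism : zmod_morphism slice.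
Proof. exact: (raddfB (map_mpoly (@ev0 m))). Qed.
Lemma slice_monoid_morphism : monoid_morphism slice.
Proof.
by split; [exact: (rmorph1 (map_mpoly (@ev0 m)))|exact: (rmorphM (map_mpoly (@ev0 m)))].
Qed.
HB.instance Definition _ :=
  GRing.isZmodMorphism.Build (Cpoly F n) {mpoly F[n]} slice slice_zmod_morphism.
HB.instance Definition _ :=
  GRing.isMonoidMorphism.Build (Cpoly F n) {mpoly F[n]} slice slice_monoid_morphism.

Lemma slice_incl g : slice (incl g) = (ev0 g)%:MP.
Proof. exact: map_mpolyC. Qed.
Lemma slice_xv c : slice (xv F c) = 'X_c.
Proof. exact: map_mpolyX. Qed.
Lemma slice_cst a : slice (cst n a) = a%:MP.
Proof. by rewrite -incl_cst slice_incl /ev0 evC_cst. Qed.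
Lemma mcoeff_slice mu f : (slice f)@_mu = ev0 (coef mu f).
Proof. exact: mcoeff_map_mpoly. Qed.

Lemma slice_zeta j : slice (zeta j) = (-1) ^+ j.+1 * 'X_(rev_ord j).
Proof.
rewrite /zeta /minorY -det_map_mx.
rewrite (@det_slice _ _ (fun s => - 'X_(inord (m - s)))); first 1 last.
- move=> s; rewrite !mxE zcol_ulift (_ : inord _ = ord0); last by apply: ord_inj; rewrite inordK.
  by rewrite Y0u rmorphN /= slice_xv.
- move=> a s; rewrite !mxE zcol_ulift.
  rewrite lift0 inord_lift; last by move: (ltn_ord a) (ltn_ord j) => /=; lia.
  rewrite Ylu /= slice_incl /ev0 evC_Y oppr0.
  have aE : (inord a : 'I_n) = a :> nat by rewrite inordK //; move: (ltn_ord a) (ltn_ord j) => /=; lia.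
  have sE : (inord (m - s) : 'I_n) = (m - s)%N :> nat by rewrite inordK // ltnS leq_subr.
  have aj : (a < j)%N := ltn_ord a.
  have sj : (s <= j)%N by rewrite -ltnS.
  have jm : (j <= m)%N by rewrite -ltnS.
  rewrite aE sE; case: ltnP => H.
    by rewrite mpolyC0 ltn_eqF //; lia.
  rewrite mpolyC_nat; congr (nat_of_bool _)%:R.
  by apply/eqP/eqP; lia.
rewrite mulrN -mulNr exprS mulN1r; congr (- _ * 'X_ _); apply: ord_inj.
by rewrite inordK /= ?subSS // ltnS leq_subr.
Qed.

(** The order is reversed because [zeta j] restricts on the slice to the variable of index m - j, up
    to sign. *)
Definition zexp (a : 'I_n -> nat) : 'X_{1..n} := [multinom a (rev_ord c) | c < n].

Lemma slice_zmon a :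
  slice (zmon a) = (-1) ^+ (\sum_(j < n) j.+1 * a j)%N *: 'X_[zexp a].
Proof.
rewrite /zmon rmorph_prod /=.
rewrite (eq_bigr (fun j : 'I_n => (-1) ^+ (j.+1 * a j) * 'X_(rev_ord j) ^+ a j)); last first.
  by move=> j _; rewrite rmorphXn /= slice_zeta exprMn exprM.
rewrite big_split /= prodrXr -mul_mpolyC; congr (_ * _).
  by rewrite rmorphXn rmorphN1.
rewrite mpolyXE_id [RHS](reindex_inj rev_ord_inj) /=; apply: eq_bigr => j _.
by rewrite mnmE rev_ordK.
Qed.

Lemma zexp_inj (a b : 'I_n -> nat) : zexp a = zexp b -> a =1 b.
Proof.
move=> /mnmP E j; have := E (rev_ord j); by rewrite !mnmE rev_ordK.
Qed.

Lemma mdeg_zexp a : mdeg (zexp a) = (\sum_j a j)%N.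
Proof.
rewrite mdegE (reindex_inj rev_ord_inj); apply: eq_bigr => j _.
by rewrite mnmE rev_ordK.
Qed.

End Zeta.

(** * The bound on the exponents of the monomials *)

Section Theta.
Variables (F : numClosedFieldType) (m : nat).
Notation n := m.+1.
Variable j : 'I_n.

(* Adding ['X] times row [j+1] of the flag matrix to row [j] changes only the
   minors of size [j+1], and those become linear in ['X]. *)
Definition theta_pt (i c : nat) : {poly F} :=
  - ((i == n)%:R + ((i == n - j) && (c == m - j))%N%:R * 'X).

Definition theta : Cpoly F n -> {poly F} := evC (polyC : {rmorphism F -> {poly F}}) theta_pt (p := n).
HB.instance Definition _ := GRing.RMorphism.on theta.

Lemma theta_cst a : theta (cst n a) = a%:P.
Proof. exact: evC_cst. Qed.

(** The flag matrix where the variables of level n are -1 and all others 0. The first row of ones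
    keeps the minors [zeta i] nonzero at this point. *)
Definition slice_entry (a c : nat) : F := if a == 0%N then 1 else (a + c == n)%N%:R.

Lemma theta_Y (a c : 'I_n.+1) :
  theta (Ymx F n a c) = (slice_entry a c)%:P + (a == j :> nat)%N%:R * ('X * (slice_entry j.+1 c)%:P).
Proof.
rewrite /theta evC_Y /theta_pt /slice_entry.
have jn := ltn_ord j; have an := ltn_ord a; have cn := ltn_ord c.
case: ltnP => H.
  rewrite opprK; congr (_ + _).
    have [a0|a0] := eqVneq (a : nat) 0%N; first by rewrite a0 subn0 eqxx.
    by rewrite !ltn_eqF ?polyC0 //; lia.
  have -> : (n - a == n - j)%N = (a == j :> nat) by apply/eqP/eqP; lia.
  have -> : (c == m - j :> nat)%N = (j.+1 + c == n)%N by apply/eqP/eqP; lia.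
  by rewrite /= polyC_natr; case: (_ == _); case: (_ == _) => /=; rewrite ?mulr1 ?mul1r ?mulr0 ?mul0r.
have -> : (a == j :> nat)%N%:R * ('X * (j.+1 + c == n)%N%:R%:P) = 0 :> {poly F}.
  case: eqP => aj; last by rewrite mul0r.
  case: eqP => E; last by rewrite mulr0 mulr0.
  by exfalso; lia.
rewrite addr0; have [a0|a0] := eqVneq (a : nat) 0%N; first by rewrite polyC1 (_ : (_ == _) = true) //; apply/eqP; lia.
rewrite polyC_natr; congr (nat_of_bool _)%:R; by apply/eqP/eqP; lia.
Qed.

Definition slice_minor J (i : 'I_J -> 'I_n.+1) : F :=
  \det (\matrix_(a < J, s < J) slice_entry a (i s)).
Definition slice_minor1 J (i : 'I_J -> 'I_n.+1) : F :=
  \det (\matrix_(a < J, s < J) slice_entry (if a == j :> nat then j.+1 else a) (i s)).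

Lemma theta_minor J (i : 'I_J -> 'I_n.+1) : (J <= n)%N ->
  theta (minorY F i) = (slice_minor i)%:P + (j < J)%N%:R * ('X * (slice_minor1 i)%:P).
Proof.
move=> Jn; have inE (a : 'I_J) : (inord a : 'I_n.+1) = a :> nat.
  by rewrite inordK // ltnS (leq_trans (ltnW (ltn_ord a))).
have E (a s : 'I_J) : theta (Ymx F n (inord a) (i s)) = (slice_entry a (i s))%:P +
    (a == j :> nat)%N%:R * ('X * (slice_entry j.+1 (i s))%:P) by rewrite theta_Y inE.
rewrite /minorY /slice_minor /slice_minor1 -!det_map_mx; case: ltnP => jJ; last first.
  rewrite mul0r addr0; congr (\det _); apply/matrixP => a s; rewrite !mxE [LHS]E.
  by rewrite ltn_eqF ?mul0r ?addr0 // (leq_trans (ltn_ord a)).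
rewrite mul1r -[X in X + _]mul1r.
apply: (determinant_multilinear (i0 := Ordinal jJ)).
- by apply/rowP => s; rewrite !mxE [LHS](E (Ordinal jJ) s) /= eqxx !mul1r.
- apply/matrixP => a s; rewrite !mxE [RHS]E.
  by rewrite /= [bump _ _ == _]eq_sym (negPf (neq_bump _ _)) ?mul0r ?addr0.
- apply/matrixP => a s; rewrite !mxE [RHS]E.
  by rewrite /= [bump _ _ == _]eq_sym (negPf (neq_bump _ _)) ?mul0r ?addr0.
Qed.

Lemma size_theta_minor J (i : 'I_J -> 'I_n.+1) : (J <= n)%N ->
  (size (theta (minorY F i)) <= (J == j.+1).+1)%N.
Proof.
move=> Jn; rewrite theta_minor //.
have sC (a : F) : (size a%:P <= 1)%N by rewrite size_polyC; case: (a == 0).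
have sX (a : F) : (size ('X * a%:P)%R <= 2)%N.
  by rewrite mulrC (leq_trans (size_polyMleq _ _)) // size_polyX addn2 /= ltnS.
case: (ltngtP J j.+1) => JJ.
- by rewrite mul0r addr0.
(* Row j + 1 is already among the first J rows, so it now occurs twice. *)
- rewrite (_ : slice_minor1 i = 0) ?mulr0 ?addr0 //.
  have jJ : (j < J)%N by apply: ltn_trans JJ.
  have ne : Ordinal jJ != Ordinal JJ by rewrite -(inj_eq val_inj) /= ltn_eqF.
  apply: (determinant_alternate ne) => s; rewrite !mxE /= eqxx.
  by rewrite gtn_eqF.
- rewrite mul1r (leq_trans (size_polyD _ _)) // geq_max sX andbT.
  exact: leq_trans (sC _) _.
Qed.

Lemma slice_minor_zcol (i : 'I_n) : slice_minor (zcol i) != 0.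
Proof.
have zE (s : 'I_i.+1) : zcol i s = (m - s)%N :> nat.
  by rewrite zcol_ulift ulift_val inordK // ltnS leq_subr.
rewrite /slice_minor (@det_slice _ _ (fun=> 1)); first by rewrite mulr1 signr_eq0.
  by move=> s; rewrite mxE.
move=> a s; rewrite mxE /slice_entry lift0 /= zE; congr (nat_of_bool _)%:R.
have := ltn_ord i; have := ltn_ord a; have : (s <= i)%N by rewrite -ltnS.
by move=> *; apply/eqP/eqP; lia.
Qed.

(** The new last row has its only 1 in the last chosen column; expanding along it leaves a slice
    minor of size j. *)
Lemma slice_minor1_zcol : slice_minor1 (zcol j) != 0.
Proof.
have zE (s : 'I_j.+1) : zcol j s = (m - s)%N :> nat.
  by rewrite zcol_ulift ulift_val inordK // ltnS leq_subr.
have jn := ltn_ord j.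
rewrite /slice_minor1 (expand_det_row _ ord_max) (bigD1 ord_max) //= big1 ?addr0; last first.
  move=> s sj; rewrite mxE /= eqxx /slice_entry /= zE.
  have sj' : (s < j)%N by rewrite ltn_neqAle -ltnS ltn_ord andbT.
  by rewrite (_ : (_ == _) = false) ?mul0r //; apply/eqP; lia.
rewrite mxE /= eqxx /slice_entry /= zE /=.
have -> : (j.+1 + (m - j) == n)%N by apply/eqP; lia.
rewrite mul1r /cofactor mulf_neq0 ?signr_eq0 //.
set M := row' _ _; have ME (a s : 'I_j) : M a s = slice_entry a (m - s).
  have la : lift ord_max a = a :> nat by rewrite /= /bump leqNgt ltn_ord.
  have ls : lift ord_max s = s :> nat by rewrite /= /bump leqNgt ltn_ord.
  by rewrite !mxE zE ls la (ltn_eqF (ltn_ord a)).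
clearbody M; move: M ME jn; case: (nat_of_ord j) => [|i] M ME jn.
  by rewrite det_mx00 oner_eq0.
rewrite (@det_slice _ _ (fun=> 1)); first by rewrite mulr1 signr_eq0.
  by move=> s; rewrite ME.
move=> a s; rewrite ME /slice_entry lift0 /=; congr (nat_of_bool _)%:R.
have := ltn_ord a; have : (s <= i)%N by rewrite -ltnS.
by move=> *; apply/eqP/eqP; lia.
Qed.

Lemma size_theta_zeta i : size (theta (zeta F i)) = (i == j).+1.
Proof.
rewrite /zeta theta_minor //; have H := slice_minor_zcol i.
have [->|ij] := eqVneq i j.
  rewrite ltnSn mul1r addrC size_polyDl mulrC size_mulX ?polyC_eq0 ?slice_minor1_zcol //.
    by rewrite size_polyC slice_minor1_zcol.
  by rewrite !size_polyC slice_minor1_zcol; case: (_ != 0).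
case: (ltnP j i.+1) => ji; last by rewrite mul0r addr0 size_polyC H.
have ji' : (j < i)%N by rewrite ltn_neqAle -ltnS ji andbT eq_sym.
rewrite (_ : slice_minor1 _ = 0) ?mulr0 ?addr0 ?size_polyC ?H //.
have ne : Ordinal ji != (Ordinal (ji' : (j.+1 < i.+1)%N)) by rewrite -(inj_eq val_inj) /= ltn_eqF.
apply: (determinant_alternate ne) => s; rewrite !mxE /= eqxx.
by rewrite gtn_eqF.
Qed.

(** The exponent a_j can thus be read off as a degree in X, and products of minors of weight k have
    degree at most k_{j+1} there, j being numbered from 0. *)
Lemma size_theta_zmon a : size (theta (zmon F a)) = (a j).+1.
Proof.
have z0 i : theta (zeta F i) != 0 by rewrite -size_poly_gt0 size_theta_zeta.
have H (r : seq 'I_n) : uniq r ->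
    (\prod_(i <- r) theta (zeta F i) ^+ a i != 0) /\
    (size (\prod_(i <- r) theta (zeta F i) ^+ a i)) = (if j \in r then a j else 0%N).+1.
  elim: r => [|i r IH] /=; first by rewrite big_nil oner_eq0 size_poly1.
  move=> /andP [ir /IH [IH1 IH2]]; rewrite big_cons mulf_neq0 ?expf_neq0 //; split=> //.
  have E : (size (theta (zeta F i) ^+ a i)).-1 = ((i == j) * a i)%N by rewrite size_exp size_theta_zeta.
  have E' : size (theta (zeta F i) ^+ a i) = ((i == j) * a i).+1.
    by rewrite -E prednK // size_poly_gt0 expf_neq0.
  rewrite size_mul ?expf_neq0 // IH2 E' inE [j == i]eq_sym addSn addnS /=.
  case: eqP ir => [->|_] ir; first by rewrite mul1n (negPf ir) addn0.
  by rewrite mul0n.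
have [_] := H _ (index_enum_uniq _); rewrite mem_index_enum => <-.
rewrite /zmon rmorph_prod /=; congr (size (polyseq _)).
by apply: eq_bigr => i _; rewrite rmorphXn.
Qed.

End Theta.

(** * Unitary families *)

Section Hermitian.
Variables (F : numClosedFieldType) (I : finType).
Implicit Types u v a b : {ffun I -> F}.

Definition dot u v : F := \sum_i u i * (v i)^*.

Lemma dotDl u v w : dot (u + v) w = dot u w + dot v w.
Proof. by rewrite -big_split; apply: eq_bigr => i _; rewrite ffunE mulrDl. Qed.
Definition fsc (c : F) u : {ffun I -> F} := [ffun i => c * u i].
Lemma dotZl c u w : dot (fsc c u) w = c * dot u w.
Proof. by rewrite mulr_sumr; apply: eq_bigr => i _; rewrite ffunE mulrA. Qed.
Lemma dotBl u v w : dot (u - v) w = dot u w - dot v w.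
Proof. by rewrite -sumrB; apply: eq_bigr => i _; rewrite !ffunE mulrBl. Qed.
Lemma dotC u v : dot u v = (dot v u)^*.
Proof.
rewrite rmorph_sum; apply: eq_bigr => i _.
by rewrite rmorphM /= conjCK mulrC.
Qed.
Lemma dot_eq0 u : dot u u = 0 -> u = 0.
Proof.
move=> /eqP; rewrite psumr_eq0 => [/allP H|i _]; last exact: mul_conjC_ge0.
apply/ffunP => i; rewrite ffunE; have := H i (mem_index_enum i).
by rewrite mul_conjC_eq0 => /eqP.
Qed.

Definition fsubspace (P : {ffun I -> F} -> Prop) :=
  P 0 /\ forall c u v, P u -> P v -> P (fsc c u + v).

(** Gram-Schmidt without a basis, by induction on a list of coordinates that supports the subspace.
    Either all members vanish at the coordinate i, or one that does not is made orthogonal to those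
    that do, and it spans the rest. *)
Lemma orth_proj P : fsubspace P ->
  forall u, exists a, P a /\ forall b, P b -> dot (u - a) b = 0.
Proof.
have H (s : seq I) : forall Q, fsubspace Q ->
    (forall b, Q b -> forall i, i \notin s -> b i = 0) ->
    forall u, exists a, Q a /\ forall b, Q b -> dot (u - a) b = 0.
  elim: s => [|i s IH] Q [Q0 QL] Qs u.
    exists 0; split=> // b Qb; rewrite (_ : b = 0).
      by rewrite dotC /dot big1 ?rmorph0 // => i _; rewrite ffunE mul0r.
    by apply/ffunP => i; rewrite ffunE (Qs _ Qb).
  pose Q' b := Q b /\ b i = 0.
  have Q'S : fsubspace Q'.
    split=> [|c x y [Qx x0] [Qy y0]]; first by split; rewrite ?ffunE.
    by split; [exact: QL|rewrite !ffunE x0 y0 mulr0 addr0].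
  have Q's b : Q' b -> forall x, x \notin s -> b x = 0.
    move=> [Qb bi] x xs; have [->|xi] := eqVneq x i => //.
    by apply: (Qs _ Qb); rewrite inE negb_or xi.
  case: (classic (forall b, Q b -> b i = 0)) => [all0|].
    have [a [[Qa _] Ha]] := IH Q' Q'S Q's u.
    by exists a; split=> // b Qb; apply: Ha; split=> //; exact: all0.
  move=> /not_all_ex_not [v0 /(imply_to_and (Q v0))] [Qv0 /eqP v0i].
  have [p [[Qp pi] Hp]] := IH Q' Q'S Q's v0.
  have fscN c x y : x - fsc c y = fsc (- c) y + x.
    by apply/ffunP => t; rewrite !ffunE mulNr addrC.
  have [v [Qv vi Hv]] : exists v, [/\ Q v, v i != 0 & forall b, Q' b -> dot v b = 0].
    exists (v0 - p); split=> //; last by rewrite !ffunE pi subr0.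
    have -> : v0 - p = fsc (-1) p + v0 by apply/ffunP => t; rewrite !ffunE mulN1r addrC.
    exact: QL.
  have vv : dot v v != 0.
    by apply: contraNneq vi => /dot_eq0 ->; rewrite ffunE.
  have [q [[Qq qi] Hq]] := IH Q' Q'S Q's u.
  exists (fsc (dot u v / dot v v) v + q); split; first exact: QL.
  move=> b Qb; pose b' := b - fsc (b i / v i) v.
  have Q'b : Q' b'.
    split; first by rewrite /b' fscN; exact: QL.
    by rewrite !ffunE divfK // subrr.
  have bE : b = fsc (b i / v i) v + b' by rewrite addrC subrK.
  have Q'q : Q' q by split.
  rewrite dotC bE dotDl dotZl rmorphD rmorphM /= -!dotC.
  have -> : dot (u - (fsc (dot u v / dot v v) v + q)) b' = 0.
    by rewrite dotBl dotDl dotZl (Hv b') // mulr0 add0r -dotBl Hq.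
  have -> : dot (u - (fsc (dot u v / dot v v) v + q)) v = 0.
    by rewrite dotBl dotDl dotZl divfK // [dot q v]dotC (Hv q) // rmorph0 addr0 subrr.
  by rewrite mulr0 addr0.
move=> PS; apply: (H (index_enum I)) => // b _ i.
by rewrite mem_index_enum.
Qed.

End Hermitian.

Section UnitaryFamilies.
Variables (F : numClosedFieldType) (m : nat).
Notation n := m.+1.
Implicit Type k : nat -> nat.

Definition dagger p (A : 'M[F]_p) : 'M[F]_p := \matrix_(i, j) (A j i)^*.

Definition lcomb (I : finType) (g : I -> Cpoly F n) (u : I -> F) : Cpoly F n :=
  \sum_i cst n (u i) * g i.

(* A finite family spanning a quotient of a unitary module: [rho] is the matrix
   of the action and [w] a height that the positive root vectors raise. *)
Record unitary_family k (I : finType) (g : I -> Cpoly F n)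
    (rho : 'M[F]_n.+1 -> I -> I -> F) (w : I -> nat) (d : nat) : Prop := UFam {
  unitary_family_act : forall A i, \tr A = 0 ->
    sl_act n k A (g i) = lcomb g (fun i' => rho A i' i);
  unitary_family_bracket : forall A B i, \tr A = 0 -> \tr B = 0 ->
    sl_act n k (A *m B - B *m A) (g i) =
    sl_act n k A (sl_act n k B (g i)) - sl_act n k B (sl_act n k A (g i));
  unitary_family_dagger : forall A i i', rho (dagger A) i i' = (rho A i' i)^*;
  unitary_family_height : forall (p q : 'I_n.+1) i i', (q < p)%N ->
    rho (delta_mx p q) i' i != 0 -> (w i < w i')%N;
  unitary_family_deg : forall i, deg_le d (g i);
  unitary_family_theta : forall j i, (size (theta j (g i)) <= (k j.+1).+1)%N;
  unitary_family_zmon : forall a, (forall j : 'I_n, (a j <= k j.+1)%N) ->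
    exists u, zmon F a = lcomb g u
}.

Lemma zmon0 a : (forall j, a j = 0%N) -> zmon F a = 1 :> Cpoly F n.
Proof. by move=> a0; rewrite /zmon big1 // => j _; rewrite a0 expr0. Qed.

Lemma zmonD a b c : (forall j, a j = (b j + c j)%N) ->
  zmon F a = zmon F b * zmon F c :> Cpoly F n.
Proof.
by move=> H; rewrite /zmon -big_split; apply: eq_bigr => j _; rewrite H exprD.
Qed.

Lemma unitary_family0 k : (forall j, (1 <= j <= n)%N -> k j = 0%N) ->
  @unitary_family k unit (fun=> 1) (fun _ _ _ => 0) (fun=> 0%N) 0.
Proof.
move=> zero_weight; have act1 A : @sl_act F n k n A 1 = 0.
  have := @sl_act_leibniz F n (ltn0Sn m) k k k n A 1 1 (leqnn n).
  rewrite !mulr1 mul1r => /(_ _)/eqP.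
  rewrite -{1}[sl_act n k A 1]addr0 (inj_eq (addrI _)) eq_sym => /(_ _)/eqP; apply=> j jn.
  by rewrite zero_weight.
have act0 A : @sl_act F n k n A 0 = 0 by exact: clin0 (sl_act_clin _ _ _).
split=> //=.
- by move=> A i _; rewrite act1 /lcomb big1 // => ? _; rewrite rmorph0 mul0r.
- by move=> A B i _ _; rewrite !act1 !act0 subrr.
- by move=> A i i'; rewrite rmorph0.
- by move=> p q i i' _; rewrite eqxx.
- by move=> i; apply: homogeneous_deg_le (@homogeneous1 _ _) _.
- by move=> j i; rewrite rmorph1 size_poly1.
- move=> a ak; exists (fun=> 1); rewrite zmon0; last first.
    by move=> j; have := ak j; rewrite zero_weight ?leqn0 => [/eqP|] //; rewrite ltn_ord.
  by rewrite /lcomb big_const /= iter_addr addr0 card_unit mulr1n rmorph1 mulr1.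
Qed.

Lemma upd_eq j (i i' : {ffun 'I_j -> 'I_n.+1}) s (G : 'I_n.+1 -> F) :
  \sum_c G c * (i' == upd i s c)%:R = G (i' s) * (i' == upd i s (i' s))%:R.
Proof.
rewrite (bigD1 (i' s)) //= big1 ?addr0 // => c ci.
case: eqP => [E|]; last by rewrite mulr0.
by move: ci; rewrite E ffunE eqxx eqxx.
Qed.

(** Agreeing outside the slot s is a symmetric relation; this yields the contravariance of the
    matrices [rho]. *)
Lemma upd_sym j (i i' : {ffun 'I_j -> 'I_n.+1}) s :
  (i' == upd i s (i' s)) = (i == upd i' s (i s)).
Proof.
have H (a b : {ffun 'I_j -> 'I_n.+1}) : a = upd b s (a s) -> b = upd a s (b s).
  move=> /ffunP E; apply/ffunP => t; have := E t; rewrite !ffunE.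
  by case: eqP => [->|_ ->].
by apply/eqP/eqP; exact: H.
Qed.

(** Here [rho] is the action on the j-th tensor power of the standard module, the tensors of basis
    vectors being orthonormal. A positive root vector replaces an index by a larger one, so the sum
    of the indices is a height. *)
Lemma unitary_family_minor j : (0 < j)%N -> (j <= n)%N ->
  @unitary_family (fund_weight j) {ffun 'I_j -> 'I_n.+1} (fun i => minorY F i)
    (fun A i' i => \sum_s \sum_c A c (i s) * (i' == upd i s c)%:R)
    (fun i => (\sum_s i s)%N) 1.
Proof.
move=> j0 jn; split.
- move=> A i trA; rewrite minor_act // /lcomb.
  under [RHS]eq_bigr do rewrite rmorph_sum mulr_suml.
  rewrite [RHS]exchange_big; apply: eq_bigr => s _.
  under [RHS]eq_bigr do rewrite rmorph_sum mulr_suml.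
  rewrite [RHS]exchange_big; apply: eq_bigr => c _.
  rewrite [RHS](bigD1 (upd i s c)) //= eqxx mulr1 big1 ?addr0 // => i' /negPf ->.
  by rewrite mulr0 rmorph0 mul0r.
- by move=> A B i trA trB; exact: minor_bracket.
- move=> A i i'; rewrite rmorph_sum; apply: eq_bigr => s _.
  by rewrite !upd_eq mxE rmorphM rmorph_nat /= upd_sym.
- move=> p q i i' qp nz.
  have [s /existsP [c]] : exists s, [exists c, delta_mx p q c (i s) * (i' == upd i s c)%:R != 0 :> F].
    apply/existsP; apply: contraNT nz => /existsPn H.
    rewrite big1 // => s _; rewrite big1 // => c _; apply/eqP.
    by have /existsPn/(_ c) := H s; rewrite negbK.
  rewrite mxE mulf_eq0 negb_or !pnatr_eq0 !eqb0 !negbK => /andP [/andP [/eqP -> /eqP isq] /eqP ->].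
  rewrite [X in (X < _)%N](bigD1 s) //= [X in (_ < X)%N](bigD1 s) //= ffunE eqxx isq.
  rewrite [X in (_ < _ + X)%N](eq_bigr (fun t => i t : nat)) ?ltn_add2r // => t ts.
  by rewrite ffunE (negPf ts).
- by move=> i; exact: deg_le_minor.
- by move=> x i; have := @size_theta_minor F m x j i jn; rewrite /fund_weight eq_sym.
- move=> a ak.
  have incomb (i : {ffun 'I_j -> 'I_n.+1}) : exists u, minorY F i = lcomb (fun i : {ffun 'I_j -> 'I_n.+1} => minorY F i) u.
    exists (fun i' => (i' == i)%:R); rewrite /lcomb (bigD1 i) //= eqxx rmorph1 mul1r big1 ?addr0 //.
    by move=> i' /negPf ->; rewrite rmorph0 mul0r.
  have jm : (j.-1 < n)%N by rewrite prednK.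
  pose x := Ordinal jm.
  have ay y : y != x -> a y = 0%N.
    move=> yx; apply/eqP; have := ak y; rewrite /fund_weight; case: eqP => [E|_]; last by rewrite leqn0.
    by case/negP: yx; apply/eqP/ord_inj; rewrite /= -E.
  (* The only exponent that may differ from 0 is at most 1: the monomial is either the minor 1 or
     [zeta x]. *)
  have := ak x; rewrite /fund_weight /= prednK // eqxx.
  case ax : (a x) => [|[|]] // _.
    rewrite zmon0; first by rewrite -(minorY_ycol F jn); exact: incomb.
    by move=> y; have [->|/ay] := eqVneq y x.
  rewrite /zmon (bigD1 x) //= ax expr1 big1 ?mulr1; last by move=> y /ay ->.
  rewrite /zeta; move: (zcol x); rewrite /x /= prednK //.
Qed.

Lemma sum_pair_l (I1 I2 : finType) (f : I1 -> F) (g1 : I1 -> Cpoly F n) (g2 : I2 -> Cpoly F n) i2 :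
  \sum_(x : I1 * I2) cst n (f x.1 * (x.2 == i2)%:R) * (g1 x.1 * g2 x.2) =
  (\sum_x cst n (f x) * g1 x) * g2 i2.
Proof.
rewrite mulr_suml -(pair_bigA _ (fun x y => cst n (f x * (y == i2)%:R) * (g1 x * g2 y))) /=.
apply: eq_bigr => x _; rewrite (bigD1 i2) //= eqxx mulr1 mulrA big1 ?addr0 //.
by move=> y /negPf ->; rewrite mulr0 rmorph0 mul0r.
Qed.

Lemma sum_pair_r (I1 I2 : finType) (f : I2 -> F) (g1 : I1 -> Cpoly F n) (g2 : I2 -> Cpoly F n) i1 :
  \sum_(x : I1 * I2) cst n ((x.1 == i1)%:R * f x.2) * (g1 x.1 * g2 x.2) =
  g1 i1 * (\sum_x cst n (f x) * g2 x).
Proof.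
rewrite -(pair_bigA _ (fun x y => cst n ((x == i1)%:R * f y) * (g1 x * g2 y))) /=.
rewrite (bigD1 i1) //= eqxx [X in _ + X]big1 ?addr0; last first.
  by move=> x /negPf ->; rewrite big1 // => y _; rewrite mul0r rmorph0 mul0r.
by rewrite mulr_sumr; apply: eq_bigr => y _; rewrite mul1r mulrCA.
Qed.

(** The tensor product of two families. The bracket relation passes to products because the mixed
    terms of the Leibniz rule cancel. *)
Lemma unitary_familyM k k1 k2 I1 I2 g1 g2 rho1 rho2 w1 w2 d1 d2 :
  (forall j, (1 <= j <= n)%N -> k j = (k1 j + k2 j)%N) ->
  @unitary_family k1 I1 g1 rho1 w1 d1 -> @unitary_family k2 I2 g2 rho2 w2 d2 ->
  @unitary_family k (I1 * I2)%type (fun x => g1 x.1 * g2 x.2)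
    (fun A x' x => rho1 A x'.1 x.1 * (x'.2 == x.2)%:R + (x'.1 == x.1)%:R * rho2 A x'.2 x.2)
    (fun x => (w1 x.1 + w2 x.2)%N) (d1 + d2).
Proof.
move=> kE U1 U2.
have LE A f h : @sl_act F n k n A (f * h) = sl_act n k1 A f * h + f * sl_act n k2 A h.
  exact: sl_act_leibniz.
have kj (j : 'I_n) : k j.+1 = (k1 j.+1 + k2 j.+1)%N by rewrite kE // ltn_ord.
split.
- move=> A [i1 i2] trA /=; rewrite LE (unitary_family_act U1) // (unitary_family_act U2) // /lcomb.
  rewrite -(sum_pair_l (fun x => rho1 A x i1)) -(sum_pair_r (fun x => rho2 A x i2)) -big_split.
  by apply: eq_bigr => x _ /=; rewrite rmorphD mulrDl.
- move=> A B [i1 i2] trA trB /=.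
  rewrite !LE (unitary_family_bracket U1) // (unitary_family_bracket U2) //.
  rewrite !(clinD (sl_act_clin (ltn0Sn m) k _)) !LE; ring.
- move=> A [i1 i2] [i1' i2'] /=; rewrite (unitary_family_dagger U1) (unitary_family_dagger U2).
  by rewrite rmorphD !rmorphM !rmorph_nat /= eq_sym [i1 == _]eq_sym.
- move=> p q [i1 i2] [i1' i2'] qp /=.
  have [->|n2] := eqVneq i2' i2; have [->|n1] := eqVneq i1' i1;
    rewrite ?mulr0 ?mul0r ?mulr1 ?mul1r ?addr0 ?add0r ?eqxx //.
  + have [r1|r1] := eqVneq (rho1 (delta_mx p q) i1 i1) 0.
      by rewrite r1 add0r => /(unitary_family_height U2 qp); rewrite ltnn.
    by have := unitary_family_height U1 qp r1; rewrite ltnn.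
  + by move=> /(unitary_family_height U1 qp); rewrite ltn_add2r.
  + by move=> /(unitary_family_height U2 qp); rewrite ltn_add2l.
- by move=> [i1 i2]; apply: deg_leM; [exact: unitary_family_deg U1 _|exact: unitary_family_deg U2 _].
- move=> j [i1 i2]; rewrite rmorphM /= kj; apply: leq_trans (size_polyMleq _ _) _.
  have := unitary_family_theta U1 j i1; have := unitary_family_theta U2 j i2; lia.
(* The exponents are split greedily: [a1] takes as much as k1 allows, and the rest fits below k2. *)
- move=> a ak; pose a1 j := minn (a j) (k1 j.+1); pose a2 j := (a j - a1 j)%N.
  have [u1 E1] : exists u, zmon F a1 = lcomb g1 u by apply: (unitary_family_zmon U1) => j; exact: geq_minr.
  have [u2 E2] : exists u, zmon F a2 = lcomb g2 u.
    apply: (unitary_family_zmon U2) => j; have := ak j; rewrite kj /a2 /a1; lia.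
  exists (fun x => u1 x.1 * u2 x.2).
  rewrite (@zmonD a a1 a2); last by move=> j; rewrite /a2 subnKC // geq_minl.
  rewrite E1 E2 /lcomb mulr_suml.
  rewrite -(pair_bigA _ (fun x y => cst n (u1 x * u2 y) * (g1 x * g2 y))) /=.
  apply: eq_bigr => x _; rewrite mulr_sumr; apply: eq_bigr => y _.
  by rewrite rmorphM; ring.
Qed.

(** Induction on |λ|, splitting off one fundamental weight at a time. A minor has degree at most 1,
    which is why the degree bound is |λ|. *)
Lemma unitary_family_ex k : exists (I : finType) g rho w,
  @unitary_family k I g rho w (\sum_(1 <= i < n.+1) k i)%N.
Proof.
move Ed : (\sum_(1 <= i < n.+1) k i)%N => d; elim: d k Ed => [|d IH] k Ed.
  do 4!eexists; apply: unitary_family0 => j jn.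
  by move/eqP: Ed; rewrite sum_nat_seq_eq0 => /allP /(_ j); rewrite mem_index_iota ltnS => /(_ jn) /eqP.
have [j [j0 jn kj]] : exists j, [/\ (0 < j)%N, (j <= n)%N & (0 < k j)%N].
  have : (\sum_(1 <= i < n.+1) k i)%N != 0%N by rewrite Ed.
  rewrite sum_nat_seq_eq0 => /allPn [j]; rewrite mem_index_iota ltnS => /andP [j0 jn].
  by rewrite -lt0n; exists j.
pose k' x := (k x - fund_weight j x)%N.
have kE x : k x = (fund_weight j x + k' x)%N.
  by rewrite /k' /fund_weight subnKC //; case: eqP => // ->.
have Ek' : (\sum_(1 <= i < n.+1) k' i)%N = d.
  apply/eqP; rewrite -(eqn_add2l 1) [X in _ == X]add1n -Ed (eq_bigr _ (fun i _ => kE i)) big_split /=.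
  rewrite eqn_add2r (bigD1_seq j) ?iota_uniq ?mem_index_iota ?j0 //= /fund_weight eqxx big1 //.
  by move=> x /negPf; rewrite /fund_weight => ->.
have [I [g [rho [w U]]]] := IH k' Ek'.
by do 4!eexists; rewrite -add1n; apply: unitary_familyM U => //; exact: unitary_family_minor.
Qed.

End UnitaryFamilies.

(** * Subspaces, spans and generated submodules *)

Section Subspaces.
Variables (F : fieldType) (p : nat).
Implicit Types W : Cpoly F p -> Prop.

Lemma subsp0 W : subspace W -> W 0.
Proof. by case. Qed.
Lemma subspD W f g : subspace W -> W f -> W g -> W (f + g).
Proof. by move=> [_ H] Wf Wg; have := H 1 f g Wf Wg; rewrite /scal rmorph1 mul1r. Qed.
Lemma subspZ W a f : subspace W -> W f -> W (cst p a * f).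
Proof. by move=> WS Wf; have := WS.2 a f 0 Wf (subsp0 WS); rewrite addr0. Qed.
Lemma subspN W f : subspace W -> W f -> W (- f).
Proof. by move=> WS /(subspZ (-1) WS); rewrite rmorphN rmorph1 mulN1r. Qed.
Lemma subspB W f g : subspace W -> W f -> W g -> W (f - g).
Proof. by move=> WS Wf Wg; apply: subspD => //; exact: subspN. Qed.
Lemma subsp_sum W I (r : seq I) (P : pred I) G : subspace W ->
  (forall i, P i -> W (G i)) -> W (\sum_(i <- r | P i) G i).
Proof.
by move=> WS H; elim/big_ind: _ => [|f g|//]; [exact: subsp0|exact: subspD].
Qed.

Lemma span_subspace (S : Cpoly F p -> Prop) : subspace (Defs.span S).
Proof.
split; first by exists 0%N, (fun=> 0), (fun=> 0); split=> [[]|] //; rewrite big_ord0.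
move=> a f g [N1 [a1 [g1 [H1 ->]]]] [N2 [a2 [g2 [H2 ->]]]].
exists (N1 + N2)%N, (fun i => match split i with inl x => a * a1 x | inr y => a2 y end),
  (fun i => match split i with inl x => g1 x | inr y => g2 y end); split.
  by move=> i; case: (split i).
rewrite big_split_ord /= /scal mulr_sumr; congr (_ + _); apply: eq_bigr => i _.
  by rewrite (unsplitK (inl i)) rmorphM mulrA.
by rewrite (unsplitK (inr i)).
Qed.

Lemma span_gen (S : Cpoly F p -> Prop) f : S f -> Defs.span S f.
Proof.
by move=> Sf; exists 1%N, (fun=> 1), (fun=> f); split; last by rewrite big_ord1 /scal rmorph1 mul1r.
Qed.

Lemma span_min (S W : Cpoly F p -> Prop) : subspace W -> (forall f, S f -> W f) ->
  forall f, Defs.span S f -> W f.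
Proof.
move=> WS SW f [N [a [g [H ->]]]]; apply: subsp_sum => // i _.
by apply: subspZ => //; exact: SW.
Qed.
End Subspaces.

Section Generated.
Variables (F : fieldType) (q p : nat) (act : 'M[F]_q.+1 -> Cpoly F p -> Cpoly F p).

(** An intersection of submodules rather than a span of words as in [Umul]: induction over the
    generated submodule is then immediate. *)
Definition Gen v f := forall W, submodule act W -> W v -> W f.

Lemma Gen_gen v : Gen v v.
Proof. by move=> W. Qed.
Lemma Gen_submodule v : submodule act (Gen v).
Proof.
split; first split=> [W [WS _] _|a f g Hf Hg W WS Wv]; first exact: subsp0.
  by apply: (WS.1.2); [exact: Hf|exact: Hg].
by move=> A f trA Hf W WS Wv; apply: WS.2 => //; exact: Hf.
Qed.
Lemma Gen_min v W : submodule act W -> W v -> forall f, Gen v f -> W f.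
Proof. by move=> WS Wv f; exact. Qed.

Hypothesis act_lin : forall A, clin (act A).

Lemma Umul_submodule S : submodule act (Umul act S).
Proof.
split=> [|A f trA]; first exact: span_subspace.
apply: (span_min (W := fun f => Umul act S (act A f))).
  have SS := span_subspace (fun f => exists (s : seq 'M[F]_q.+1) (w : Cpoly F p),
    [/\ forall A, A \in s -> \tr A = 0, S w & f = foldr act w s]).
  split=> [|a g h Hg Hh]; first by rewrite (clin0 (act_lin A)); exact: subsp0 SS.
  by rewrite /scal (act_lin A); apply: SS.2.
move=> _ [s [w [Hs Sw ->]]]; apply: span_gen; exists (A :: s), w; split=> // B.
by rewrite inE => /orP [/eqP ->|/Hs].
Qed.

Lemma Umul_gen (S : Cpoly F p -> Prop) f : S f -> Umul act S f.
Proof.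
by move=> Sf; apply: span_gen; exists [::], f.
Qed.

Lemma Umul_min (S W : Cpoly F p -> Prop) : submodule act W -> (forall f, S f -> W f) ->
  forall f, Umul act S f -> W f.
Proof.
move=> WS SW; apply: span_min => [|_ [s [w [Hs Sw ->]]]]; first exact: WS.1.
elim: s Hs => [|A s IH] Hs /=; first exact: SW.
apply: WS.2; first by apply: Hs; rewrite mem_head.
by apply: IH => B Bs; apply: Hs; rewrite inE Bs orbT.
Qed.

End Generated.

(** * Raising operators and contravariant forms *)

Section Positive.
Variables (F : numClosedFieldType) (n : nat).
Hypothesis n_gt0 : (0 < n)%N.
Implicit Type k : nat -> nat.

Lemma act_row k p (i : 'I_p.+1) f :
  sl_act n k (delta_mx ord_max (ulift i)) f = - dx i f :> Cpoly F p.+1.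
Proof.
rewrite sl_actS // sl_stepE; last exact: sl_act_mlin.
have lm (a : 'I_p.+1) : (ulift a == ord_max) = false.
  by apply/negbTE; rewrite eq_sym; exact: neq_lift.
have N0 a b : Nmx (delta_mx ord_max (ulift i) : 'M[F]_p.+2) a b = 0.
  by rewrite /Nmx !mxE lm /= rmorph0 mul0r addr0.
rewrite big1 ?mul0r ?add0r; last by [].
rewrite big1 ?sub0r; last first.
  by move=> a _; rewrite big1 // => b _; rewrite mxE lm rmorph0 mul0r.
rewrite [X in _ + X]big1 ?addr0; last by move=> a _; rewrite big1 // => b _; rewrite N0 mul0r.
rewrite (bigD1 i) //= mxE !eqxx rmorph1 mul1r big1 ?addr0 // => a ai.
by rewrite mxE (inj_eq lift_inj) (negPf ai) andbF rmorph0 mul0r.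
Qed.

Lemma cpoly_natr_neq0 p e : e.+1%:R != 0 :> Cpoly F p.
Proof.
elim: p => [|p IH]; first by rewrite pnatr_eq0.
by rewrite -(rmorph_nat (@incl F p)) -(rmorph0 (@incl F p)) (inj_eq (@incl_inj F p)).
Qed.

(* Differentiating by the variables of the last row brings a nonzero element of
   the subspace into the previous polynomial ring. *)
Lemma constant_in_stable k p (S : Cpoly F p -> Prop) : subspace S ->
  (forall (i j : 'I_p.+1) f, (j < i)%N -> S f -> S (sl_act n k (delta_mx i j) f)) ->
  (exists2 f, S f & f <> 0) -> S 1.
Proof.
elim: p S => [|p IH] S SS stab [f Sf f0].
  have := subspZ (f^-1 : F) SS Sf.
  by rewrite [cst 0 _]/(f^-1 : F) mulVf //; apply/eqP.
have Sdx i g : S g -> S (dx i g).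
  move=> Sg; rewrite -[dx i g]opprK -(act_row k); apply: subspN => //.
  by apply: stab => //; rewrite ulift_val.
have [g Sg g0] : exists2 g, S (incl g) & g <> 0.
  have [mu] : exists mu, coef mu f <> 0.
    apply: NNPP => H; apply: f0; apply: coefP => mu; rewrite raddf0.
    by apply: NNPP => H'; apply: H; exists mu.
  have : exists d, deg_le d f.
    exists (mmeasure mdeg (f : {mpoly (Cpoly F p)[p.+1]})) => nu /ltnW nud.
    exact: (memN_msupp_eq0 (msize_mdeg_ge nud)).
  move=> [d df]; elim: d f Sf f0 df mu => [|d IHd] f Sf f0 df mu.
    move=> mf; exists (coef 0%MM f); last first.
      have [<-//|mu0] := eqVneq mu 0%MM; case: mf; apply: df.
      by rewrite lt0n mdeg_eq0.
    suff <- : f = incl (coef 0%MM f) by [].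
    apply: coefP => nu; rewrite coef_incl; have [->|nu0] := eqVneq nu 0%MM.
      by rewrite mulr1.
    by rewrite mulr0 df // lt0n mdeg_eq0.
  (* If all partial derivatives vanish, then in characteristic 0 only the constant coefficient is
     left; otherwise some nonzero derivative has a smaller degree bound. *)
  move=> mf; case: (classic (forall i, dx i f = 0)) => [H|].
    have df0 nu : nu != 0%MM -> coef nu f = 0.
      move=> nu0; have [i nui] : exists i, nu i != 0%N.
        apply/existsP; apply: contraNT nu0 => /existsPn H'; apply/eqP/mnmP => i.
        by rewrite mnm0E; apply/eqP; have := H' i; rewrite negbK.
      have := congr1 (coef (nu - U_(i))%MM) (H i); rewrite coef_dx raddf0.
      rewrite submK ?lep1mP // -mulr_natr => /eqP.
      by rewrite mulf_eq0 (negPf (cpoly_natr_neq0 _ _)) orbF => /eqP.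
    apply: (IHd f Sf f0 _ mu mf) => nu; rewrite ltnNge => nud; apply: df0.
    by apply: contraNneq nud => ->; rewrite mdeg0.
  move=> /not_all_ex_not [i di0].
  have [nu nuf] : exists nu, coef nu (dx i f) <> 0.
    apply: NNPP => H; apply: di0; apply: coefP => nu; rewrite raddf0.
    by apply: NNPP => H'; apply: H; exists nu.
  apply: (IHd (dx i f) _ di0 _ nu nuf); first exact: Sdx.
  by move=> xi xid; rewrite coef_dx df ?mul0rn // mdegD mdeg1 addn1.
rewrite -(rmorph1 (@incl F p)).
apply: (IH (fun h => S (incl h))); last by exists g.
  split=> [|a x y Sx Sy]; first by rewrite rmorph0; exact: subsp0.
  have -> : incl (scal a x + y) = cst p.+1 a * incl x + incl y by rewrite rmorphD rmorphM.
  by apply: subspD => //; exact: subspZ.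
move=> i j h ij Sh.
have trd : \tr (delta_mx i j : 'M[F]_p.+1) = 0 
  by rewrite mxtrace_delta (_ : (i == j) = false) //; apply/negbTE; rewrite neq_ltn ij orbT.
rewrite -corner_act_incl // corner_delta; apply: stab => //.
by rewrite !ulift_val.
Qed.

(** The coefficients of such an f span a subspace of [Cpoly F m] stable under raising operators. If
    f is nonzero this subspace contains 1, yet all coefficients vanish at the origin. *)
Lemma slice_inj k m f :
  (forall i j : 'I_m.+1, (j < i)%N ->
     sl_act n k (delta_mx (ulift i) (ulift j)) f = 0 :> Cpoly F m.+1) ->
  slice f = 0 -> f = 0.
Proof.
move=> sing sf0; apply: NNPP => f0.
have ev_coef mu : ev0 (coef mu f) = 0 by rewrite -mcoeff_slice sf0 mcoeff0.
pose S (g : Cpoly F m) := exists (r : seq (F * 'X_{1..m.+1})),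
  g = \sum_(x <- r) cst m x.1 * coef x.2 f.
have SS : subspace S.
  split; first by exists [::]; rewrite big_nil.
  move=> a x y [r1 ->] [r2 ->]; exists ([seq (a * z.1, z.2) | z <- r1] ++ r2).
  rewrite big_cat big_map /= /scal mulr_sumr; congr (_ + _).
  by apply: eq_bigr => z _; rewrite rmorphM mulrA.
have Sc mu : S (coef mu f).
  by exists [:: (1, mu)]; rewrite big_seq1 rmorph1 mul1r.
have : S 1.
  apply: (@constant_in_stable k) => // [i j g ij [r ->]|]; last first.
    apply: NNPP => H; apply: f0; apply: coefP => mu; rewrite raddf0.
    by apply: NNPP => H'; apply: H; exists (coef mu f).
  have AL := sl_act_clin (F := F) n_gt0 k (delta_mx i j : 'M_m.+1).
  rewrite (clin_sum AL); apply: subsp_sum => // x _.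
  rewrite (clinZ AL); apply: subspZ => //.
  have nij : i != j by rewrite neq_ltn ij orbT.
  have := congr1 (coef x.2) (sing i j ij).
  rewrite coef_corner_delta // raddf0 addrC => /eqP; rewrite addr_eq0 => /eqP ->.
  apply: subspN => //; case: ifP => _; first exact: subsp0.
  by rewrite -mulr_natr mulrC -(rmorph_nat (@cst F m)); exact: subspZ.
move=> [r /(congr1 (@ev0 F m))]; rewrite rmorph1 rmorph_sum big1 => [/eqP|x _]; first by rewrite oner_eq0.
by rewrite rmorphM /= ev_coef mulr0.
Qed.

(** E_{1,2} sends x^i to (i - k_n) x^{i+1}: starting from 1 it reaches the powers one by one and
    stops exactly at k_n. *)
Lemma Vmod1E k f : @Vmod F n k 1 f <-> Gen (@sl_act F n k 1) 1 f.
Proof.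
pose x : Cpoly F 1 := xv F (m := 0) ord0.
pose V (g : Cpoly F 1) := exists2 i : nat, (i <= k n)%N & g = x ^+ i.
have dxE i : dx ord0 (x ^+ i) = cst 1 i%:R * x ^+ i.-1.
  elim: i => [|i IH]; first by rewrite expr0 -(rmorph1 (@cst F 1)) dx_cst rmorph0 mul0r.
  rewrite exprS dxM IH dx_xv eqxx mul1r !rmorph_nat mulrS mulrDl mul1r.
  by congr (_ + _); rewrite mulrCA -exprS; case: i {IH} => [|i] //; rewrite !mul0r.
have actE A i : sl_act n k A (x ^+ i) = cst 1 (A ord0 ord_max * (i%:R - (k n)%:R)) * x ^+ i.+1
    + cst 1 (- A ord_max ord0 * i%:R) * x ^+ i.-1
    + cst 1 (A ord0 ord0 * (2%:R * i%:R - (k n)%:R)) * x ^+ i.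
  have xdx : x * dx ord0 (x ^+ i) = cst 1 i%:R * x ^+ i.
    by rewrite dxE mulrCA -exprS; case: i => [|i] //; rewrite rmorph0 !mul0r.
  rewrite [LHS]/(sl2_act n k A (x ^+ i)) /sl2_act /scal -/x expr2 -mulrA xdx dxE exprS.
  by rewrite !rmorphM !rmorphB !rmorphM !rmorphN !rmorph_nat; ring.
have VS : submodule (@sl_act F n k 1) (Defs.span V).
  have spanS : subspace (Defs.span V) := span_subspace V.
  have Vx i : (i <= k n)%N -> Defs.span V (x ^+ i) by move=> ik; apply: span_gen; exists i.
  split=> // A g _ [N [a [g' [H ->]]]].
  have AL := sl_act_clin (F := F) n_gt0 k A.
  rewrite (clin_sum AL); apply: subsp_sum => // y _; rewrite /scal (clinZ AL); apply: subspZ => //.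
  have [i ik ->] := H y; rewrite actE; apply: subspD => //; first apply: subspD => //.
  - case: (ltnP i (k n)) => ik'; first by apply: subspZ => //; exact: Vx.
    have -> : i = k n by apply/eqP; rewrite eqn_leq ik.
    by rewrite subrr mulr0 rmorph0 mul0r; exact: subsp0.
  - by apply: subspZ => //; apply: Vx; rewrite (leq_trans (leq_pred i)).
  - by apply: subspZ => //; exact: Vx.
have GS := Gen_submodule (@sl_act F n k 1) 1.
have V1 : Defs.span V 1 by apply: span_gen; exists 0%N.
split; last by move=> /(Gen_min VS V1).
apply: (span_min (S := V)) => [|_ [i ik ->]]; first exact: GS.1.
rewrite -/x; elim: i ik => [|i IH] ik; first by rewrite expr0; exact: Gen_gen.
have := subspZ ((i%:R - (k n)%:R)^-1) GS.1 (GS.2 (delta_mx ord0 ord_max) _ _ (IH (ltnW ik))).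
have nz : i%:R - (k n)%:R != 0 :> F by rewrite subr_eq0 eqr_nat ltn_eqF.
have D01 : (delta_mx ord0 ord_max : 'M[F]_2) ord0 ord_max = 1 by rewrite mxE !eqxx.
have D10 : (delta_mx ord0 ord_max : 'M[F]_2) ord_max ord0 = 0 by rewrite mxE.
have D00 : (delta_mx ord0 ord_max : 'M[F]_2) ord0 ord0 = 0 by rewrite mxE.
rewrite actE D01 D10 D00 oppr0 !mul0r !addr0 mul1r mulrA -rmorphM mulVf // rmorph1 mul1r.
by apply; rewrite mxtrace_delta.
Qed.

(** The generating subspace of each step is itself generated by 1 under the corner subalgebra, so 1
    suffices as a generator. *)
Lemma VmodE k p f : (0 < p <= n)%N ->
  @Vmod F n k p f <-> Gen (@sl_act F n k p) 1 f.
Proof.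
case: p f => // p f; elim: p f => [|p IH] f pn; first exact: Vmod1E.
have {}IH g : Vmod n k g <-> Gen (@sl_act F n k p.+1) 1 g by apply: IH; lia.
have AL := sl_act_clin (F := F) n_gt0 k (p := p.+2).
have US := @Umul_submodule F _ _ (@sl_act F n k p.+2) AL (fun h => exists2 g, Vmod n k g & h = incl g).
have U1 : Umul (@sl_act F n k p.+2) (fun h => exists2 g, Vmod n k g & h = incl g) 1.
  by apply: Umul_gen; exists 1 => //; apply/IH; exact: Gen_gen.
split; last by move=> /(Gen_min US U1).
apply: Umul_min; first exact: Gen_submodule.
move=> _ [g /IH Vg ->].
have GS : submodule _ _ := Gen_submodule (@sl_act F n k p.+2) 1.
apply: (Gen_min (W := fun g => Gen (@sl_act F n k p.+2) 1 (incl g))) Vg; last by rewrite rmorph1; exact: Gen_gen.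
split; first split.
- by rewrite rmorph0; exact: subsp0 GS.1.
- move=> a h h' Hh Hh'.
  have -> : incl (scal a h + h') = scal a (incl h) + incl h' by rewrite rmorphD rmorphM.
  exact: (GS.1.2 a _ _ Hh Hh').
- move=> A h trA Hh; rewrite -corner_act_incl //.
  have trC : \tr (corner A) = 0 by rewrite corner_tr.
  exact: (GS.2 (corner A) _ trC Hh).
Qed.

End Positive.

Section Form.
Variables (F : numClosedFieldType) (m : nat) (k : nat -> nat).
Notation n := m.+1.
Variables (I : finType) (g : I -> Cpoly F n) (rho : 'M[F]_n.+1 -> I -> I -> F).
Variables (w : I -> nat) (d : nat).
Hypothesis U : @unitary_family F m k I g rho w d.
Local Notation act := (@sl_act F n k n).
Local Notation Z f := (exists u, f = lcomb g u).

Let actL A : clin (act A) := sl_act_clin (ltn0Sn m) k A.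

Lemma lcombD u v : lcomb g u + lcomb g v = lcomb g (fun i => u i + v i).
Proof. by rewrite -big_split; apply: eq_bigr => i _; rewrite rmorphD mulrDl. Qed.
Lemma lcombZ a u : cst n a * lcomb g u = lcomb g (fun i => a * u i).
Proof. by rewrite mulr_sumr; apply: eq_bigr => i _; rewrite rmorphM mulrA. Qed.

Lemma Z_subspace : subspace (fun f => Z f).
Proof.
split; first by exists (fun=> 0); rewrite /lcomb big1 // => i _; rewrite rmorph0 mul0r.
move=> a _ _ [u ->] [v ->]; exists (fun i => a * u i + v i).
by rewrite -lcombD -lcombZ.
Qed.

Lemma act_lcomb A u : \tr A = 0 ->
  act A (lcomb g u) = lcomb g (fun i' => \sum_i u i * rho A i' i).
Proof.
move=> trA; rewrite /lcomb (clin_sum (actL A)).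
transitivity (\sum_i \sum_i' cst n (u i * rho A i' i) * g i').
  apply: eq_bigr => i _; rewrite (clinZ (actL A)) (unitary_family_act U) // lcombZ //.
by rewrite exchange_big; apply: eq_bigr => i' _; rewrite rmorph_sum mulr_suml.
Qed.

Lemma Z_submodule : submodule act (fun f => Z f).
Proof.
by split=> [|A _ trA [u ->]]; [exact: Z_subspace|rewrite act_lcomb //; eexists].
Qed.

Lemma Z_bracket A B f : \tr A = 0 -> \tr B = 0 -> Z f ->
  act (A *m B - B *m A) f = act A (act B f) - act B (act A f).
Proof.
move=> trA trB [u ->]; rewrite /lcomb !(clin_sum (actL _)) -sumrB; apply: eq_bigr => i _.
by rewrite !(clinZ (actL _)) (unitary_family_bracket U) // mulrBr.
Qed.

Lemma Z_deg f : Z f -> deg_le d f.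
Proof.
move=> [u ->]; apply: deg_le_sum => i _ mu mud.
by rewrite coef_cstM (unitary_family_deg U) ?mulr0.
Qed.

Lemma Z_theta j f : Z f -> (size (theta j f) <= (k j.+1).+1)%N.
Proof.
move=> [u ->]; rewrite rmorph_sum; apply: (leq_trans (size_sum _ _ _)); apply/bigmax_leqP => i _.
rewrite rmorphM /= theta_cst mul_polyC; apply: leq_trans (size_scale_leq _ _) _.
exact: unitary_family_theta U _ _.
Qed.

Lemma Z_zmon a : (forall j : 'I_n, (a j <= k j.+1)%N) -> Z (zmon F a).
Proof. by move=> H; have := unitary_family_zmon U H. Qed.

Lemma Z1 : Z 1.
Proof. by rewrite -(@zmon0 F m (fun=> 0%N)) //; exact: Z_zmon. Qed.

(* On the span of a unitary family the height cannot increase forever. *)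
Lemma singular_ex (S : Cpoly F n -> Prop) : subspace S -> (forall f, S f -> Z f) ->
  (forall (i j : 'I_n) f, (j < i)%N -> S f -> S (act (delta_mx (ulift i) (ulift j)) f)) ->
  (exists2 f, S f & f <> 0) ->
  exists f, [/\ S f, f <> 0 & forall i j : 'I_n, (j < i)%N ->
    act (delta_mx (ulift i) (ulift j)) f = 0].
Proof.
move=> SS SZ stab [f0 Sf0 f00].
pose Zge s f := exists u, (forall i, (w i < s)%N -> u i = 0) /\ f = lcomb g u.
(* A crude upper bound for all heights; [e] below counts the levels that remain. *)
pose M := (\sum_i w i)%N.
have ZM f : Zge M.+1 f -> f = 0.
  move=> [u [u0 ->]]; rewrite /lcomb big1 // => i _; rewrite u0 ?rmorph0 ?mul0r //.
  by rewrite ltnS /M (bigD1 i) //= leq_addr.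
suff H e s f : (M.+1 - s <= e)%N -> Zge s f -> S f -> f <> 0 ->
    exists f, [/\ S f, f <> 0 & forall i j : 'I_n, (j < i)%N ->
      act (delta_mx (ulift i) (ulift j)) f = 0].
  apply: (H _ 0%N f0 (leqnn _)) => //; have [u ->] := SZ _ Sf0.
  by exists u; split.
elim: e s f => [|e IH] s f se [u [u0 fE]] Sf fn0.
  case: fn0; apply: ZM; exists u; split=> // i iM; apply: u0; lia.
case: (classic (forall i j : 'I_n, (j < i)%N -> act (delta_mx (ulift i) (ulift j)) f = 0)) => [H|].
  by exists f.
move=> /not_all_ex_not [i /not_all_ex_not [j H']].
have [ij nz] := imply_to_and _ _ H'.
apply: (IH s.+1 _ _ _ _ nz); [by lia| |exact: stab].
have trd : \tr (delta_mx (ulift i) (ulift j) : 'M[F]_n.+1) = 0.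
  by rewrite mxtrace_delta (inj_eq lift_inj) (_ : (i == j) = false) //; apply/negbTE; rewrite neq_ltn ij orbT.
rewrite fE act_lcomb //.
exists (fun i' => \sum_x u x * rho (delta_mx (ulift i) (ulift j)) i' x); split=> //.
move=> i' wi'; rewrite big1 // => x _ /=.
have [r0|r0] := eqVneq (rho (delta_mx (ulift i) (ulift j)) i' x) 0; first by rewrite r0 mulr0.
rewrite ltnS in wi'; rewrite u0 ?mul0r //; apply: leq_trans wi'; apply: (unitary_family_height U) r0.
by rewrite !ulift_val.
Qed.

(** Projection is a field of the record because subspaces are bare predicates without bases; it
    comes from [orth_proj] in the space of coefficient vectors. *)
Record hform (h : Cpoly F n -> Cpoly F n -> F) : Prop := HForm {
  hformL : forall a f f' f2, Z f -> Z f' -> Z f2 ->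
    h (cst n a * f + f') f2 = a * h f f2 + h f' f2;
  hformC : forall f f', Z f -> Z f' -> h f f' = (h f' f)^*;
  hform_eq0 : forall f, Z f -> h f f = 0 -> f = 0;
  hform_act : forall A f f', \tr A = 0 -> Z f -> Z f' ->
    h (act A f) f' = h f (act (dagger A) f');
  hform_proj : forall S, subspace S -> (forall f, S f -> Z f) ->
    forall f, Z f -> exists2 a, S a & forall b, S b -> h (f - a) b = 0
}.

Lemma mxtrace_dagger p (A : 'M[F]_p) : \tr A = 0 -> \tr (dagger A) = 0.
Proof.
move=> trA; rewrite -(rmorph0 (@Num.conj F)) -trA rmorph_sum.
by apply: eq_bigr => i _; rewrite mxE.
Qed.

(* The orthogonal complement of the relations between the [g i] is stable and
   maps bijectively onto their span. *)
Lemma hform_ex : exists h, hform h.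
Proof.
pose lc (u : {ffun I -> F}) := lcomb g u.
have lcL c u v : lc (fsc c u + v) = cst n c * lc u + lc v.
  rewrite /lc lcombZ lcombD; apply: eq_bigr => i _; by rewrite !ffunE.
have lc0 : lc 0 = 0 by rewrite /lc /lcomb big1 // => i _; rewrite ffunE rmorph0 mul0r.
have fscN (x y : {ffun I -> F}) : x - y = fsc (-1) y + x.
  by apply/ffunP => t; rewrite !ffunE mulN1r addrC.
have lcB u v : lc (u - v) = lc u - lc v.
  by rewrite fscN lcL rmorphN rmorph1 mulN1r addrC.
pose ker u := lc u = 0.
have kerS : fsubspace ker.
  by split=> // c u v Hu Hv; rewrite /ker lcL Hu Hv mulr0 addr0.
pose coh u := forall b, ker b -> dot u b = 0.
have cohL c u v : coh u -> coh v -> coh (fsc c u + v).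
  by move=> Hu Hv b kb; rewrite dotDl dotZl Hu // Hv // mulr0 addr0.
have coh_inj u v : coh u -> coh v -> lc u = lc v -> u = v.
  move=> Hu Hv E; apply/eqP; rewrite -subr_eq0; apply/eqP/dot_eq0.
  have H : ker (u - v) by rewrite /ker lcB E subrr.
  by rewrite dotBl Hu // Hv // subrr.
have sex f : exists u, Z f -> lc u = f /\ coh u.
  case: (classic (Z f)) => [[u0 ->]|nZ]; last by exists 0.
  have [a [ka Ha]] := orth_proj kerS [ffun i => u0 i].
  exists ([ffun i => u0 i] - a) => _; split=> //.
  rewrite lcB ka subr0; by apply: eq_bigr => i _; rewrite ffunE.
(* The coefficient vector of f orthogonal to all relations. The form is the standard product of
   these representatives. *)
pose s f := proj1_sig (constructive_indefinite_description _ (sex f)).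
have sP f : Z f -> lc (s f) = f /\ coh (s f).
  exact: (proj2_sig (constructive_indefinite_description _ (sex f))).
have Zlc u : Z (lc u) by exists u.
have slc u : coh u -> s (lc u) = u.
  by move=> cu; have [E C] := sP _ (Zlc u); exact: coh_inj.
pose R A (u : {ffun I -> F}) : {ffun I -> F} := [ffun i' => \sum_i u i * rho A i' i].
have lcR A u : \tr A = 0 -> lc (R A u) = act A (lc u).
  by move=> trA; rewrite /lc act_lcomb //; apply: eq_bigr => i _; rewrite ffunE.
have dotR A u v : dot (R A u) v = dot u (R (dagger A) v).
  rewrite /dot; under eq_bigr do rewrite ffunE mulr_suml.
  rewrite exchange_big; apply: eq_bigr => i _; rewrite ffunE rmorph_sum mulr_sumr.
  apply: eq_bigr => i' _; rewrite (unitary_family_dagger U) rmorphM /= conjCK; ring.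
have Zact A f : \tr A = 0 -> Z f -> Z (act A f) by exact: Z_submodule.2.
(* [R A] preserves the complement of the relations because its adjoint [R (dagger A)] preserves the
   relations. *)
have sA A f : \tr A = 0 -> Z f -> s (act A f) = R A (s f).
  move=> trA Zf; have [E C] := sP f Zf.
  rewrite -{1}E -lcR // slc // => b kb; rewrite dotR; apply: C.
  by rewrite /ker lcR ?mxtrace_dagger // kb (clin0 (actL _)).
exists (fun f f' => dot (s f) (s f')); split.
- move=> a f f' f2 Zf Zf' Zf2; rewrite -dotZl -dotDl; congr (dot _ _).
  have [E C] := sP f Zf; have [E' C'] := sP f' Zf'.
  by rewrite -{1}E -{1}E' -lcL slc //; exact: cohL.
- by move=> f f' _ _; rewrite dotC.
- by move=> f Zf /dot_eq0 sf0; have [<- _] := sP f Zf; rewrite sf0.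
- by move=> A f f' trA Zf Zf'; rewrite !sA ?mxtrace_dagger // dotR.
- move=> S SS SZ f Zf.
  pose P u := S (lc u) /\ coh u.
  have PS : fsubspace P.
    split; first by split; [rewrite lc0; exact: subsp0|move=> b _; rewrite /dot big1 // => i _; rewrite ffunE mul0r].
    by move=> c u v [Su Cu] [Sv Cv]; split; [rewrite lcL; exact: SS.2|exact: cohL].
  have [a [[Sa Ca] Ha]] := orth_proj PS (s f).
  have [E C] := sP f Zf.
  exists (lc a) => // b Sb; have [Eb Cb] := sP b (SZ _ Sb).
  rewrite -{1}E -lcB slc; last by rewrite fscN; exact: cohL.
  by apply: Ha; split; rewrite ?Eb.
Qed.

(** If the submodule generated by 1 were smaller than the span, its orthogonal complement there
    would be nonzero and stable. It would then contain 1 too, and 1 would have norm 0. *)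
Lemma Gen1_Z f : Gen act 1 f <-> Z f.
Proof.
split; first by apply: (Gen_min Z_submodule); exact: Z1.
have [h H] := hform_ex => Zf.
have GS := Gen_submodule act 1.
have GZ x : Gen act 1 x -> Z x by apply: (Gen_min Z_submodule); exact: Z1.
have [a Ga Ha] := hform_proj H GS.1 GZ Zf.
have [<-//|fa] := classic (a = f).
have ZS := Z_subspace.
pose K x := Z x /\ forall b, Gen act 1 b -> h x b = 0.
have KS : subspace K.
  split; first split.
  - exact: subsp0 ZS.
  - move=> b Gb; have := hformL H (-1) Z1 Z1 (GZ _ Gb).
    by rewrite rmorphN rmorph1 mulN1r addNr mulN1r addNr.
  move=> c x y [Zx Hx] [Zy Hy]; split; first exact: ZS.2.
  by move=> b Gb; rewrite (hformL H) // ?Hx ?Hy ?mulr0 ?addr0 //; exact: GZ.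
have K1 : K 1.
  apply: (@constant_in_stable F n (ltn0Sn m) k) => //.
    move=> i j x ij [Zx Hx].
    have trd : \tr (delta_mx i j : 'M[F]_n.+1) = 0.
      by rewrite mxtrace_delta (_ : (i == j) = false) //; apply/negbTE; rewrite neq_ltn ij orbT.
    split; first exact: Z_submodule.2.
    move=> b Gb; rewrite (hform_act H) //; last exact: GZ.
    by apply: Hx; apply: GS.2 => //; exact: mxtrace_dagger.
  exists (f - a); last by move=> /eqP; rewrite subr_eq0 => /eqP E; apply: fa.
  by split=> //; apply: (subspB ZS) => //; exact: GZ.
have G1 : Gen act 1 1 by exact: Gen_gen.
have /(hform_eq0 H Z1) /eqP := K1.2 _ G1.
by rewrite oner_eq0.
Qed.

End Form.

(** Uniqueness of digits in base B; it lets a single diagonal matrix separate all exponent vectors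
    of a given degree. *)
Lemma digits_inj B N (a b : 'I_N -> nat) :
  (forall j, (a j < B)%N) -> (forall j, (b j < B)%N) ->
  (\sum_j a j * B ^ j = \sum_j b j * B ^ j)%N -> a =1 b.
Proof.
elim: N a b => [|N IH] a b aB bB E; first by case.
have split0 (c : 'I_N.+1 -> nat) :
    (\sum_j c j * B ^ j = c ord0 + (\sum_(j < N) c (lift ord0 j) * B ^ j) * B)%N.
  rewrite big_ord_recl muln1 big_distrl /=; congr (_ + _)%N; apply: eq_bigr => j _.
  by rewrite /bump add1n expnSr mulnA.
have B0 : (0 < B)%N by apply: leq_ltn_trans (aB ord0).
move: E; rewrite !split0 => E.
have E0 : a ord0 = b ord0.
  by have := congr1 (modn^~ B) E; rewrite ![(_ + _ * _)%N]addnC !modnMDl !modn_small.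
have {}E : (\sum_(j < N) a (lift ord0 j) * B ^ j = \sum_(j < N) b (lift ord0 j) * B ^ j)%N.
  by apply/eqP; rewrite -(eqn_pmul2r B0) -(eqn_add2l (a ord0)) {2}E0 E.
move=> j; case: (unliftP ord0 j) => [j' ->|->] //.
exact: (IH (fun j => a (lift ord0 j)) (fun j => b (lift ord0 j))).
Qed.

(** Applying T minus the eigenvalue of the first term removes that term and rescales the others by
    nonzero factors, which leads back to a shorter sum. *)
Lemma eigen_sep (F : fieldType) p (S : Cpoly F p -> Prop) T (B : eqType) (r : seq B) v (tau : B -> F) :
  subspace S -> clin T -> (forall f, S f -> S (T f)) -> uniq r ->
  (forall b, T (v b) = cst p (tau b) * v b) ->
  {in r &, injective tau} ->
  S (\sum_(b <- r) v b) -> forall b, b \in r -> S (v b).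
Proof.
move=> SS TL TS; elim: r v => [//|b0 r IH] v /= /andP [b0r ur] Tv tinj.
rewrite big_cons => Sv.
have Sr b : b \in r -> S (v b).
  move=> br; have nz : tau b - tau b0 != 0.
    rewrite subr_eq0; apply: contraNneq b0r => E.
    by rewrite -(tinj b b0 _ _ E) // inE ?eqxx // br orbT.
  have H : S (cst p (tau b - tau b0) * v b).
    apply: (IH (fun b => cst p (tau b - tau b0) * v b)) => //.
    - by move=> c; rewrite (clinZ TL) Tv; ring.
    - by move=> c e cr er; apply: tinj; rewrite inE ?cr ?er orbT.
    have := subspB SS (TS _ Sv) (subspZ (tau b0) SS Sv).
    rewrite (clinD TL) Tv mulrDr opprD addrACA subrr add0r (clin_sum TL) mulr_sumr -sumrB.
    congr S; apply: eq_bigr => c _; by rewrite Tv rmorphB mulrBl.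
  have := subspZ (tau b - tau b0)^-1 SS H.
  by rewrite mulrA -rmorphM mulVf // rmorph1 mul1r.
move=> b; rewrite inE => /orP [/eqP ->|]; last exact: Sr.
rewrite -[v b0](addrK (\sum_(b <- r) v b)); apply: subspB => //.
by rewrite big_seq; apply: subsp_sum.
Qed.

(** * Decomposition of the graded pieces *)

Section Decomposition.
Variables (F : numClosedFieldType) (m : nat) (k : nat -> nat).
Notation n := m.+1.
Variables (I : finType) (g : I -> Cpoly F n) (rho : 'M[F]_n.+1 -> I -> I -> F).
Variables (w : I -> nat) (d : nat).
Hypothesis U : @unitary_family F m k I g rho w d.
Local Notation act := (@sl_act F n k n).
Local Notation actC := (@corner_act F n k m).
Local Notation Z f := (exists u, f = lcomb g u).
Local Notation T := {ffun 'I_n -> 'I_d.+1}.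
Local Notation zm a := (zmon F (fun j => nat_of_ord (a j))).

Let actL A : clin (act A) := sl_act_clin (ltn0Sn m) k A.
Let ZS : subspace (fun f => Z f) := Z_subspace g.

Definition singular f := forall i j : 'I_n, (j < i)%N ->
  act (delta_mx (ulift i) (ulift j)) f = 0.

Lemma mxtrace_delta_neq (i j : 'I_n) : i != j -> \tr (delta_mx i j : 'M[F]_n) = 0.
Proof. by move=> ij; rewrite mxtrace_delta (negPf ij). Qed.

Lemma actC_delta (i j : 'I_n) f :
  actC (delta_mx i j) f = act (delta_mx (ulift i) (ulift j)) f.
Proof. by rewrite /corner_act corner_delta. Qed.

Lemma zmon_singular a : singular (zmon F a).
Proof.
move=> i j ij; rewrite -corner_delta sl_act_zmon.
- rewrite /zwt big1 ?add0r; last first.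
    move=> x _; rewrite mxE; case: eqP => [->|]; last by rewrite mulr0.
    by rewrite [i == j](_ : _ = false) ?mulr0 //; apply/negbTE; rewrite neq_ltn ij orbT.
  rewrite big1 ?rmorph0 ?mul0r // => x _; rewrite corner_delta mxE; case: eqP => [->|]; last by rewrite mulr0.
  by rewrite (inj_eq lift_inj) [i == j](_ : _ = false) ?mulr0 //; apply/negbTE; rewrite neq_ltn ij orbT.
- by rewrite mxtrace_delta_neq // neq_ltn ij orbT.
- move=> a' b ab; rewrite mxE; case: eqP => // ai; case: eqP => // bj.
  by move: ab; rewrite ai bj ltnNge ltnW.
Qed.

Lemma zmon_neq0 a : zmon F a <> 0 :> Cpoly F n.
Proof.
move=> /(congr1 (@slice F m)); rewrite slice_zmon rmorph0 => /eqP.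
rewrite -mul_mpolyC mulf_eq0 mpolyC_eq0 signr_eq0 /= => /eqP /(congr1 (mcoeff (zexp a))).
by rewrite mcoeffX eqxx mcoeff0 => /eqP; rewrite oner_eq0.
Qed.

Lemma singularB f f' : singular f -> singular f' -> singular (f - f').
Proof. by move=> Hf Hf' i j ij; rewrite (clinB (actL _)) Hf // Hf' // subrr. Qed.

Lemma singular_sum (J : finType) (P : pred J) (c : J -> F) v :
  (forall x, singular (v x)) -> singular (\sum_(x | P x) cst n (c x) * v x).
Proof.
move=> H i j ij; rewrite (clin_sum (actL _)) big1 // => x _.
by rewrite (clinZ (actL _)) H // mulr0.
Qed.

(** Every monomial of degree r on the slice is, up to sign, the restriction of one [zmon].
    Subtracting the combination with the same slice as f leaves 0 by [slice_inj]. *)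
Lemma singular_span r f : singular f -> homogeneous r f -> (r <= d)%N ->
  exists c : T -> F, f = \sum_(a : T | (\sum_j a j == r)%N) cst n (c a) * zm a.
Proof.
move=> sf hf rd.
pose c (a : T) := (-1) ^+ (\sum_(j < n) j.+1 * a j)%N * (slice f)@_(zexp (fun j => nat_of_ord (a j))).
exists c; apply/eqP; rewrite -subr_eq0; apply/eqP; apply: (@slice_inj F n (ltn0Sn m) k).
  by apply: singularB => //; apply: singular_sum => a; exact: zmon_singular.
rewrite rmorphB rmorph_sum; apply/mpolyP => mu; rewrite mcoeffB mcoeff0 [X in _ - X]raddf_sum.
have E (a : T) : (slice (cst n (c a) * zm a))@_mu =
    (slice f)@_mu * (zexp (fun j => nat_of_ord (a j)) == mu)%:R.
  rewrite rmorphM /= slice_cst slice_zmon mul_mpolyC scalerA mcoeffZ mcoeffX.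
  case: eqP => [<-|_]; last by rewrite !mulr0.
  by rewrite !mulr1 /c mulrAC -expr2 sqrr_sign mul1r.
rewrite (eq_bigr (fun a : T => (slice f)@_mu * (zexp (fun j => nat_of_ord (a j)) == mu)%:R)); last by move=> a _; exact: E.
have [mur|mur] := eqVneq (mdeg mu) r; last first.
  have -> : (slice f)@_mu = 0 by rewrite mcoeff_slice hf ?rmorph0.
  by rewrite big1 ?subrr // => a _; rewrite mul0r.
have muj j : (mu j <= d)%N.
  by apply: leq_trans rd; rewrite -mur mdegE (bigD1 j) //= leq_addr.
pose a0 : T := [ffun j => inord (mu (rev_ord j))].
have a0E j : a0 j = mu (rev_ord j) :> nat by rewrite ffunE inordK // ltnS.
have za0 : zexp (fun j => nat_of_ord (a0 j)) = mu.
  by apply/mnmP => c'; rewrite mnmE a0E rev_ordK.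
rewrite (bigD1 a0) /=; last first.
  by rewrite -(mdeg_zexp (fun j => nat_of_ord (a0 j))) za0 mur.
rewrite za0 eqxx mulr1 big1 ?addr0 ?subrr // => a /andP [_ aa0].
case: eqP => [za|]; last by rewrite mulr0.
case/eqP: aa0; apply/ffunP => j; apply: ord_inj.
exact: (zexp_inj (etrans za (esym za0)) j).
Qed.

(** On a monomial of exponent a the eigenvalue is the number with base d + 1 digits a_j, up to a
    term that depends only on the degree and on k. Subtracting the mean makes the matrix traceless;
    being real and diagonal, it is self-adjoint. *)
Definition Dsep : 'M[F]_n :=
  \matrix_(i, j) if i == j then (d.+1 ^ rev_ord i)%N%:R - (\sum_(x < n) d.+1 ^ x)%N%:R / n%:R else 0.

Lemma Dsep_tr : \tr Dsep = 0.
Proof.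
rewrite /mxtrace (eq_bigr (fun i : 'I_n => (d.+1 ^ rev_ord i)%N%:R - (\sum_(x < n) d.+1 ^ x)%N%:R / n%:R)).
  rewrite sumrB sumr_const card_ord -[X in _ - X]mulr_natr divfK ?pnatr_eq0 //.
  by rewrite natr_sum [X in _ - X](reindex_inj rev_ord_inj) /= subrr.
by move=> i _; rewrite mxE eqxx.
Qed.

Lemma Dsep_low (i j : 'I_n) : (i < j)%N -> Dsep i j = 0.
Proof. by move=> ij; rewrite mxE (_ : (i == j) = false) //; apply/negbTE; rewrite neq_ltn ij. Qed.

Lemma Dsep_dagger : dagger (corner Dsep) = corner Dsep.
Proof.
have E : dagger Dsep = Dsep.
  apply/matrixP => i j; rewrite !mxE eq_sym; case: eqP => [->|_]; last exact: rmorph0.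
  by rewrite rmorphB rmorph_nat fmorph_div !rmorph_nat.
apply: cornerP => [i j|i|j]; rewrite mxE ?corner_uu ?corner_um ?corner_mu ?rmorph0 //.
by rewrite -[in RHS]E [RHS]mxE.
Qed.

Lemma zwt_inj r (a b : T) : (\sum_j a j = r)%N -> (\sum_j b j = r)%N ->
  zwt k Dsep (fun j => a j) = zwt k Dsep (fun j => b j) -> a = b.
Proof.
move=> ar br /addIr; have E (c : T) : (\sum_j c j = r)%N ->
    \sum_j (c j)%:R * Dsep (rev_ord j) (rev_ord j) =
    (\sum_j c j * d.+1 ^ j)%N%:R - r%:R * ((\sum_(x < n) d.+1 ^ x)%N%:R / n%:R) :> F.
  move=> <-; rewrite !natr_sum mulr_suml -sumrB; apply: eq_bigr => j _.
  by rewrite mxE eqxx rev_ordK mulrBr natrM !natr_sum.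
rewrite !E // => /addIr /eqP; rewrite eqr_nat => /eqP H.
apply/ffunP => j; apply: ord_inj.
by apply: (digits_inj (B := d.+1) (a := fun j => a j) (b := fun j => b j)).
Qed.

Lemma Dsep_zmon a : act (corner Dsep) (zmon F a) = cst n (zwt k Dsep a) * zmon F a.
Proof. by apply: sl_act_zmon; [exact: Dsep_tr|exact: Dsep_low]. Qed.

Definition admissible r : {set T} :=
  [set a : T | (\sum_j a j == r)%N && [forall j, a j <= k j.+1]%N].

Lemma admissibleP r (a : T) : reflect ((\sum_j a j = r)%N /\ forall j, (a j <= k j.+1)%N) (a \in admissible r).
Proof.
rewrite inE; apply: (iffP andP) => [[/eqP H1 /forallP H2]|[H1 H2]]; first by split.
by split; [apply/eqP|apply/forallP].
Qed.

(** [Dsep] isolates the terms of f, so each monomial that occurs lies in the span itself, where the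
    degree in X excludes exponents beyond k. *)
Lemma Z_singular r f : Z f -> homogeneous r f -> singular f ->
  exists c : T -> F, f = \sum_(a in admissible r) cst n (c a) * zm a.
Proof.
move=> Zf hf sf; case: (leqP r d) => [rd|dr]; last first.
  exists (fun=> 0); rewrite big1; last by move=> a _; rewrite rmorph0 mul0r.
  apply: NNPP => f0; have := homogeneous_uniq hf (Z_deg U Zf) f0.
  by rewrite leqNgt dr.
have [c fE] := singular_span sf hf rd.
have Zc (a : T) : (\sum_j a j == r)%N -> Z (cst n (c a) * zm a).
  move=> ar; rewrite fE -big_filter in Zf.
  apply: (@eigen_sep F n _ (act (corner Dsep)) _ _ (fun a => cst n (c a) * zm a)
     (fun a : T => zwt k Dsep (fun j => a j)) ZS (actL _) _ _ _ _ Zf).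
  - by move=> x Zx; apply: (Z_submodule U).2; rewrite ?corner_tr ?Dsep_tr.
  - by rewrite filter_uniq // index_enum_uniq.
  - by move=> b; rewrite (clinZ (actL _)) Dsep_zmon; ring.
  - move=> b b'; rewrite !mem_filter => /andP [/eqP br _] /andP [/eqP b'r _].
    exact: zwt_inj br b'r.
  - by rewrite mem_filter ar mem_index_enum.
exists c; rewrite fE; apply/esym.
rewrite [RHS](bigID (fun a : T => [forall j, a j <= k j.+1]%N)) /= [X in _ = _ + X]big1 ?addr0.
  by apply: eq_bigl => a; rewrite inE.
move=> a /andP [ar /forallPn [j ajk]].
have [->|c0] := eqVneq (c a) 0; first by rewrite rmorph0 mul0r.
have := Z_theta U j (subspZ (c a)^-1 ZS (Zc a ar)).
rewrite mulrA -rmorphM mulVf // rmorph1 mul1r size_theta_zmon ltnS.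
by rewrite (negPf ajk).
Qed.

Lemma Z_corner : submodule actC (fun f => Z f).
Proof.
by split=> // A f trA Zf; apply: (Z_submodule U).2; rewrite ?corner_tr.
Qed.

Lemma homogeneous_corner r : submodule actC (homogeneous r).
Proof.
split; first by split=> [mu _|a f f' Hf Hf']; [rewrite raddf0|apply: homogeneousD => //; exact: homogeneous_cstM].
by move=> A f trA Hf; exact: coef_corner_homog.
Qed.

Definition graded_span r f := Z f /\ homogeneous r f.

Lemma graded_span_corner r : submodule actC (graded_span r).
Proof.
have [[H1 H2] H3] := Z_corner; have [[H4 H5] H6] := homogeneous_corner r.
split; first by split=> [|a f f' [Zf Hf] [Zf' Hf']]; split=> //; [exact: H2|exact: H5].
by move=> A f trA [Zf Hf]; split; [exact: H3|exact: H6].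
Qed.

Lemma sl_module_sub W : submodule actC W -> (forall f, W f -> Z f) -> sl_module actC W.
Proof.
move=> WS WZ; split=> //.
- by move=> A a f f' _ _ _; rewrite /corner_act; exact: actL.
- move=> A B a f _ _ _; rewrite /corner_act corner_lin.
  exact: (sl_act_mlin F (ltn0Sn m) k n).2.
- move=> A B f trA trB Wf; rewrite /corner_act cornerB !corner_mul.
  by apply: (Z_bracket U); rewrite ?corner_tr //; exact: WZ.
Qed.

Definition Gen_zmon (a : T) := Gen actC (zm a).

Lemma Gen_zmon_graded r a : a \in admissible r -> forall f, Gen_zmon a f -> graded_span r f.
Proof.
move=> /admissibleP [ar ak]; apply: Gen_min; first exact: graded_span_corner.
split; first exact: (Z_zmon U).
by rewrite -ar; exact: homogeneous_zmon.
Qed.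

Section WithForm.
Variable h : Cpoly F n -> Cpoly F n -> F.
Hypothesis H : hform k g h.

Lemma hform0l f : Z f -> h 0 f = 0.
Proof.
move=> Zf; have Z1 := Z1 U; have := hformL H (-1) Z1 Z1 Zf.
by rewrite rmorphN rmorph1 mulN1r addNr mulN1r addNr.
Qed.

Lemma hformZl c f f' : Z f -> Z f' -> h (cst n c * f) f' = c * h f f'.
Proof.
by move=> Zf Zf'; rewrite -[cst n c * f]addr0 (hformL H) ?hform0l ?addr0 //; exact: subsp0 ZS.
Qed.

Lemma hformZr c f f' : Z f -> Z f' -> h f (cst n c * f') = c^* * h f f'.
Proof.
move=> Zf Zf'; have Zc := subspZ c ZS Zf'.
by rewrite (hformC H) // hformZl // rmorphM /= -(hformC H).
Qed.

Lemma dagger_delta (i j : 'I_n.+1) : dagger (delta_mx i j : 'M[F]_n.+1) = delta_mx j i.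
Proof. by apply/matrixP => a b; rewrite !mxE rmorph_nat andbC. Qed.

Lemma dagger_corner (A : 'M[F]_n) : dagger (corner A) = corner (dagger A).
Proof.
by apply: cornerP => [i j|i|j]; rewrite mxE ?corner_uu ?corner_um ?corner_mu ?rmorph0 // mxE.
Qed.

Lemma orth_corner (W : Cpoly F n -> Prop) : submodule actC W -> (forall f, W f -> Z f) ->
  submodule actC (fun f => Z f /\ forall b, W b -> h f b = 0).
Proof.
move=> WS WZ; split; first split.
- by split; [exact: subsp0 ZS|move=> b Wb; apply: hform0l; exact: WZ].
- move=> a f f' [Zf Hf] [Zf' Hf']; split; first exact: ZS.2.
  by move=> b Wb; rewrite (hformL H) ?Hf ?Hf' ?mulr0 ?addr0 //; exact: WZ.
move=> A f trA [Zf Hf]; split; first exact: Z_corner.2.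
move=> b Wb; rewrite (hform_act H) ?corner_tr //; last exact: WZ.
rewrite dagger_corner; apply: Hf; apply: WS.2 => //; exact: mxtrace_dagger.
Qed.

Lemma zmon_orth r a b : a \in admissible r -> b \in admissible r -> a != b -> h (zm a) (zm b) = 0.
Proof.
move=> /admissibleP [ar ak] /admissibleP [br bk] ab.
have Za := Z_zmon U ak; have Zb := Z_zmon U bk.
have trH : \tr (corner Dsep) = 0 by rewrite corner_tr Dsep_tr.
have hb : h (zm b) (zm b) != 0.
  by apply/eqP => /(hform_eq0 H Zb); exact: zmon_neq0.
have E x (Zx : Z (zmon F x)) : zwt k Dsep x * h (zmon F x) (zm b) = (zwt k Dsep (fun j => b j))^* * h (zmon F x) (zm b).
  by have := hform_act H trH Zx Zb; rewrite Dsep_dagger !Dsep_zmon hformZl // hformZr.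
(* Pairing [zm b] with itself shows that its eigenvalue equals its own conjugate. *)
have /(mulIf hb) Eb := E _ Zb.
have /eqP := E _ Za; rewrite -Eb -subr_eq0 -mulrBl mulf_eq0 => /orP [|/eqP //].
by rewrite subr_eq0 => /eqP /(zwt_inj ar br) /eqP; rewrite (negPf ab).
Qed.

(* The analogue of [U(g) v = U(n_-) v] for a highest weight vector [v]. *)
Lemma Gen_lowering (a : T) (W : Cpoly F n -> Prop) : subspace W ->
  (forall j, (a j <= k j.+1)%N) -> W (zm a) ->
  (forall (i j : 'I_n) f, (i < j)%N -> Gen_zmon a f -> W (actC (delta_mx i j) f)) ->
  forall f, Gen_zmon a f -> W f.
Proof.
move=> WS ak Wa Wlow.
pose NG f := forall W, subspace W -> W (zm a) ->
  (forall (i j : 'I_n) f, (i < j)%N -> W f -> W (actC (delta_mx i j) f)) -> W f.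
have NGS : subspace NG.
  split=> [V VS _ _|c f f' Hf Hf' V VS Va Vl]; first exact: subsp0.
  by apply: VS.2; [exact: Hf|exact: Hf'].
have NGa : NG (zm a) by [].
have NGl (i j : 'I_n) f : (i < j)%N -> NG f -> NG (actC (delta_mx i j) f).
  by move=> ij Hf V VS Va Vl; exact: (Vl i j f ij (Hf V VS Va Vl)).
have Za := Z_zmon U ak.
(* [NG] is the closure of [zm a] under lowering operators alone. On [zm a] the lower triangular part
   of A acts by a scalar, and moving A past a lowering operator costs a commutator, again
   traceless. *)
have NGact f : NG f -> Z f /\ forall A, \tr A = 0 -> NG (actC A f).
  move=> Hf; apply: (Hf (fun x => Z x /\ forall A, \tr A = 0 -> NG (actC A x))) => {f Hf}.
  - split; first by split; [exact: subsp0 ZS|move=> A _; rewrite /corner_act (clin0 (actL _)); exact: subsp0 NGS].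
    move=> c f f' [Zf Hf] [Zf' Hf']; split; first exact: ZS.2.
    by move=> A trA; rewrite /corner_act actL; apply: NGS.2; [exact: Hf|exact: Hf'].
  - split=> // A trA.
    pose L : 'M[F]_n := \matrix_(i, j) if (i < j)%N then 0 else A i j.
    have AE : A = L + \sum_(i < n) \sum_(j < n | (i < j)%N) A i j *: delta_mx i j.
      rewrite {1}[A]matrix_sum_delta [L]matrix_sum_delta -big_split; apply: eq_bigr => i _ /=.
      rewrite [LHS](bigID (fun j : 'I_n => (i < j)%N)) /= addrC; congr (_ + _).
      rewrite [RHS](bigID (fun j : 'I_n => (i < j)%N)) /= [X in _ = X + _]big1 ?add0r.
        by apply: eq_bigr => j /negPf ij; rewrite mxE ij.
      by move=> j ij; rewrite mxE ij scale0r.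
    have trL : \tr L = 0.
      by rewrite -trA; apply: eq_bigr => i _; rewrite mxE ltnn.
    have CL := sl_act_mlin F (ltn0Sn m) k n.
    have cE : corner A = corner L + \sum_(i < n) \sum_(j < n | (i < j)%N) A i j *: corner (delta_mx i j).
      rewrite {1}AE; have cD (X Y : 'M[F]_n) : corner (X + Y) = corner X + corner Y.
        by have := corner_lin 1 X Y; rewrite !scale1r.
      have c0 : corner (0 : 'M[F]_n) = 0.
        by have := cornerB (0 : 'M[F]_n) 0; rewrite !subrr.
      have cZ x (X : 'M[F]_n) : corner (x *: X) = x *: corner X.
        by have := corner_lin x X 0; rewrite !addr0 c0 addr0.
      rewrite cD (big_morph _ cD c0); congr (_ + _); apply: eq_bigr => i _.
      by rewrite (big_morph _ cD c0); apply: eq_bigr => j _; rewrite cZ.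
    rewrite /corner_act cE (mlinD CL); refine (subspD NGS _ _).
      rewrite sl_act_zmon //; first by refine (subspZ _ NGS _).
      by move=> i j ij; rewrite mxE ij.
    rewrite (mlin_sum CL); refine (subsp_sum _ NGS _) => i _.
    rewrite (mlin_sum CL); refine (subsp_sum _ NGS _) => j ij.
    by rewrite (mlinZ CL); refine (subspZ _ NGS _); exact: NGl.
  - move=> i j f ij [Zf Hf].
    have ij' : i != j by rewrite neq_ltn ij.
    split; first by apply: Z_corner.2 => //; exact: mxtrace_delta_neq.
    move=> A trA; pose E : 'M[F]_n := delta_mx i j.
    have trE : \tr E = 0 by exact: mxtrace_delta_neq.
    have trAE : \tr (A *m E - E *m A) = 0 by rewrite raddfB /= mxtrace_mulC subrr.
    have -> : actC A (actC E f) = actC E (actC A f) + actC (A *m E - E *m A) f.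
      rewrite /corner_act cornerB !corner_mul (Z_bracket U) ?corner_tr //; ring.
    by refine (subspD NGS _ _); [apply: NGl => //; exact: Hf|exact: Hf].
have NGsub : submodule actC NG.
  by split=> // A f trA Hf; exact: (NGact f Hf).2.
move=> f Uf; suff [] : W f /\ Gen_zmon a f by [].
have Uf' : NG f by apply: Gen_min Uf.
apply: (Uf' (fun x => W x /\ Gen_zmon a x)).
- have [GS _] := Gen_submodule actC (zm a).
  by split; [split; exact: subsp0|move=> c x y [Wx Ux] [Wy Uy]; split; [exact: WS.2|exact: GS.2]].
- by split=> //; exact: Gen_gen.
- move=> i j x ij [Wx Ux]; split; first exact: Wlow.
  apply: (Gen_submodule actC (zm a)).2 => //; apply: mxtrace_delta_neq.
  by rewrite neq_ltn ij.
Qed.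

(** As orthogonal complements are submodules, f may be taken to be [zm a]. A lowering operator
    applied on the other side becomes a raising operator on [zm a] and gives 0. *)
Lemma Gen_zmon_orth r a b : a \in admissible r -> b \in admissible r -> a != b ->
  forall f f', Gen_zmon a f -> Gen_zmon b f' -> h f f' = 0.
Proof.
move=> aA bA ab f f' Uf Uf'.
have /admissibleP [ar ak] := aA; have /admissibleP [br bk] := bA.
have Za := Z_zmon U ak; have Zb := Z_zmon U bk.
have UZ c x : c \in admissible r -> Gen_zmon c x -> Z x by move=> cA /(Gen_zmon_graded cA) [].
have Gb := Gen_submodule actC (zm b).
have [_] : Z f /\ forall x, Gen_zmon b x -> h f x = 0; last by apply.
have OS := orth_corner Gb (fun x => UZ b x bA).
apply: (Gen_min OS) Uf; split=> // x Ux.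
suff [Zx hx] : Z x /\ h x (zm a) = 0 by rewrite (hformC H) // hx rmorph0.
apply: (Gen_lowering (a := b) (W := fun x => Z x /\ h x (zm a) = 0)) Ux => //.
- split; first by split; [exact: subsp0 ZS|exact: hform0l].
  move=> c y y' [Zy hy] [Zy' hy']; split; first exact: ZS.2.
  by rewrite (hformL H) // hy hy' mulr0 addr0.
- by split=> //; apply: zmon_orth bA aA _; rewrite eq_sym.
- move=> i j y ij Uy; have Zy := UZ b y bA Uy.
  have trE : \tr (delta_mx i j : 'M[F]_n) = 0 by apply: mxtrace_delta_neq; rewrite neq_ltn ij.
  split; first exact: Z_corner.2.
  rewrite actC_delta (hform_act H) // ?dagger_delta ?zmon_singular //; last first.
    by rewrite -corner_delta corner_tr.
  by rewrite (hformC H) ?hform0l ?rmorph0 //; exact: subsp0 ZS.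
Qed.

Lemma corner_singular (W : Cpoly F n -> Prop) : submodule actC W -> (forall f, W f -> Z f) ->
  (exists2 f, W f & f <> 0) -> exists f, [/\ W f, f <> 0 & singular f].
Proof.
move=> WS WZ; apply: (singular_ex U WS.1 WZ) => i j f ij Wf.
rewrite -actC_delta; apply: WS.2 => //; apply: mxtrace_delta_neq.
by rewrite neq_ltn ij orbT.
Qed.

(** A nonzero submodule contains a singular vector, hence a combination of admissible monomials;
    orthogonality to the other [Gen_zmon b] reduces it to a multiple of the generator. *)
Lemma Gen_zmon_irreducible r a : a \in admissible r -> irreducible actC (Gen_zmon a).
Proof.
move=> aA; have Gs := Gen_submodule actC (zm a).
have UZ x : Gen_zmon a x -> Z x by move=> /(Gen_zmon_graded aA) [].
split; first exact: sl_module_sub.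
  by exists (zm a); [exact: Gen_gen|exact: zmon_neq0].
move=> W WS WU; case: (classic (forall f, W f -> f = 0)) => [|nW]; first by left.
right; have [f [Wf f0 sf]] : exists f, [/\ W f, f <> 0 & singular f].
  apply: corner_singular => //; first by move=> x /WU /UZ.
  apply: NNPP => H'; apply: nW => f Wf; apply: NNPP => f0; apply: H'; by exists f.
have [Zf hf] := Gen_zmon_graded aA (WU _ Wf).
have [c fE] := Z_singular Zf hf sf.
have Zm b : b \in admissible r -> Z (zm b) by move=> /admissibleP [_ bk]; exact: (Z_zmon U).
have hsum (P : pred T) b : b \in admissible r -> (forall x, P x -> x \in admissible r) ->
    h (\sum_(x | P x) cst n (c x) * zm x) (zm b) = \sum_(x | P x) c x * h (zm x) (zm b).
  move=> bA PA; suff [] : Z (\sum_(x | P x) cst n (c x) * zm x) /\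
     h (\sum_(x | P x) cst n (c x) * zm x) (zm b) = \sum_(x | P x) c x * h (zm x) (zm b) by [].
  elim/big_rec2: _ => [|x y y' Px [Zy hy]]; first by split; [exact: subsp0 ZS|apply: hform0l; exact: Zm].
  split; first by apply: ZS.2 => //; exact: Zm (PA _ Px).
  by rewrite (hformL H) ?hy //; [exact: Zm (PA _ Px)|exact: Zm].
have cb b : b \in admissible r -> b != a -> c b = 0.
  move=> bA ba; have : h f (zm b) = 0.
    have ab : a != b by rewrite eq_sym.
    have Ub : Gen_zmon b (zm b) by exact: Gen_gen.
    exact: (Gen_zmon_orth aA bA ab (WU _ Wf) Ub).
  rewrite fE hsum // (bigD1 b) //= big1 ?addr0; last first.
    by move=> x /andP [xA xb]; rewrite (zmon_orth xA bA xb) mulr0.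
  move/eqP; rewrite mulf_eq0 => /orP [/eqP //|/eqP hb].
  by case: (@zmon_neq0 (fun j => nat_of_ord (b j))); exact: (hform_eq0 H (Zm _ bA)).
have fa : f = cst n (c a) * zm a.
  rewrite fE (bigD1 a) //= big1 ?addr0 // => b /andP [bA ba].
  by rewrite cb // rmorph0 mul0r.
have ca : c a != 0 by apply/eqP => E; apply: f0; rewrite fa E rmorph0 mul0r.
apply: Gen_min => //; have := subspZ (c a)^-1 WS.1 Wf.
by rewrite fa mulrA -rmorphM mulVf // rmorph1 mul1r.
Qed.

(** Were the sum of the [Gen_zmon] not the whole graded piece, its orthogonal complement would
    contain a nonzero singular vector. That vector is a combination of monomials, hence lies in the
    sum as well and has norm 0. *)
Lemma components r :
  [/\ sl_module actC (graded_span r),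
      forall i : 'I_#|admissible r|, irreducible actC (Gen_zmon (enum_val i)),
      forall f, graded_span r f <-> exists2 u : 'I_#|admissible r| -> Cpoly F n,
        forall i, Gen_zmon (enum_val i) (u i) & f = \sum_i u i
    & forall u : 'I_#|admissible r| -> Cpoly F n, (forall i, Gen_zmon (enum_val i) (u i)) ->
        \sum_i u i = 0 -> forall i, u i = 0].
Proof.
pose e (i : 'I_#|admissible r|) : T := enum_val i.
have eA i : e i \in admissible r by exact: enum_valP.
have Gs i := Gen_submodule actC (zm (e i)).
split.
- by apply: sl_module_sub; [exact: graded_span_corner|move=> f []].
- by move=> i; exact: Gen_zmon_irreducible (eA i).
- move=> f; pose S f := exists2 u : 'I_#|admissible r| -> Cpoly F n, forall i, Gen_zmon (e i) (u i) & f = \sum_i u i.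
  have SM x : S x -> graded_span r x.
    move=> [u Uu ->]; apply: subsp_sum => [|i _]; first exact: (graded_span_corner r).1.
    exact: Gen_zmon_graded (eA i) _ (Uu i).
  have SS : submodule actC S.
    split; first split.
    - exists (fun=> 0); last by rewrite big1.
      by move=> i; exact: subsp0 (Gs i).1.
    - move=> a _ _ [u Uu ->] [v Uv ->]; exists (fun i => scal a (u i) + v i).
        by move=> i; exact: ((Gs i).1.2 _ _ _ (Uu i) (Uv i)).
      by rewrite big_split /scal mulr_sumr.
    - move=> A _ trA [u Uu ->]; exists (fun i => actC A (u i)).
        by move=> i; exact: ((Gs i).2 _ _ trA (Uu i)).
      by rewrite /corner_act (clin_sum (actL _)).
  have SZ x : S x -> Z x by move=> /SM [].
  split; last exact: SM.
  move=> [Zf hf].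
  have [s Ss Hs] := hform_proj H SS.1 SZ Zf.
  have [<-//|fs] := classic (s = f).
  pose K x := (Z x /\ forall b, S b -> h x b = 0) /\ graded_span r x.
  have KS : submodule actC K.
    have [[O1 O2] O3] := orth_corner SS SZ; have [[G1 G2] G3] := graded_span_corner r.
    split; first by split=> [|a x y [Kx Gx] [Ky Gy]]; split=> //; [exact: O2|exact: G2].
    by move=> A x trA [Kx Gx]; split; [exact: O3|exact: G3].
  have [x [Kx x0 sx]] : exists x, [/\ K x, x <> 0 & singular x].
    apply: corner_singular => //; first by move=> x [_ []].
    exists (f - s); last by move=> /eqP; rewrite subr_eq0 => /eqP E; apply: fs.
    have gfs : graded_span r (f - s) by apply: (subspB (graded_span_corner r).1) => //; exact: SM.
    by split=> //; split=> //; exact: gfs.1.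
  have [[Zx Hx] [_ hx]] := Kx.
  have [c xE] := Z_singular Zx hx sx.
  have Sx : S x.
    rewrite xE; apply: (subsp_sum _ SS.1) => a aA; apply: (subspZ _ SS.1).
    exists (fun i => if e i == a then zm a else 0).
      move=> i; case: eqP => [<-|_]; first exact: Gen_gen.
      exact: subsp0 (Gs i).1.
    rewrite (bigD1 (enum_rank_in aA a)) //= /e enum_rankK_in // eqxx big1 ?addr0 // => i ia.
    case: eqP => // E; case/eqP: ia; apply: enum_val_inj.
    by rewrite enum_rankK_in.
  by case: x0; apply: (hform_eq0 H Zx); exact: Hx.
- move=> u Uu u0 i.
  have Zu j : Z (u j) by have [] := Gen_zmon_graded (eA j) (Uu j).
  have hsum (P : pred 'I_#|admissible r|) : Z (\sum_(j | P j) u j) /\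
      h (\sum_(j | P j) u j) (u i) = \sum_(j | P j) h (u j) (u i).
    elim/big_rec2: _ => [|j y y' _ [Zy hy]]; first by split; [exact: subsp0 ZS|exact: hform0l].
    split; first exact: (subspD ZS (Zu j) Zy).
    by have := hformL H 1 (Zu j) Zy (Zu i); rewrite rmorph1 !mul1r hy => ->.
  have [_] := hsum predT; rewrite u0 hform0l // (bigD1 i) //= big1 ?addr0.
    by move=> /esym /(hform_eq0 H (Zu i)).
  move=> j ji; apply: (Gen_zmon_orth (eA j) (eA i)) => //.
  by rewrite (inj_eq enum_val_inj).
Qed.

End WithForm.

End Decomposition.

(** * Highest weights of the extreme pieces and the number of components *)

Section Main.
Variables (F : numClosedFieldType) (m : nat) (k : nat -> nat).
Hypothesis m_gt0 : (0 < m)%N.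
Notation n := m.+1.
Notation l := (\sum_(1 <= i < n.+1) k i)%N.
Notation actM := (@sl_act F n k m).
Notation actC := (@corner_act F n k m).
Variables (I : finType) (g : I -> Cpoly F n) (rho : 'M[F]_n.+1 -> I -> I -> F).
Variables (w : I -> nat).
Hypothesis U : unitary_family k g rho w l.
Local Notation Z f := (exists u, f = lcomb g u).
Local Notation T := {ffun 'I_n -> 'I_l.+1}.
Local Notation zm a := (zmon F (fun j => nat_of_ord (a j))).

Lemma sum_weights : (\sum_(j < n) k j.+1 = l)%N.
Proof. by rewrite big_add1 big_mkord. Qed.

Lemma VgradedE r : Vgraded n k r = graded_span (m := m) g r.
Proof.
apply: functional_extensionality => f; apply: propositional_extensionality.
have E : Vmod n k f <-> Z f.
  by apply: iff_trans (Gen1_Z U f); apply: VmodE; rewrite ?leqnn.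
by split=> [[Vf hf]|[Zf hf]]; split; [exact/E|exact/homogeneousP|exact/E|exact/homogeneousP].
Qed.

Lemma VmodM : Vmod n k (m := m) = Gen actM 1.
Proof.
apply: functional_extensionality => f; apply: propositional_extensionality.
by apply: VmodE => //; rewrite m_gt0 leqnSn.
Qed.

Lemma sl_act_low1 p (A : 'M[F]_p.+1) : (p <= n)%N -> \tr A = 0 ->
  (forall i j : 'I_p.+1, (i < j)%N -> A i j = 0) ->
  sl_act n k A 1 = cst p (\sum_(i < p.+1) (tail_weight n k p i)%:R * A (rev_ord i) (rev_ord i)).
Proof.
move=> pn trA low; have [L HL] := flag_cocycle_ex F (ltn0Sn m) pn.
have [_ _ -> /(_ low) H] := HL A trA.
by rewrite rmorph_sum; apply: eq_bigr => i _; rewrite H rmorphM.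
Qed.

Lemma tail_weight_recl p i : (i < p)%N -> tail_weight n k p i = (k (n - p + i.+1) + tail_weight n k p i.+1)%N.
Proof. by move=> ip; rewrite /tail_weight big_ltn. Qed.

Lemma coroot_tr r : \tr (coroot F m r) = 0.
Proof. by rewrite raddfB /= !mxtrace_delta !eqxx subrr. Qed.

Lemma coroot_low r (i j : 'I_m.+1) : (i < j)%N -> coroot F m r i j = 0.
Proof.
move=> ij; have nij : i != j by rewrite neq_ltn ij.
have H (c : 'I_m.+1) : (i == c) && (j == c) = false.
  by apply/negbTE; apply: contra nij => /andP [/eqP -> /eqP ->].
by rewrite !mxE !H subrr.
Qed.

(** Reversal turns the diagonal positions m + 1 - r and m - r of h_r into r - 1 and r. *)
Lemma coroot_sum (G : nat -> F) r : (1 <= r <= m)%N ->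
  \sum_(i < m.+1) G i * coroot F m r (rev_ord i) (rev_ord i) = G r.-1 - G r.
Proof.
move=> /andP [r1 rm].
have H c : (c <= m)%N -> \sum_(i < m.+1) G i * (rev_ord i == inord (m - c))%:R = G c.
  move=> cm; have iE : (inord c : 'I_m.+1) = c :> nat by rewrite inordK.
  have rE : rev_ord (inord c) = inord (m - c) :> 'I_m.+1.
    by apply: ord_inj; rewrite /= iE inordK ?subSS // ltnS leq_subr.
  rewrite (bigD1 (inord c)) //= rE eqxx mulr1 iE big1 ?addr0 // => i ic.
  by rewrite -rE (inj_eq rev_ord_inj) (negPf ic) mulr0.
have rp : (m.+1 - r = m - r.-1)%N by case: r r1 rm => // r _ _; rewrite subSS.
rewrite -(H r.-1) ?(leq_trans (leq_pred r)) // -(H r) // -sumrB; apply: eq_bigr => i _.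
by rewrite /coroot rp !mxE !andbb mulrBr.
Qed.

Lemma incl_Z f : Gen actM 1 f -> Z (incl f).
Proof.
have Zs := Z_corner U; apply: (Gen_min (W := fun f => Z (incl f))); last exact: Z1 U.
split; first split.
- by rewrite rmorph0; exact: subsp0 Zs.1.
- move=> a x y Zx Zy.
  have -> : incl (scal a x + y) = scal a (incl x) + incl y by rewrite rmorphD rmorphM.
  exact: Zs.1.2.
- by move=> A x trA Zx; rewrite -corner_act_incl //; exact: (Zs.2 A _ trA Zx).
Qed.

Lemma M_irreducible : irreducible_of_highest_weight actM (Gen actM 1) (fun i => k i.+1).
Proof.
have Gs := Gen_submodule actM 1.
have AM := sl_act_mlin F (ltn0Sn m) k m.
split.
  split.
  - split=> //.
    + by move=> A a f f' _ _ _; exact: AM.1.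
    + by move=> A B a f _ _ _; exact: AM.2.
    (* The bracket relation is known on the span inside C_n and is pulled back along the injective
       [incl]. *)
    + move=> A B f trA trB Gf; apply: incl_inj.
      have trAB : \tr (A *m B - B *m A) = 0 by rewrite raddfB /= mxtrace_mulC subrr.
      rewrite raddfB /= -!corner_act_incl // cornerB !corner_mul.
      by apply: (Z_bracket U); rewrite ?corner_tr //; exact: incl_Z.
  - by exists 1; [exact: Gen_gen|move/eqP; rewrite oner_eq0].
  - move=> W WS WG; case: (classic (forall f, W f -> f = 0)) => [|nW]; first by left.
    right; apply: Gen_min => //; apply: (@constant_in_stable F n (ltn0Sn m) k) => //; first exact: WS.1.
      move=> i j f ij Wf; apply: WS.2 => //.
      by rewrite mxtrace_delta (_ : (i == j) = false) //; apply/negbTE; rewrite neq_ltn ij orbT.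
    by apply: NNPP => H; apply: nW => f Wf; apply: NNPP => f0; apply: H; exists f.
exists 1; first exact: Gen_gen.
split; first by move/eqP; rewrite oner_eq0.
- move=> i j ij; have nij : (i == j) = false by apply/negbTE; rewrite neq_ltn ij orbT.
  rewrite sl_act_low1 //; first last.
  + move=> a b ab; rewrite mxE; case: eqP => // ai; case: eqP => // bj.
    by move: ab; rewrite ai bj ltnNge ltnW.
  + by rewrite mxtrace_delta nij.
  rewrite big1 ?rmorph0 // => x _; rewrite mxE; case: eqP => [->|]; last by rewrite mulr0.
  by rewrite nij mulr0.
- move=> r r1; rewrite sl_act_low1 ?coroot_tr //; last exact: coroot_low.
  rewrite (coroot_sum (fun i => (tail_weight n k m i)%:R)) // /scal mulr1; congr cst.
  have /andP [r0 rm] := r1.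
  (* Consecutive tails differ by k_{n-m+r}, and n - m = 1 accounts for the shift of the weight. *)
  rewrite tail_weight_recl ?prednK // natrD addrK; congr (k _)%:R; lia.
Qed.

Let ktop : T := [ffun j : 'I_n => inord (k j.+1)].

Lemma ktopE (j : 'I_n) : ktop j = k j.+1 :> nat.
Proof. by rewrite ffunE inordK // ltnS -sum_weights (bigD1 j) //= leq_addr. Qed.

Lemma ktop_admissible : ktop \in admissible m k l l.
Proof.
apply/admissibleP; split; last by move=> j; rewrite ktopE.
by rewrite -[RHS]sum_weights; apply: eq_bigr => j _; rewrite ktopE.
Qed.

Lemma admissible_top a : a \in admissible m k l l -> a = ktop.
Proof.
move=> /admissibleP [al ak]; apply/ffunP => j; apply: ord_inj; rewrite ktopE; apply/eqP.
rewrite eqn_leq ak leqNgt; apply/negP => lt.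
have : (\sum_j a j < \sum_(j < n) k j.+1)%N.
  rewrite (bigD1 j) //= [X in (_ < X)%N](bigD1 j) //= -addSn; apply: leq_add => //.
  by apply: leq_sum => i _.
by rewrite al sum_weights ltnn.
Qed.

Lemma card_admissible_le r : (r <= l)%N -> (#|admissible m k l r| <= #|admissible m k l (l - r)|)%N.
Proof.
move=> rl; pose phi (a : T) : T := [ffun j : 'I_n => inord (k j.+1 - a j)].
have phiE a (j : 'I_n) : phi a j = (k j.+1 - a j)%N :> nat.
  by rewrite ffunE inordK // ltnS (leq_trans (leq_subr _ _)) // -sum_weights (bigD1 j) //= leq_addr.
rewrite -(card_in_imset (f := phi)).
  apply/subset_leq_card/subsetP => _ /imsetP [a /admissibleP [ar ak] ->]; apply/admissibleP; split.
    rewrite (eq_bigr (fun j : 'I_n => k j.+1 - a j)%N) => [|j _]; last exact: phiE.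
    by rewrite sumnB // ar sum_weights.
  by move=> j; rewrite phiE leq_subr.
move=> a b /admissibleP [_ ak] /admissibleP [_ bk] /ffunP E; apply/ffunP => j; apply: ord_inj.
have := congr1 (@nat_of_ord _) (E j); rewrite !phiE.
by move=> E2; rewrite -(subKn (ak j)) E2 subKn.
Qed.

Lemma card_admissible r : (r <= l)%N -> #|admissible m k l r| = #|admissible m k l (l - r)%N|.
Proof.
move=> rl; apply/eqP; rewrite eqn_leq card_admissible_le //=.
by have := card_admissible_le (leq_subr r l); rewrite subKn.
Qed.

(** In degree |λ| the only admissible exponent is k itself, so there is a single component. *)
Lemma top_irreducible : irreducible_of_highest_weight actC (graded_span (m := m) g l) k.
Proof.
have [h H] := hform_ex U.
have E : graded_span (m := m) g l = Gen_zmon k ktop.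
  apply: functional_extensionality => f; apply: propositional_extensionality.
  split=> [|Uf]; last exact: (Gen_zmon_graded U ktop_admissible).
  have [_ _ /(_ f) Hf _] := components U H l.
  move=> /Hf [u Uu ->]; apply: subsp_sum => [|i _].
    exact: (Gen_submodule actC (zm ktop)).1.
  by have := Uu i; rewrite (admissible_top (enum_valP i)).
split; first by rewrite E; exact: (Gen_zmon_irreducible U H ktop_admissible).
exists (zm ktop); first by rewrite E; exact: Gen_gen.
split; first exact: zmon_neq0.
- by move=> i j ij; rewrite actC_delta; exact: zmon_singular.
- move=> r r1; rewrite /corner_act sl_act_zmon ?coroot_tr //; last exact: coroot_low.
  rewrite /scal; congr (cst n _ * _); rewrite /zwt.
  rewrite (eq_bigr (fun j : 'I_n => (k j.+1)%:R * coroot F m r (rev_ord j) (rev_ord j))); last first.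
    by move=> j _; rewrite ktopE.
  rewrite (coroot_sum (fun j => (k j.+1)%:R)) //.
  rewrite big_ord_recl (_ : rev_ord ord0 = ord_max); last by apply: ord_inj; rewrite /= subn1.
  rewrite corner_um mulr0 add0r.
  rewrite (eq_bigr (fun i : 'I_n => (tail_weight n k n i.+1)%:R * coroot F m r (rev_ord i) (rev_ord i))); last first.
    move=> i _; rewrite lift0; have -> : rev_ord (lift ord0 i) = ulift (rev_ord i).
      by apply: ord_inj; rewrite ulift_val /= /bump.
    by rewrite corner_uu.
  rewrite (coroot_sum (fun i => (tail_weight n k n i.+1)%:R)) //.
  (* The monomial contributes k_r - k_{r+1} and the constant 1 contributes k_{r+1}. *)
  have /andP [r0 rm] := r1; rewrite prednK // (tail_weight_recl (i := r)) ?subnn ?add0n //.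
  by rewrite natrD addrK subrK.
Qed.

(** In degree 0 the only admissible exponent is 0, whose monomial is the constant 1. *)
Lemma bottom_incl f : graded_span (m := m) g 0 f <-> exists2 x, Gen actM 1 x & f = incl x.
Proof.
have [h H] := hform_ex U; split=> [gf|[x Gx ->]]; last first.
  by split; [exact: incl_Z|exact: homogeneous_incl].
have [_ _ /(_ f) Hf _] := components U H 0.
have GM := Gen_submodule actM 1.
have WS : submodule actC (fun f => exists2 x, Gen actM 1 x & f = incl x).
  split; first split.
  - by exists 0; [exact: subsp0 GM.1|rewrite rmorph0].
  - move=> a _ _ [x Gx ->] [y Gy ->]; exists (scal a x + y); last by rewrite rmorphD rmorphM.
    exact: (GM.1.2 _ _ _ Gx Gy).
  - move=> A _ trA [x Gx ->]; exists (actM A x); first exact: (GM.2 _ _ trA Gx).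
    by rewrite /corner_act corner_act_incl.
have [u Uu ->] := Hf.1 gf; apply: (subsp_sum _ WS.1) => i _.
apply: (Gen_min WS) (Uu i); exists 1; first exact: Gen_gen.
rewrite zmon0 ?rmorph1 // => j; have /admissibleP [s0 _] := enum_valP i.
apply/eqP; rewrite -leqn0; apply: leq_trans (eq_leq s0).
by rewrite (bigD1 j) //= leq_addr.
Qed.

End Main.

Theorem polynomial_realization_grading (F : numClosedFieldType) (m : nat) (hm : (1 <= m)%N) (k : nat -> nat) :
  let n := m.+1 in
  let l := (\sum_(1 <= i < n.+1) k i)%N in
  let M : Cpoly F m -> Prop := @Vmod F n k m in
  let Mbar (r : nat) : Cpoly F n -> Prop := @Vgraded F n k m r in
  let actM : 'M[F]_n -> Cpoly F m -> Cpoly F m := @sl_act F n k m in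
  let act : 'M[F]_n -> Cpoly F n -> Cpoly F n := @corner_act F n k m in
  (nontrivial (Mbar l) /\ (forall r : nat, nontrivial (Mbar r) -> (r <= l)%N)) /\
  (forall f, Mbar 0%N f <-> exists2 g, M g & f = incl g) /\
  (forall A g, \tr A = 0 -> M g -> act A (incl g) = incl (actM A g)) /\
  irreducible_of_highest_weight actM M (fun i => k i.+1) /\
  irreducible_of_highest_weight act (Mbar l) k /\
  (forall r : nat, (r <= l)%N ->
     exists N : nat, irreducible_components act (Mbar r) N /\
                     irreducible_components act (Mbar (l - r)%N) N).
Proof.
move=> n l M Mbar actM act.
have [I [g [rho [w U]]]] := unitary_family_ex F m k.
have [h H] := hform_ex U.
have VE r : Mbar r = graded_span g r by exact: (VgradedE U).
have ME : M = Gen actM 1 by exact: VmodM.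
split; first split.
- rewrite VE; exists (zmon F (fun j => k j.+1)); last exact: zmon_neq0.
  split; first exact: (Z_zmon U).
  by rewrite /l -sum_weights; exact: homogeneous_zmon.
- move=> r; rewrite VE => -[f [Zf hf] f0]; exact: homogeneous_uniq hf (Z_deg U Zf) f0.
split; first by move=> f; rewrite VE ME; exact: (bottom_incl U).
split; first by move=> A x trA _; rewrite /act /corner_act corner_act_incl.
split; first by rewrite ME; exact: (M_irreducible hm U).
split; first by rewrite VE; exact: (top_irreducible U).
move=> r rl; exists #|admissible m k l r|.
have comp q : irreducible_components act (Mbar q) #|admissible m k l q|.
  rewrite VE; have [C1 C2 C3 C4] := components U H q.
  by exists (fun i => Gen_zmon k (enum_val i)); split.
by split; [exact: comp|rewrite card_admissible //; exact: comp].
Qed.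

Theorem mainTheorem6 (R : realType) (m : nat) (hm : (1 <= m)%N) (k : nat -> nat) :
  (* n = m + 1 >= 2 *)
  let n := m.+1 in
  let l := (\sum_(1 <= i < n.+1) k i)%N in
  let M : Cpoly R[i] m -> Prop := @Vmod R[i] n k m in
  let Mbar (r : nat) : Cpoly R[i] n -> Prop := @Vgraded R[i] n k m r in
  (* the actions of sl(n) on C_{n-1} and on C_n *)
  let actM : 'M[R[i]]_n -> Cpoly R[i] m -> Cpoly R[i] m := @sl_act R[i] n k m in
  let act : 'M[R[i]]_n -> Cpoly R[i] n -> Cpoly R[i] n := @corner_act R[i] n k m in
  (* max { r | Mbar_r <> 0 } = |lambda| *)
  (nontrivial (Mbar l) /\ (forall r : nat, nontrivial (Mbar r) -> (r <= l)%N)) /\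
  (* Mbar_0 = M (identified with 1 (x) M), as sl(n)-modules *)
  (forall f, Mbar 0%N f <-> exists2 g, M g & f = incl g) /\
  (forall A g, \tr A = 0 -> M g -> act A (incl g) = incl (actM A g)) /\
  irreducible_of_highest_weight actM M (fun i => k i.+1) /\
  irreducible_of_highest_weight act (Mbar l) k /\
  (forall r : nat, (r <= l)%N ->
     exists N : nat, irreducible_components act (Mbar r) N /\
                     irreducible_components act (Mbar (l - r)%N) N).
Proof. exact: (@polynomial_realization_grading R[i] m hm k). Qed.
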